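(* In DL-Lite$_{\mathcal R}$, exhaustive rooted CCQ answering (CCQ answering restricted to DL-Lite$_{\mathcal R}$ knowledge bases and CCQs that are both exhaustive and rooted) is in $\mathsf{coNEXP}$ w.r.t. combined complexity.
   Context: Description logic: let $N_C$, $N_R$, $N_I$ be pairwise disjoint infinite sets of atomic concepts, atomic roles and individual names. A role is $P$ or $P^-$ with $P\in N_R$. An ABox $\mathcal A$ is a finite set of assertions $A(b)$, $P(a,b)$ ($A\in N_C$, $P\in N_R$, $a,b\in N_I$); $\mathsf{Ind}(\mathcal A)$ is the set of individuals occurring in it. A DL-Lite$_{\mathcal R}$ TBox is a finite set of concept inclusions $B_1\sqsubseteq B_2$ or $B_1\sqsubseteq\neg B_2$, where each $B_i$ is some $A\in N_C$ or $\exists R$ with $R$ a role, and role inclusions $R_1\sqsubseteq R_2$ or $R_1\sqsubseteq\neg R_2$ with $R_1,R_2$ roles. A knowledge base (KB) is a pair $\mathcal K=(\mathcal T,\mathcal A)$ of a TBox and an ABox. An interpretation $\mathcal I$ has a non-empty domain $\Delta^{\mathcal I}$ and maps each $A\in N_C$ to $A^{\mathcal I}\subseteq\Delta^{\mathcal I}$, each $P\in N_R$ to $P^{\mathcal I}\subseteq\Delta^{\mathcal I}\times\Delta^{\mathcal I}$, and individuals injectively to domain elements (unique name assumption); $(P^-)^{\mathcal I}$ is the converse of $P^{\mathcal I}$, $(\exists R)^{\mathcal I}=\{d\mid \exists d'\,(d,d')\in R^{\mathcal I}\}$, and $\neg$ is complement. $\mathcal I$ is a model of $\mathcal K$ if $F^{\mathcal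 I}\subseteq G^{\mathcal I}$ for every inclusion $F\sqsubseteq G$ in $\mathcal T$ and all assertions of $\mathcal A$ hold in $\mathcal I$. Counting queries: a counting conjunctive query (CCQ) is $q(\mathbf x)=\exists\mathbf y\,\exists\mathbf z\;\psi(\mathbf x,\mathbf y,\mathbf z)$, where $\mathbf x$ (answer variables), $\mathbf y$ (existential variables), $\mathbf z$ (counting variables) are disjoint tuples of variables and $\psi$ is a conjunction of atoms $A(t)$, $P(t_1,t_2)$ whose terms are individual names or variables from $\mathbf x\cup\mathbf y\cup\mathbf z$. A match of $q$ in $\mathcal I$ is a map $\sigma$ from the terms of $q$ to $\Delta^{\mathcal I}$ with $\sigma(a)=a^{\mathcal I}$ for individuals $a$, and satisfying all atoms of $\psi$. If $\sigma$ maps $\mathbf x$ to $\mathbf a^{\mathcal I}$, its restriction to $\mathbf z$ is a counting match (c-match) of $q(\mathbf a)$ in $\mathcal I$. $q$ is exhaustive if it has no existential variables ($\mathbf y=\emptyset$). The Gaifman graph of $q$ has the terms of $q$ as vertices and an edge $\{t_1,t_2\}$ iff $t_1,t_2$ co-occur in a role atom of $q$; $q$ is rooted if every connected component of its Gaifman graph contains at least one answer variable or individual name. CCQ answering: given a KB $\mathcal K=(\mathcal T,\mathcal A)$, a CCQ $q$, a tuple $\mathbf a$ of individuals of $\mathcal A$ and an integer $m$ in binary, decide whether $(\mathbf a,[m,+\infty])$ is a certain answer to $q$ w.r.t. $\mathcal K$, i.e. whether every model of $\mathcal K$ has at least $m$ c-matches of $q(\mathbf a)$. Combined complexity: measured in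 the size of the whole input $\mathcal T,\mathcal A,q,\mathbf a,m$. *)

(* Defs.v *)
(* MathComp world (plain MathComp; List.In and the reflexive-transitive closure
   come from Stdlib). *)
From HB Require Import structures.
From mathcomp Require Import all_boot all_order all_algebra.
From Stdlib Require List Relation_Operators.

Set Implicit Arguments.
Unset Strict Implicit.
Unset Printing Implicit Defensive.

(** * Nondeterministic multitape Turing machines *)

Inductive move := MoveL | MoveN | MoveR.

Definition code_move (d : move) : 'I_3 :=
  match d with MoveL => inord 0 | MoveN => inord 1 | MoveR => inord 2 end.
Definition decode_move (i : 'I_3) : move :=
  match val i with 0 => MoveL | 1 => MoveN | _ => MoveR end.
Lemma code_moveK : cancel code_move decode_move.
Proof. by case; rewrite /decode_move /= inordK. Qed.
HB.instance Definition _ := Finite.copy move (can_type code_moveK).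

(* The blank is None and the input alphabet is {0,1}; every machine chooses its
   own further tape symbols. *)
Definition tape_symbol (work : finType) : finType := option (bool + work)%type.

Record ntm := NTM {
  state : finType;
  work : finType;
  ntapes : nat;     (* the machine has ntapes.+1 tapes *)
  start : state;
  accepting : {set state};
  trans : state -> {ffun 'I_ntapes.+1 -> tape_symbol work} ->
    {set (state * {ffun 'I_ntapes.+1 -> tape_symbol work * move})%type}
}.

Section Tapes.
Variable work : finType.
Let symbol := tape_symbol work.

(* Two-way infinite tape (l, r): the head scans the first symbol of r, the
   symbols to its left are those of l, nearest first, and all remaining cells
   are blank. *)
Definition tape := (seq symbol * seq symbol)%type.

Definition scan (t : tape) : symbol := head None t.2.

Definition write_move (t : tape) (a : symbol * move) : tape :=
  match a.2 with
  | MoveL => (behead t.1, head None t.1 :: a.1 :: behead t.2)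
  | MoveN => (t.1, a.1 :: behead t.2)
  | MoveR => (a.1 :: t.1, behead t.2)
  end.
End Tapes.

Section Computations.
Variable M : ntm.

Definition config := (state M * {ffun 'I_(ntapes M).+1 -> tape (work M)})%type.

Definition init (w : seq bool) : config :=
  (start M, [ffun i => if i == ord0 then ([::], [seq Some (inl b) | b <- w])
                       else ([::], [::])]).

Definition step (c d : config) : Prop :=
  exists2 t, t \in trans c.1 [ffun i => scan (c.2 i)] &
    d = (t.1, [ffun i => write_move (c.2 i) (t.2 i)]).

Inductive computation (c : config) : nat -> config -> Prop :=
| computation0 : computation c 0 c
| computationS n d e : computation c n d -> step d e -> computation c n.+1 e.

Definition accepts (w : seq bool) : Prop :=
  exists n c, computation (init w) n c /\ c.1 \in accepting M.

Definition runs_in_time (f : nat -> nat) : Prop :=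
  forall w n c, computation (init w) n c -> n <= f (size w).
End Computations.

(** * Complexity classes of languages over {0,1} *)

Definition language := seq bool -> Prop.

Definition NEXP (L : language) : Prop :=
  exists (M : ntm) (p : {poly nat}),
    runs_in_time M (fun n => 2 ^ p.[n]%R) /\ forall w, L w <-> accepts M w.

Definition coNEXP (L : language) : Prop := NEXP (fun w => ~ L w).

(** * DL-Lite_R *)

(* Names and variables are binary words.  The sets of names are disjoint in the
   sense that every occurrence of a word is of exactly one sort, determined by
   its position. *)
Definition concept_name : eqType := seq bool.
Definition role_name : eqType := seq bool.
Definition individual : eqType := seq bool.
Definition variable : eqType := seq bool.

Inductive role := Direct of role_name | Inverse of role_name.

Inductive basic_concept := Atomic of concept_name | Exists of role.

Inductive inclusion :=
| ConceptIncl of basic_concept & basic_concept      (* B1 [= B2 *)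
| ConceptDisj of basic_concept & basic_concept      (* B1 [= ~ B2 *)
| RoleIncl of role & role                           (* R1 [= R2 *)
| RoleDisj of role & role.                          (* R1 [= ~ R2 *)

Inductive assertion :=
| ConceptAssertion of concept_name & individual
| RoleAssertion of role_name & individual & individual.

(* Finite sets of inclusions and of assertions are presented as lists. *)
Definition tbox := seq inclusion.
Definition abox := seq assertion.
Record kb := KB { kb_tbox : tbox; kb_abox : abox }.

Definition assertion_inds (F : assertion) : seq individual :=
  match F with
  | ConceptAssertion _ b => [:: b]
  | RoleAssertion _ a b => [:: a; b]
  end.

Definition Ind (A : abox) : seq individual := flatten (map assertion_inds A).

(* The domain is non-empty since it contains the interpretation of some name. *)
Record interpretation := Interpretation {
  domain : Type;
  concept_int : concept_name -> domain -> Prop;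
  role_int : role_name -> domain -> domain -> Prop;
  ind_int : individual -> domain;
  ind_int_inj : injective ind_int
}.

Section Semantics.
Variable I : interpretation.

Definition role_ext (R : role) (d e : domain I) : Prop :=
  match R with
  | Direct P => role_int P d e
  | Inverse P => role_int P e d
  end.

Definition concept_ext (B : basic_concept) (d : domain I) : Prop :=
  match B with
  | Atomic A => concept_int A d
  | Exists R => exists e, role_ext R d e
  end.

Definition sat_inclusion (F : inclusion) : Prop :=
  match F with
  | ConceptIncl B1 B2 => forall d, concept_ext B1 d -> concept_ext B2 d
  | ConceptDisj B1 B2 => forall d, concept_ext B1 d -> ~ concept_ext B2 d
  | RoleIncl R1 R2 => forall d e, role_ext R1 d e -> role_ext R2 d e
  | RoleDisj R1 R2 => forall d e, role_ext R1 d e -> ~ role_ext R2 d e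
  end.

Definition sat_assertion (F : assertion) : Prop :=
  match F with
  | ConceptAssertion A b => concept_int A (ind_int I b)
  | RoleAssertion P a b => role_int P (ind_int I a) (ind_int I b)
  end.

Definition model (K : kb) : Prop :=
  (forall F, List.In F (kb_tbox K) -> sat_inclusion F) /\
  (forall F, List.In F (kb_abox K) -> sat_assertion F).
End Semantics.

(** * Counting conjunctive queries *)

Inductive term := Var of variable | Cst of individual.

Inductive atom :=
| ConceptAtom of concept_name & term
| RoleAtom of role_name & term & term.

Definition atom_terms (F : atom) : seq term :=
  match F with
  | ConceptAtom _ t => [:: t]
  | RoleAtom _ t u => [:: t; u]
  end.

Record query := Query {
  answer_vars : seq variable;
  exist_vars : seq variable;
  count_vars : seq variable;
  body : seq atom
}.

Definition query_vars (q : query) : seq variable :=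
  answer_vars q ++ exist_vars q ++ count_vars q.

Definition disjoint_seqs (s t : seq variable) : bool :=
  ~~ has [in s] t.

Definition is_ccq (q : query) : Prop :=
  [/\ disjoint_seqs (answer_vars q) (exist_vars q),
      disjoint_seqs (answer_vars q) (count_vars q),
      disjoint_seqs (exist_vars q) (count_vars q)
    & forall F v, List.In F (body q) -> List.In (Var v) (atom_terms F) ->
        v \in query_vars q].

(* Every variable of the query is a term of it, even if it is in no atom. *)
Definition query_term (q : query) (t : term) : Prop :=
  (exists2 v, v \in query_vars q & t = Var v) \/
  (exists2 F, List.In F (body q) & List.In t (atom_terms F)).

Section Matches.
Variables (I : interpretation) (q : query).

Definition term_val (s : variable -> domain I) (t : term) : domain I :=
  match t with Var v => s v | Cst a => ind_int I a end.

Definition sat_atom (s : variable -> domain I) (F : atom) : Prop :=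
  match F with
  | ConceptAtom A t => concept_int A (term_val s t)
  | RoleAtom P t u => role_int P (term_val s t) (term_val s u)
  end.

Definition is_match (s : variable -> domain I) : Prop :=
  forall F, List.In F (body q) -> sat_atom s F.

(* The restriction of a match to the counting variables z is represented by the
   tuple of its values on z. *)
Definition c_match (a : seq individual) (c : seq (domain I)) : Prop :=
  exists s, [/\ is_match s,
                map s (answer_vars q) = map (ind_int I) a
              & c = map s (count_vars q)].

Definition at_least_c_matches (a : seq individual) (m : nat) : Prop :=
  exists f : 'I_m -> seq (domain I),
    injective f /\ forall i, c_match a (f i).
End Matches.

(* (a, [m, +oo]) is a certain answer to q over K. *)
Definition certain_answer (K : kb) (q : query) (a : seq individual) (m : nat) :
    Prop :=
  forall I : interpretation, model I K -> at_least_c_matches I q a m.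

Definition exhaustive (q : query) : Prop := exist_vars q = [::].

Definition gaifman_edge (q : query) (t u : term) : Prop :=
  exists P, List.In (RoleAtom P t u) (body q) \/
            List.In (RoleAtom P u t) (body q).

Definition gaifman_connected (q : query) : term -> term -> Prop :=
  Relation_Operators.clos_refl_trans term (gaifman_edge q).

Definition anchor (q : query) (t : term) : Prop :=
  match t with Var v => v \in answer_vars q | Cst _ => True end.

Definition rooted (q : query) : Prop :=
  forall t, query_term q t -> exists2 u, gaifman_connected q t u & anchor q u.

(** * The decision problem as a language *)

Record instance := Instance {
  inst_kb : kb;
  inst_query : query;
  inst_answer : seq individual;
  inst_bound : nat
}.

Definition is_instance (x : instance) : Prop :=
  [/\ is_ccq (inst_query x),
      size (inst_answer x) = size (answer_vars (inst_query x))
    & {subset inst_answer x <= Ind (kb_abox (inst_kb x))}].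

(* All the codes below are prefix-free, hence can be concatenated without
   ambiguity; in a list every item is preceded by 1, and the list is closed by
   0.  Code lengths are linear in the number of symbols, with names written
   out in full. *)
Definition enc_list (T : Type) (enc : T -> seq bool) (s : seq T) : seq bool :=
  flatten [seq true :: enc x | x <- s] ++ [:: false].

Definition enc_word (w : seq bool) : seq bool := enc_list (fun b => [:: b]) w.

(* Binary digits of m, least significant first and without leading zeros. *)
Definition binary_digits (m : nat) : seq bool :=
  mkseq (fun i => odd (m %/ 2 ^ i)) (up_log 2 m.+1).

Definition enc_nat (m : nat) : seq bool := enc_word (binary_digits m).

Definition enc_role (R : role) : seq bool :=
  match R with
  | Direct P => false :: enc_word P
  | Inverse P => true :: enc_word P
  end.

Definition enc_basic_concept (B : basic_concept) : seq bool :=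
  match B with
  | Atomic A => false :: enc_word A
  | Exists R => true :: enc_role R
  end.

Definition enc_inclusion (F : inclusion) : seq bool :=
  match F with
  | ConceptIncl B1 B2 =>
      [:: false; false] ++ enc_basic_concept B1 ++ enc_basic_concept B2
  | ConceptDisj B1 B2 =>
      [:: false; true] ++ enc_basic_concept B1 ++ enc_basic_concept B2
  | RoleIncl R1 R2 => [:: true; false] ++ enc_role R1 ++ enc_role R2
  | RoleDisj R1 R2 => [:: true; true] ++ enc_role R1 ++ enc_role R2
  end.

Definition enc_assertion (F : assertion) : seq bool :=
  match F with
  | ConceptAssertion A b => false :: enc_word A ++ enc_word b
  | RoleAssertion P a b => true :: enc_word P ++ enc_word a ++ enc_word b
  end.

Definition enc_kb (K : kb) : seq bool :=
  enc_list enc_inclusion (kb_tbox K) ++ enc_list enc_assertion (kb_abox K).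

Definition enc_term (t : term) : seq bool :=
  match t with
  | Var v => false :: enc_word v
  | Cst a => true :: enc_word a
  end.

Definition enc_atom (F : atom) : seq bool :=
  match F with
  | ConceptAtom A t => false :: enc_word A ++ enc_term t
  | RoleAtom P t u => true :: enc_word P ++ enc_term t ++ enc_term u
  end.

Definition enc_query (q : query) : seq bool :=
  enc_list enc_word (answer_vars q) ++ enc_list enc_word (exist_vars q) ++
  enc_list enc_word (count_vars q) ++ enc_list enc_atom (body q).

Definition encode (x : instance) : seq bool :=
  enc_kb (inst_kb x) ++ enc_query (inst_query x) ++
  enc_list enc_word (inst_answer x) ++ enc_nat (inst_bound x).

(* CCQ answering restricted to the queries in C. *)
Definition ccq_answering (C : query -> Prop) : language := fun w =>
  exists x : instance,
    [/\ w = encode x, is_instance x, C (inst_query x)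
      & certain_answer (inst_kb x) (inst_query x) (inst_answer x)
          (inst_bound x)].

(* Main.v *)
(* By contraposition it suffices to recognize in nondeterministic exponential time
   the words that are not positive instances.

   If a model has fewer than m counting matches, it can be collapsed to one of
   exponential size that still has fewer than m.  Keep the individuals and the
   values of the matches (the roots), unravel the rest of the model from the
   roots by successors to a depth exceeding the number of terms of the query,
   and merge deeper elements according to their types.  A match of a rooted query
   cannot reach the merged part, so it comes from a match of the original model;
   for an exhaustive query every term of the match is a root, so that no counting
   match is created.

   Hence the negative instances are the words [w] for which some first-order
   sentence holds in a structure with elements the numbers less than
   2 ^ (|w| + 5) ^ 3 and relations that can be guessed: tables describe the
   countermodel and the assignments, and further tables make it possible to parse
   [w] in first-order logic.  Such existential second-order definable languages
   are in NEXP: a machine guesses the tables and evaluates the sentence, its tapes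
   holding numbers in unary. *)

Require Import Defs.
From HB Require Import structures.
From mathcomp Require Import all_boot all_order all_algebra.
From mathcomp Require Import boolp zify.
From Stdlib Require Relations.Operators_Properties.
Set Implicit Arguments.
Unset Strict Implicit.
Unset Printing Implicit Defensive.

(** * Structured programs over tapes *)

(** Checking a countermodel directly on tapes would need a separate program for every syntactic
    notion. With a logic over a fixed vocabulary, one evaluator, running in time polynomial in the
    number [N] of elements, does all the machine work. First-order quantifiers are strong enough
    because [N] is large: every set of input positions is coded by an element, so reachability
    (along the items of a list, or in the Gaifman graph) becomes quantification over coded sets; and
    every assignment of domain elements to the names of the input is coded, so matches can be
    quantified too. The collapsed model of an input of length [n] has at most [2 ^ ((n + 5) ^ 2)]
    elements, hence at most [2 ^ ((n + 5) ^ 3)] assignments to its at most [n] names: this is the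
    origin of the cubic exponent. That there are fewer than [m] counting matches is certified by
    labels below [m - 1], matches with equal labels agreeing on the counting variables. The obstacle
    to collapsing is role disjointness: all pairs of elements from which the roles between two nodes
    are copied must have the same roles, so merged nodes may only be linked in one direction. *)

Notation symbol := (tape_symbol void).
Definition bsym (b : bool) : symbol := Some (inl b).

(* A tape is given by the contents of its cells and the position of its head;
   all positions are relative to the initial position of the head. *)
Definition ztape := ((int -> symbol) * int)%type.

Definition shift (d : move) (z : int) : int :=
  match d with MoveL => z - 1 | MoveN => z | MoveR => z + 1 end%R.

Definition zscan (x : ztape) : symbol := x.1 x.2.

Definition zact (x : ztape) (a : symbol) (d : move) : ztape :=
  (fun z => if z == x.2 then a else x.1 z, shift d x.2).

(** The lists are compared with the cells through [nth None], hence up to trailing blanks, which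
    moves of the head may add. *)
Definition represents (t : tape void) (x : ztape) : Prop :=
  forall i : nat, nth None t.2 i = x.1 (x.2 + i%:Z)%R /\
                  nth None t.1 i = x.1 (x.2 - i.+1%:Z)%R.

Lemma represents_scan t x : represents t x -> scan t = zscan x.
Proof. by move=> /(_ 0)[+ _]; rewrite nth0 GRing.addr0. Qed.

Lemma represents_act t x a d :
  represents t x -> represents (write_move t (a, d)) (zact x a d).
Proof.
case: t => l r; case: x => f p H i; rewrite /zact /write_move /=.
have Hl k z : z = (p - k.+1%:Z)%R -> nth None l k = f z.
  by move=> ->; case: (H k).
have Hr k z : z = (p + k%:Z)%R -> nth None r k = f z.
  by move=> ->; case: (H k).
case: d => /=; split.
- case: i => [|[|i]] /=.
  + by rewrite -nth0 ifF; [apply: Hl|]; lia.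
  + by rewrite ifT //; lia.
  + by rewrite nth_behead ifF; [apply: Hr|]; lia.
- by rewrite nth_behead ifF; [apply: Hl|]; lia.
- case: i => [|i] /=; first by rewrite ifT //; lia.
  by rewrite nth_behead ifF; [apply: Hr|]; lia.
- by rewrite ifF; [apply: Hl|]; lia.
- by rewrite nth_behead ifF; [apply: Hr|]; lia.
- case: i => [|i] /=; first by rewrite ifT //; lia.
  by rewrite ifF; [apply: Hl|]; lia.
Qed.

(* The guesses of a run are drawn from a stream of bits, which makes runs
   deterministic. *)
Record mem := Mem { tp : nat -> ztape; orc : nat -> bool }.

Definition upd (s : mem) (i : nat) (x : ztape) : mem :=
  Mem (fun k => if k == i then x else tp s k) (orc s).

Definition ask (s : mem) : mem := Mem (tp s) (fun k => orc s k.+1).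

Inductive prog :=
| PMove (i : nat) (d : move)
| PWrite (i : nat) (a : symbol)
| PGuess (i : nat)
| PSeq (c1 c2 : prog)
| PIf (i : nat) (a : symbol) (c1 c2 : prog)   (* is [a] scanned on tape [i]? *)
| PWhile (i : nat) (a : symbol) (c : prog).   (* until [a] is scanned *)

(** The number counts the steps of the compiled machine exactly, one for each elementary instruction
    and each test, so that [exec_dsteps] preserves it without slack. *)
Inductive exec : prog -> mem -> nat -> mem -> Prop :=
| exec_move i d s : exec (PMove i d) s 1 (upd s i (zact (tp s i) (zscan (tp s i)) d))
| exec_write i a s : exec (PWrite i a) s 1 (upd s i (zact (tp s i) a MoveN))
| exec_guess i s :
    exec (PGuess i) s 1 (upd (ask s) i (zact (tp s i) (bsym (orc s 0)) MoveN))
| exec_seq c1 c2 s n1 s1 n2 s2 : exec c1 s n1 s1 -> exec c2 s1 n2 s2 ->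
    exec (PSeq c1 c2) s (n1 + n2) s2
| exec_if i a c1 c2 s n s' :
    exec (if zscan (tp s i) == a then c1 else c2) s n s' ->
    exec (PIf i a c1 c2) s n.+1 s'
| exec_exit i a c s : zscan (tp s i) = a -> exec (PWhile i a c) s 1 s
| exec_loop i a c s n1 s1 n2 s2 : zscan (tp s i) != a ->
    exec c s n1 s1 -> exec (PWhile i a c) s1 n2 s2 ->
    exec (PWhile i a c) s (1 + n1 + n2) s2.

(** * Compilation to Turing machines *)

(** In a conditional or a loop, [None] is the state that performs the test. *)
Fixpoint control (c : prog) : finType :=
  match c with
  | PMove _ _ | PWrite _ _ | PGuess _ => unit
  | PSeq c1 c2 => (control c1 + control c2)%type
  | PIf _ _ c1 c2 => option (control c1 + control c2)
  | PWhile _ _ c => option (control c)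
  end.

Fixpoint entry (c : prog) : control c :=
  match c with
  | PMove _ _ | PWrite _ _ | PGuess _ => tt
  | PSeq c1 c2 => inl (entry c1)
  | PIf _ _ c1 c2 => None
  | PWhile _ _ c => None
  end.

(* Each step acts on a single tape, given by its index. *)
Definition action := (nat * (symbol * move))%type.

Definition noop (f : nat -> symbol) : action := (0, (f 0, MoveN)).

(* The next control state is [None] when the program is left. *)
Fixpoint delta (c : prog) :
    control c -> (nat -> symbol) -> bool -> option (control c) * action :=
  match c return control c -> (nat -> symbol) -> bool -> option (control c) * action with
  | PMove i d => fun _ f _ => (None, (i, (f i, d)))
  | PWrite i a => fun _ f _ => (None, (i, (a, MoveN)))
  | PGuess i => fun _ f b => (None, (i, (bsym b, MoveN)))
  | PSeq c1 c2 => fun q f b =>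
      match q with
      | inl q => let r := delta q f b in
                 (Some (oapp inl (inr (entry c2)) r.1), r.2)
      | inr q => let r := delta q f b in (omap inr r.1, r.2)
      end
  | PIf i a c1 c2 => fun q f b =>
      match q with
      | None => (Some (Some (if f i == a then inl (entry c1) else inr (entry c2))), noop f)
      | Some (inl q) => let r := delta q f b in (omap (fun q => Some (inl q)) r.1, r.2)
      | Some (inr q) => let r := delta q f b in (omap (fun q => Some (inr q)) r.1, r.2)
      end
  | PWhile i a c => fun q f b =>
      match q with
      | None => ((if f i == a then None else Some (Some (entry c))), noop f)
      | Some q => let r := delta q f b in (Some r.1, r.2)
      end
  end.

(** These are the states that consume a bit of the stream. The machine offers both bits in every
    running state, but in the other states the two transitions coincide by [delta_not_guessing]. *)
Fixpoint guessing (c : prog) : control c -> bool :=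
  match c return control c -> bool with
  | PMove _ _ | PWrite _ _ => fun _ => false
  | PGuess _ => fun _ => true
  | PSeq c1 c2 => fun q =>
      match q with inl q => guessing q | inr q => guessing q end
  | PIf _ _ c1 c2 => fun q =>
      match q with
      | None => false | Some (inl q) => guessing q | Some (inr q) => guessing q
      end
  | PWhile _ _ c => fun q => if q is Some q then guessing q else false
  end.

Lemma delta_not_guessing c (q : control c) f b b' :
  ~~ guessing q -> delta q f b = delta q f b'.
Proof.
elim: c q => //= [c1 IH1 c2 IH2|i a c1 IH1 c2 IH2|i a c IH].
- by case=> q H; rewrite ?(IH1 _ H) ?(IH2 _ H).
- by case=> [[]|] // q H; rewrite ?(IH1 _ H) ?(IH2 _ H).
- by case=> // q H; rewrite (IH _ H).
Qed.

Definition dstep c (q : control c) (s : mem) : option (control c) * mem :=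
  let r := delta q (fun i => zscan (tp s i)) (orc s 0) in
  let s' := if guessing q then ask s else s in
  (r.1, upd s' r.2.1 (zact (tp s r.2.1) r.2.2.1 r.2.2.2)).

Inductive dsteps c : nat -> option (control c) * mem -> option (control c) * mem -> Prop :=
| dsteps0 x : dsteps 0 x x
| dstepsS n q s y : dsteps n (dstep q s) y -> dsteps n.+1 (Some q, s) y.

Lemma upd_noop s i : upd s i (zact (tp s i) (zscan (tp s i)) MoveN) = s.
Proof.
case: s => t o; rewrite /upd /zact /zscan /=; congr Mem; apply: funext => k.
case: eqP => // ->; case: (t i) => f p /=; congr pair.
by apply: funext => z; case: eqP => // ->.
Qed.

Lemma dsteps_cat c n1 n2 (x y z : option (control c) * mem) :
  dsteps n1 x y -> dsteps n2 y z -> dsteps (n1 + n2) x z.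
Proof. by elim=> // n q s w _ IH /IH; exact: dstepsS. Qed.

(* A program runs inside a larger one until it is left. *)
Lemma dsteps_embed c c' (g : control c -> control c') (x : option (control c')) n
    (q : control c) s s' :
  (forall q s, dstep (g q) s = (oapp (fun q => Some (g q)) x (dstep q s).1, (dstep q s).2)) ->
  dsteps n (Some q, s) (None, s') -> dsteps n (Some (g q), s) (x, s').
Proof.
move=> gE; move Ex: (Some q, s) => y; move Ez: (None, s') => z H.
elim: H q s Ex Ez => [w|{}n q' t z' H IH] q s; first by move=> <-.
case=> -> -> Ez; apply: dstepsS; rewrite gE.
case E: (dstep q' t) H IH => [[r|] t'] /= H IH; first by apply: IH.
by subst z'; inversion H; subst; apply: dsteps0.
Qed.

Lemma exec_dsteps c s n s' : exec c s n s' -> dsteps n (Some (entry c), s) (None, s').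
Proof.
elim=> {c s n s'}.
- by move=> i d s; apply: dstepsS; apply: dsteps0.
- by move=> i d s; apply: dstepsS; apply: dsteps0.
- by move=> i s; apply: dstepsS; apply: dsteps0.
- move=> c1 c2 s n1 s1 n2 s2 _ H1 _ H2; apply: dsteps_cat.
    apply: (dsteps_embed (c' := PSeq c1 c2) (g := inl) (x := Some (inr (entry c2)))) H1.
    by move=> q t; rewrite /dstep /=; case: (delta _ _ _) => [[r|] a].
  apply: (dsteps_embed (c' := PSeq c1 c2) (g := inr) (x := None)) H2.
  by move=> q t; rewrite /dstep /=; case: (delta _ _ _) => [[r|] a].
- move=> i a c1 c2 s n s' _ H; apply: dstepsS; rewrite /dstep /= upd_noop.
  case: eqP H => _ H.
    apply: (dsteps_embed (c' := PIf i a c1 c2) (g := fun q => Some (inl q)) (x := None)) H.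
    by move=> q t; rewrite /dstep /=; case: (delta _ _ _) => [[r|] ?].
  apply: (dsteps_embed (c' := PIf i a c1 c2) (g := fun q => Some (inr q)) (x := None)) H.
  by move=> q t; rewrite /dstep /=; case: (delta _ _ _) => [[r|] ?].
- move=> i a c s E; apply: dstepsS; rewrite /dstep /= upd_noop E eqxx.
  exact: dsteps0.
- move=> i a c s n1 s1 n2 s2 /negPf E _ H1 _ H2; rewrite -addnA.
  apply: dstepsS; rewrite /dstep /= upd_noop E; apply: dsteps_cat H2.
  apply: (dsteps_embed (c' := PWhile i a c) (g := Some) (x := Some None)) H1.
  by move=> q t; rewrite /dstep /=; case: (delta _ _ _) => [[r|] ?].
Qed.

Section Machine.
Variables (K : nat) (c : prog).

Definition lookup (f : {ffun 'I_K.+1 -> symbol}) (i : nat) : symbol := f (inord i).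

Definition lift_action (f : {ffun 'I_K.+1 -> symbol}) (a : action) :
    {ffun 'I_K.+1 -> symbol * move} :=
  [ffun j => if j == inord a.1 then a.2 else (f j, MoveN)].

(* The machine accepts if the program is left with [true] scanned on tape 1. *)
Definition machine : ntm := {|
  Defs.state := option (option (control c));
  Defs.work := void;
  ntapes := K;
  start := Some (Some (entry c));
  accepting := [set None];
  trans := fun q f =>
    match q with
    | Some (Some q) =>
        [set let r := delta q (lookup f) b in (Some r.1, lift_action f r.2) | b : bool]
    | Some None =>
        if lookup f 1 == bsym true then [set (None, lift_action f (0, (lookup f 0, MoveN)))]
        else set0
    | None => set0
    end |}.

Fixpoint indices_le (c : prog) : bool :=
  match c with
  | PMove i _ | PWrite i _ | PGuess i => i <= K
  | PSeq c1 c2 => indices_le c1 && indices_le c2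
  | PIf i _ c1 c2 => [&& i <= K, indices_le c1 & indices_le c2]
  | PWhile i _ c => (i <= K) && indices_le c
  end.

Definition config_rep (t : {ffun 'I_K.+1 -> tape void}) (s : mem) : Prop :=
  forall i : 'I_K.+1, represents (t i) (tp s i).

End Machine.

Lemma delta_ext K c (q : control c) f g b :
  indices_le K c -> (forall i, i <= K -> f i = g i) ->
  delta q f b = delta q g b /\ (delta q f b).2.1 <= K.
Proof.
move=> + fg; elim: c q => /= [i d|i a|i|c1 IH1 c2 IH2|i a c1 IH1 c2 IH2|i a c IH].
- by move=> _ Hi; rewrite fg.
- by move=> _ Hi.
- by move=> _ Hi.
- by case=> q /andP[/IH1 H1 /IH2 H2]; [case: (H1 q)|case: (H2 q)] => /= -> ->.
- case=> [[]|] => [q|q|] /and3P[Hi /IH1 H1 /IH2 H2].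
  + by case: (H1 q) => -> ->.
  + by case: (H2 q) => -> ->.
  + by rewrite /noop !fg.
- case=> [q|] /andP[Hi /IH H]; first by case: (H q) => -> ->.
  by rewrite /noop !fg.
Qed.

(** Once the stream of guesses is fixed, runs are deterministic: a run that leaves the program
    bounds the length of all runs from the same state and is the only one that leaves it. Time
    bounds and acceptance both rest on this. *)
Lemma dsteps_det c n (x y z : option (control c) * mem) m :
  dsteps n x y -> dsteps m x z -> z.1 = None ->
  n <= m /\ (y.1 = None -> n = m /\ y = z).
Proof.
move=> H; elim: H m z => [[[q|] s]|{}n q s {}y H IH] m z Hm zN.
- by split=> // - [].
- by inversion Hm; subst.
- inversion Hm; subst; first by [].
  match goal with H : dsteps _ (dstep q s) z |- _ => rename H into H2 end.
  by have [H3 H4] := IH _ _ H2 zN; split=> // /H4[-> ->].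
Qed.

(** Tapes not concerned by the action are rewritten with the symbol they scan; this may append a
    blank to a list but does not change the tape it represents. *)
Lemma config_rep_act K (t : {ffun 'I_K.+1 -> tape void}) s (a : action) :
  a.1 <= K -> config_rep t s ->
  config_rep [ffun i => write_move (t i) (lift_action [ffun i => scan (t i)] a i)]
    (upd s a.1 (zact (tp s a.1) a.2.1 a.2.2)).
Proof.
move=> Ha H i; rewrite !ffunE /=; case: a Ha => j [x d] /= Hj.
case: (eqVneq i (inord j)) => [->|ne].
  by rewrite inordK ?eqxx //; apply: represents_act; move: (H (inord j)); rewrite inordK.
rewrite ifF; last by apply: contraNF ne => /eqP <-; rewrite inord_val.
have := represents_act (zscan (tp s i)) MoveN (H i).
rewrite (represents_scan (H i)).
rewrite /zact /=; suff -> : (fun z => if z == (tp s i).2 then zscan (tp s i) else (tp s i).1 z) = (tp s i).1.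
  by rewrite -surjective_pairing.
by apply: funext => z; case: eqP => // ->.
Qed.

Lemma computation_cons (M : ntm) (x y z : config M) n :
  Defs.step x y -> computation y n z -> computation x n.+1 z.
Proof.
move=> Hs H; elim: H => [|m d e _ IH He].
  by apply: computationS Hs; apply: computation0.
exact: computationS IH He.
Qed.

Definition input_tape (w : seq bool) : int -> symbol :=
  fun z => if z is Posz n then omap inl (onth w n) else None.

Definition blank_tape : ztape := (fun _ => None, 0%R).

Definition init_mem (w : seq bool) (o : nat -> bool) : mem :=
  Mem (fun i => if i == 0 then (input_tape w, 0%R) else blank_tape) o.

Lemma config_rep_init K c w o :
  config_rep (K := K) (init (machine K c) w).2 (init_mem w o).
Proof.
move=> i; rewrite /= !ffunE -val_eqE /=; case: (val i == 0) => j /=; last first.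
  by rewrite !nth_nil.
split; last by rewrite nth_nil.
by elim: w j => [|b w IH] [|j] //=.
Qed.

Section Simulation.
Variables (K : nat) (c : prog).
Hypotheses (K_gt0 : 0 < K) (cK : indices_le K c).

Let M := machine K c.

Lemma delta_rep (t : {ffun 'I_K.+1 -> tape void}) s (q : control c) b :
  config_rep t s -> (guessing q -> b = orc s 0) ->
  delta q (lookup [ffun i => scan (t i)]) b =
  delta q (fun i => zscan (tp s i)) (orc s 0)
  /\ (delta q (fun i => zscan (tp s i)) (orc s 0)).2.1 <= K.
Proof.
move=> H Hb.
have E i : i <= K -> lookup [ffun i => scan (t i)] i = zscan (tp s i).
  by move=> Hi; rewrite /lookup ffunE (represents_scan (H _)) inordK.
have E' i : i <= K -> zscan (tp s i) = zscan (tp s i) by [].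
split; last by case: (delta_ext q (orc s 0) cK E').
case: (boolP (guessing q)) => [/Hb ->|/delta_not_guessing Hd].
  by case: (delta_ext q (orc s 0) cK E).
by rewrite (Hd _ _ (orc s 0)); case: (delta_ext q (orc s 0) cK E).
Qed.

(** The bits chosen along a computation are collected into a stream. Its continuation [o'] after the
    computation is left arbitrary for the induction on the last step: the bit of that step must come
    right after those of the previous steps. *)
Lemma computation_dsteps w n (d : config M) : computation (init M w) n d ->
  forall o', exists o,
  match d.1 with
  | Some x => exists s, [/\ dsteps n (Some (entry c), init_mem w o) (x, s),
                            orc s = o' & config_rep d.2 s]
  | None => exists s m, [/\ n = m.+1,
       dsteps m (Some (entry c), init_mem w o) (None, s) & zscan (tp s 1) = bsym true]
  end.
Proof.
elim=> [|m d' e H IH [r Hr ->]] o'.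
  exists o' => /=; exists (init_mem w o'); split => //; first exact: dsteps0.
  exact: config_rep_init.
case: d' H IH Hr => [[[q|]|] t] H IH /=; last by rewrite inE.
- case/imsetP => b _ -> /=.
  set o2 := if guessing q then (fun k => if k is k'.+1 then o' k' else b) else o'.
  have [o [s [Hs Ho Hrep]]] := IH o2.
  exists o; have [|E HK] := delta_rep (q := q) (b := b) Hrep.
    by rewrite Ho /o2 => ->.
  exists (dstep q s).2; split.
  + have -> : (delta q (lookup [ffun i => scan (t i)]) b).1 = (dstep q s).1.
      by rewrite E.
    rewrite -surjective_pairing -addn1; apply: dsteps_cat Hs _.
    by apply: dstepsS; apply: dsteps0.
  + rewrite /dstep /=; case: (boolP (guessing q)) => Hg /=; rewrite Ho /o2 ?Hg //.
    by rewrite (negPf Hg).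
  + rewrite E /dstep /=.
    have := config_rep_act HK Hrep.
    by case: (guessing q).
- case: eqP => // E; last by rewrite inE.
  rewrite inE => /eqP -> /=; have [o [s [Hs Ho Hrep]]] := IH o'.
  exists o, s, m; split => //.
  rewrite -E /lookup ffunE (represents_scan (Hrep _)) /= inordK //.
Qed.

Lemma dsteps_computation n x y (t : {ffun 'I_K.+1 -> tape void}) :
  dsteps n x y -> config_rep t x.2 ->
  exists2 t', computation (M := M) (Some x.1, t) n (Some y.1, t') & config_rep t' y.2.
Proof.
move=> H; elim: H t => [{}x|{}n q s {}y _ IH] t Hrep /=.
  by exists t => //; apply: computation0.
have [//|E HK] := delta_rep (q := q) (b := orc s 0) Hrep.
have Hrep' := config_rep_act HK Hrep.
have {Hrep'}Hrep' : config_rep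
   [ffun i => write_move (t i) (lift_action [ffun i => scan (t i)]
     (delta q (fun i => zscan (tp s i)) (orc s 0)).2 i)] (dstep q s).2.
  by move: Hrep'; rewrite /dstep /=; case: (guessing q).
have [t' H1 H2] := IH _ Hrep'; exists t' => //.
apply: computation_cons H1.
exists (Some (dstep q s).1, lift_action [ffun i => scan (t i)]
     (delta q (fun i => zscan (tp s i)) (orc s 0)).2) => //.
by apply/imsetP; exists (orc s 0) => //=; rewrite E.
Qed.

Variable T : nat -> nat.
Hypothesis terminates : forall w o, exists n s',
  n <= T (size w) /\ exec c (init_mem w o) n s'.

(** Termination is assumed for every stream because the time bound concerns all computations,
    accepting or not. The additional step is the transition to the accepting state. *)
Lemma machine_runs_in_time : runs_in_time M (fun n => (T n).+1).
Proof.
move=> w n d /computation_dsteps /(_ xpredT)[o].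
have [m [s' [Hm /exec_dsteps He]]] := terminates w o.
case: d => [[x|] t] /=.
  by case=> s [H _ _]; have [+ _] := dsteps_det H He erefl; lia.
by case=> s [k [-> H _]]; have [+ _] := dsteps_det H He erefl; lia.
Qed.

Lemma machine_accepts w : accepts M w <->
  exists o n s', exec c (init_mem w o) n s' /\ zscan (tp s' 1) = bsym true.
Proof.
split=> [[n [d [/computation_dsteps /(_ xpredT)[o + Hd]]]]|].
  move: Hd; rewrite inE => /eqP -> [s [m [_ Hs E]]].
  have [k [s' [_ He]]] := terminates w o.
  exists o, k, s'; split => //.
  by have [_ /(_ erefl)[_ [<-]]] := dsteps_det Hs (exec_dsteps He) erefl.
case=> o [n [s' [/exec_dsteps He E]]].
have [t' H Hrep] := dsteps_computation He (@config_rep_init K c w o).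
exists n.+1, (None, [ffun i => write_move (t' i)
  (lift_action [ffun i => scan (t' i)] (0, (lookup [ffun i => scan (t' i)] 0, MoveN)) i)]).
split; last by rewrite inE.
have -> : init M w = (Some (Some (entry c)), (init M w).2) by [].
apply: computationS H _.
exists (None, lift_action [ffun i => scan (t' i)] (0, (lookup [ffun i => scan (t' i)] 0, MoveN))) => //=.
suff -> : lookup [ffun i => scan (t' i)] 1 = bsym true by rewrite eqxx inE.
by rewrite /lookup ffunE (represents_scan (Hrep _)) /= inordK.
Qed.
End Simulation.

(** * Verified program fragments *)

Definition runs (c : prog) (s : mem) (T : nat) (s' : mem) : Prop :=
  exists2 n, n <= T & exec c s n s'.

Lemma mem_eq s s' : (forall k, tp s k = tp s' k) -> orc s = orc s' -> s = s'.
Proof. by case: s s' => [t o] [t' o'] /= /funext -> ->. Qed.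

Lemma upd_upd s i x y : upd (upd s i x) i y = upd s i y.
Proof. by apply: mem_eq => // k /=; case: eqP. Qed.

Lemma updC s i j x y : i != j -> upd (upd s i x) j y = upd (upd s j y) i x.
Proof.
move=> ne; apply: mem_eq => // k /=.
by case: (eqVneq k j) => // ->; rewrite eq_sym (negPf ne).
Qed.

Lemma upd_same s i : upd s i (tp s i) = s.
Proof. by apply: mem_eq => // k /=; case: eqP => // ->. Qed.

Lemma upd_id s i x : tp s i = x -> upd s i x = s.
Proof. by move=> <-; exact: upd_same. Qed.

Lemma tp_upd s i x : tp (upd s i x) i = x.
Proof. by rewrite /= eqxx. Qed.

Lemma tp_upd_neq s i j x : j != i -> tp (upd s i x) j = tp s j.
Proof. by move=> /negPf /= ->. Qed.

Lemma runs_le c s T T' s' : runs c s T s' -> T <= T' -> runs c s T' s'.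
Proof. by case=> n Hn H HT; exists n => //; apply: leq_trans HT. Qed.

Lemma runs_seq c1 c2 s T1 s1 T2 s2 :
  runs c1 s T1 s1 -> runs c2 s1 T2 s2 -> runs (PSeq c1 c2) s (T1 + T2) s2.
Proof.
by move=> [n1 H1 E1] [n2 H2 E2]; exists (n1 + n2); [lia|apply: exec_seq E1 E2].
Qed.

Lemma runs_if i a c1 c2 s T s' :
  runs (if zscan (tp s i) == a then c1 else c2) s T s' ->
  runs (PIf i a c1 c2) s T.+1 s'.
Proof. by move=> [n H E]; exists n.+1 => //; apply: exec_if. Qed.

Definition displacement (d : move) : int :=
  match d with MoveL => - 1 | MoveN => 0 | MoveR => 1 end%R.

Definition mv (j : nat) (z : int) (s : mem) : mem :=
  upd s j ((tp s j).1, (tp s j).2 + z)%R.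

Lemma mv_mv j y z s : mv j y (mv j z s) = mv j (y + z)%R s.
Proof. by rewrite /mv upd_upd /= eqxx /= -GRing.addrA (GRing.addrC z). Qed.

Lemma mv0 j s : mv j 0 s = s.
Proof. by rewrite /mv GRing.addr0 upd_id //; case: (tp s j). Qed.

Lemma mv_upd s i j x z : i != j -> mv j z (upd s i x) = upd (mv j z s) i x.
Proof. by move=> ne; rewrite /mv tp_upd_neq 1?eq_sym // updC. Qed.

Lemma mv_upd_same s i f p z : mv i z (upd s i (f, p)) = upd s i (f, p + z)%R.
Proof. by rewrite /mv upd_upd tp_upd. Qed.

Lemma iter_mv n j z s : iter n (mv j z) s = mv j (n%:Z * z)%R s.
Proof.
elim: n => [|n IH] /=; first by rewrite GRing.mul0r mv0.
by rewrite IH mv_mv; congr mv; lia.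
Qed.

Lemma runs_move j d s : runs (PMove j d) s 1 (mv j (displacement d) s).
Proof.
exists 1 => //; suff -> : mv j (displacement d) s = upd s j (zact (tp s j) (zscan (tp s j)) d) by constructor.
rewrite /mv /zact /zscan; case: (tp s j) => f p /=; congr (upd s j (_, _)).
- by apply: funext => z; case: eqP => // ->.
- by case: d => //=; rewrite GRing.addr0.
Qed.

Definition put (x : ztape) (a : symbol) : ztape :=
  (fun z => if z == x.2 then a else x.1 z, x.2).

Lemma runs_write j a s : runs (PWrite j a) s 1 (upd s j (put (tp s j) a)).
Proof. by exists 1 => //; exact: exec_write. Qed.

Lemma runs_guess j s :
  runs (PGuess j) s 1 (upd (ask s) j (put (tp s j) (bsym (orc s 0)))).
Proof. by exists 1 => //; exact: exec_guess. Qed.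

Lemma runs_until i a c T m (g : nat -> mem) :
  (forall k, k < m -> zscan (tp (g k) i) != a) -> zscan (tp (g m) i) = a ->
  (forall k, k < m -> runs c (g k) T (g k.+1)) ->
  runs (PWhile i a c) (g 0) (m * T.+1 + 1) (g m).
Proof.
elim: m g => [|m IH] g H1 H2 H3; first by exists 1 => //; exact: exec_exit.
have [n Hn E] := IH (fun k => g k.+1) (fun k Hk => H1 k.+1 Hk) H2 (fun k Hk => H3 k.+1 Hk).
have [n1 Hn1 E1] := H3 0 isT.
exists (1 + n1 + n); first by lia.
by apply: exec_loop E; [apply: H1|exact: E1].
Qed.

Local Notation "n %:Z" := (Posz n) (only parsing) : nat_scope.

(* Only the nonblank cells of the tape are delimited: their contents may vary. *)
Definition marks (f : int -> symbol) (m : nat) : Prop :=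
  forall z : int, (f z != None) = (0 <= z < m%:Z)%R.

Definition unary (m : nat) : int -> symbol :=
  fun z => if (0 <= z < m%:Z)%R then bsym true else None.

Lemma marks_unary m : marks (unary m) m.
Proof. by move=> z; rewrite /unary; case: ifP. Qed.

Lemma marks_input w : marks (input_tape w) (size w).
Proof.
case=> n //=; elim: w n => [|b w IH] [|n] //=; rewrite IH; lia.
Qed.

(** The head may stand on the blank after the last mark, where the loop would stop at once; hence
    the initial move to the left. *)
Definition rewind (t : nat) : prog :=
  PSeq (PMove t MoveL) (PSeq (PWhile t None (PMove t MoveL)) (PMove t MoveR)).

Lemma runs_rewind t f m p s : marks f m -> p <= m -> tp s t = (f, p%:Z) ->
  runs (rewind t) s (2 * p + 3) (upd s t (f, 0%R)).
Proof.
move=> fm pm ts.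
have H k : zscan (tp (mv t (- k%:Z - 1) s) t) = f (p%:Z - k%:Z - 1)%R.
  by rewrite /zscan tp_upd ts /=; congr f; lia.
have -> : upd s t (f, 0%R) = mv t 1 (mv t (- p%:Z - 1)%R s).
  by rewrite mv_mv /mv ts /=; congr upd; congr pair; lia.
have -> : 2 * p + 3 = 1 + ((p * 1.+1 + 1) + 1) by lia.
apply: runs_seq; first exact: runs_move.
apply: runs_seq; last exact: runs_move.
have -> : mv t (displacement MoveL) s = mv t (- 0%:Z - 1)%R s by [].
apply: (@runs_until _ _ _ 1 p (fun k => mv t (- k%:Z - 1)%R s)) => [k kp||k kp].
- by rewrite H fm; lia.
- by rewrite H; apply/eqP; rewrite -[_ == _]negbK fm; lia.
- suff -> : mv t (- k.+1%:Z - 1)%R s = mv t (displacement MoveL) (mv t (- k%:Z - 1)%R s).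
    exact: runs_move.
  by rewrite mv_mv; congr mv => /=; lia.
Qed.

Definition loop (t : nat) (c : prog) : prog :=
  PSeq (PWhile t None (PSeq c (PMove t MoveR))) (rewind t).

Definition loop_time (m T : nat) : nat := m * T.+2 + 1 + (2 * m + 3).

(** In [g k], the memory after [k] rounds, the head on tape [t] is put back to 0; during the loop it
    really stands at [k], and the body may read it. *)
Lemma runs_loop t c T f m (g : nat -> mem) : marks f m ->
  (forall k, k <= m -> tp (g k) t = (f, 0%R)) ->
  (forall k, k < m -> runs c (upd (g k) t (f, k%:Z)) T (upd (g k.+1) t (f, k%:Z))) ->
  runs (loop t c) (g 0) (loop_time m T) (g m).
Proof.
move=> fm gt gc.
have -> : g m = upd (upd (g m) t (f, m%:Z)) t (f, 0%R).
  by rewrite upd_upd upd_id // gt.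
have -> : g 0 = upd (g 0) t (f, 0%:Z) by rewrite upd_id ?gt.
apply: runs_seq; last first.
  by apply: (runs_rewind fm) => //; rewrite tp_upd.
apply: runs_le (runs_until (m := m) (g := fun k => upd (g k) t (f, k%:Z)) _ _ _) _.
- by move=> k km; rewrite tp_upd /zscan /= fm; lia.
- by rewrite tp_upd /zscan; apply/eqP; rewrite -[_ == _]negbK /= fm; lia.
- move=> k km; apply: runs_seq; first exact: gc.
  have -> : upd (g k.+1) t (f, k.+1%:Z) = mv t (displacement MoveR) (upd (g k.+1) t (f, k%:Z)).
    by rewrite /mv upd_upd tp_upd /=; congr (upd _ t (f, _)); lia.
  exact: runs_move.
- lia.
Qed.

(* The power [N ^ k] is counted by heads on [k] tapes of length [N]; tapes 4 to
   7 are reserved to this purpose. *)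
Fixpoint power_loop (k : nat) (c : prog) : prog :=
  if k is k'.+1 then loop (4 + k') (power_loop k' c) else c.

Fixpoint power_time (N k T : nat) : nat :=
  if k is k'.+1 then loop_time N (power_time N k' T) else T.

Definition counters (N : nat) (k : nat) (s : mem) : Prop :=
  forall j, j < k -> tp s (4 + j) = (unary N, 0%R).

Definition override (k : nat) (h : nat -> ztape) (s : mem) : mem :=
  Mem (fun j => if 4 <= j < 4 + k then h j else tp s j) (orc s).

(** The body must work whatever the [k] counter tapes hold, which [override] expresses; the
    invariant [g] can then ignore their moving heads. The offset [i0] is the number of rounds
    already done by the enclosing loops. *)
Lemma runs_power k c T N (g : nat -> mem) m i0 :
  (forall i h, i < m -> runs c (override k h (g i)) T (override k h (g i.+1))) ->
  (forall i, counters N k (g i)) -> i0 + N ^ k <= m ->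
  runs (power_loop k c) (g i0) (power_time N k T) (g (i0 + N ^ k)).
Proof.
elim: k g m i0 => [|k IH] g m i0 Hc Hg Hm.
  move: Hm; rewrite expn0 addn1 => Hm.
  have E s : override 0 (tp s) s = s by apply: mem_eq => // j /=; case: ifP.
  have E' s h : override 0 h s = s.
    by apply: mem_eq => // j /=; case: ifP => // H; exfalso; lia.
  by have := Hc i0 (tp (g 0)) Hm; rewrite !E'.
rewrite expnS.
have -> : g i0 = (fun a => g (i0 + a * N ^ k)) 0 by rewrite addn0.
apply: (runs_loop (g := fun a => g (i0 + a * N ^ k)) (marks_unary N)) => [a _|a aN].
  exact: Hg.
rewrite mulSn [N ^ k + _]addnC addnA.
have a_le : a.+1 * N ^ k <= N * N ^ k by rewrite leq_mul2r aN orbT.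
apply: (IH (fun i => upd (g i) (4 + k) (unary N, a%:Z)) m (i0 + a * N ^ k)) => [i h im|i j jk|].
- have E s : override k h (upd s (4 + k) (unary N, a%:Z)) =
    override k.+1 (fun j => if j == 4 + k then (unary N, a%:Z) else h j) s.
    apply: mem_eq => // j /=; case: (eqVneq j (4 + k)) => [->|ne].
      by rewrite ifF ?ifT //; lia.
    by have -> : (4 <= j < 4 + k) = (4 <= j < 4 + k.+1) by lia.
  by rewrite !E; exact: Hc.
- by rewrite tp_upd_neq ?Hg //; lia.
- by move: Hm; rewrite expnS; move: a_le; rewrite mulSn; lia.
Qed.

(* Moves head [j] by [N ^ k] cells for each unit of the value of tape [v]; the
   position of head [v] is kept by a mark. *)
Definition walk (v k j : nat) (d : move) : prog :=
  PSeq (PWrite v (bsym false)) (PSeq (PMove v MoveL)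
  (PSeq (PWhile v None (PSeq (power_loop k (PMove j d)) (PMove v MoveL)))
  (PSeq (PMove v MoveR) (PSeq (PWhile v (bsym false) (PMove v MoveR))
    (PWrite v (bsym true)))))).

Definition walk_time (N k : nat) : nat :=
  1 + (1 + ((N * (power_time N k 1 + 1).+1 + 1) + (1 + ((N * 2 + 1) + 1)))).

Lemma runs_power_move k j d N s : (forall i, i < k -> j != 4 + i) -> counters N k s ->
  runs (power_loop k (PMove j d)) s (power_time N k 1) (mv j ((N ^ k)%:Z * displacement d)%R s).
Proof.
move=> jk Hs; rewrite -iter_mv.
have j_out : (4 <= j < 4 + k) = false.
  by apply: contraTF isT => H; have := jk (j - 4); rewrite subnKC ?eqxx; lia.
apply: (@runs_power k _ 1 N (fun i => iter i (mv j (displacement d)) s) (N ^ k) 0) => //.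
  move=> i h _; rewrite iterS.
  set s' := iter i _ s; suff -> : override k h (mv j (displacement d) s') =
    mv j (displacement d) (override k h s') by exact: runs_move.
  apply: mem_eq => // l /=; rewrite j_out.
  by case: (eqVneq l j) => [->|//]; rewrite j_out.
move=> i l lk; rewrite iter_mv tp_upd_neq ?Hs // eq_sym; exact: jk.
Qed.

Lemma runs_walk v k j d N (x : nat) s :
  (forall i, i < k -> j != 4 + i) -> (forall i, i < k -> v != 4 + i) -> j != v ->
  counters N k s -> tp s v = (unary N, x%:Z) -> x < N ->
  runs (walk v k j d) s (walk_time N k) (mv j (x%:Z * (N ^ k)%:Z * displacement d)%R s).
Proof.
move=> jk vk jv Hs vs xN.
pose f z := if z == x%:Z then bsym false else unary N z.
have fN z : (f z == None) = ~~ (0 <= z < N%:Z)%R.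
  rewrite /f /unary; case: (z =P x%:Z) => [->|_]; last by case: (_ <= _ < _)%R.
  by symmetry; apply/negbTE; lia.
pose mark z s := upd s v (f, z).
pose D := ((N ^ k)%:Z * displacement d)%R.
pose g i := mark (x%:Z - i%:Z - 1)%R (mv j (i%:Z * D)%R s).
have vj : v != j by rewrite eq_sym.
have Eg : mv v (displacement MoveL) (mark x%:Z s) = g 0.
  by rewrite /g /mark mv_upd_same GRing.mul0r mv0; congr (upd _ v (f, _)) => /=; lia.
have -> : mv j (x%:Z * (N ^ k)%:Z * displacement d)%R s = upd (mark x%:Z (mv j (x%:Z * D)%R s)) v (unary N, x%:Z).
  rewrite /mark upd_upd upd_id; first by rewrite /D GRing.mulrA.
  by rewrite tp_upd_neq.
have -> : (unary N, x%:Z) = put (f, x%:Z) (bsym true).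
  rewrite /put /=; congr pair; apply: funext => z; rewrite /f.
  by case: (z =P x%:Z) => // ->; rewrite /unary ifT //; lia.
apply: runs_seq; first by apply: runs_write.
have -> : upd s v (put (tp s v) (bsym false)) = mark x%:Z s.
  by rewrite vs.
apply: runs_seq; first exact: runs_move.
rewrite Eg; apply: runs_seq.
  apply: runs_le (runs_until (m := x) (g := g) (T := power_time N k 1 + 1) _ _ _) _.
  - by move=> i ix; rewrite tp_upd /zscan /= fN; lia.
  - by rewrite tp_upd /zscan; apply/eqP; rewrite /= fN; lia.
  - move=> i ix; apply: runs_seq.
      apply: runs_power_move =>// i' ik.
      by rewrite /g /mark !tp_upd_neq ?Hs // eq_sym ?jk ?vk.
    have -> : g i.+1 = mv v (displacement MoveL) (mv j D (g i)).
      rewrite /g /mark mv_upd // mv_mv mv_upd_same.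
      by congr (upd (mv _ _ _) v (f, _)) => /=; lia.
    exact: runs_move.
  - by have : x * (power_time N k 1 + 1).+1 <= N * (power_time N k 1 + 1).+1; [rewrite leq_mul2r; lia|lia].
apply: runs_seq; first exact: runs_move.
set s1 := mv j (x%:Z * D)%R s.
have -> : mv v (displacement MoveR) (g x) = mark 0%:Z s1.
  by rewrite /g /mark mv_upd_same; congr (upd _ v (f, _)) => /=; lia.
apply: runs_seq.
  apply: runs_le (runs_until (m := x) (g := fun i => mark i%:Z s1) (T := 1) _ _ _) _.
  - move=> i ix; rewrite tp_upd /zscan /= /f ifF; last by lia.
    by rewrite /unary; case: ifP.
  - by rewrite tp_upd /zscan /= /f eqxx.
  - move=> i ix; have -> : mark i.+1%:Z s1 = mv v (displacement MoveR) (mark i%:Z s1).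
      by rewrite /mark mv_upd_same; congr (upd _ v (f, _)) => /=; lia.
    exact: runs_move.
  - lia.
have -> : (f, x%:Z) = tp (mark x%:Z s1) v by rewrite tp_upd.
exact: runs_write.
Qed.

(** * Existential second-order formulas *)

Inductive relsym :=
  RSet | RStep | RDom | RInd | RConcept | RRole | RAssign | RValue | RLabel.

Definition rel_code (c : relsym) : nat :=
  match c with
  | RSet => 0 | RStep => 1 | RDom => 2 | RInd => 3 | RConcept => 4
  | RRole => 5 | RAssign => 6 | RValue => 7 | RLabel => 8
  end.

(* The elements are the numbers less than [sN]; values of [sG] elsewhere are
   irrelevant. *)
Record structure := Structure {
  sN : nat;
  sw : seq bool;
  sG : relsym -> nat -> nat -> nat -> bool
}.

(* Variables are de Bruijn indices. *)
Inductive fo :=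
| FBit (b : bool) (x : nat)
| FLin (l r : seq nat) (c : nat)          (* sum of l + c = sum of r *)
| FRel (c : relsym) (x y z : nat)
| FNot (f : fo)
| FAnd (f g : fo)
| FAll (f : fo).

Definition scons (x : nat) (e : nat -> nat) : nat -> nat :=
  fun i => if i is i'.+1 then e i' else x.

Fixpoint sat (M : structure) (e : nat -> nat) (f : fo) : bool :=
  match f with
  | FBit b x => onth (sw M) (e x) == Some b
  | FLin l r c => sumn (map e l) + c == sumn (map e r)
  | FRel c x y z => sG M c (e x) (e y) (e z)
  | FNot f => ~~ sat M e f
  | FAnd f g => sat M e f && sat M e g
  | FAll f => all (fun x => sat M (scons x e) f) (iota 0 (sN M))
  end.

Fixpoint vars_lt (D : nat) (f : fo) : bool :=
  match f with
  | FBit _ x => x < D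
  | FLin l r _ => all (fun x => x < D) (l ++ r)
  | FRel _ x y z => [&& x < D, y < D & z < D]
  | FNot f => vars_lt D f
  | FAnd f g => vars_lt D f && vars_lt D g
  | FAll f => vars_lt D.+1 f
  end.

Fixpoint depth (f : fo) : nat :=
  match f with
  | FNot f => depth f
  | FAnd f g => maxn (depth f) (depth g)
  | FAll f => (depth f).+1
  | _ => 0
  end.

(* Tape 1 is a stack of truth values, tape 2 has a single mark, tape 3 holds
   the relations, and the head on tape [8 + i] is the value of the variable of
   de Bruijn level [i]. *)
Definition push (b : bool) : prog := PSeq (PWrite 1 (bsym b)) (PMove 1 MoveR).

Definition opposite (d : move) : move :=
  match d with MoveL => MoveR | MoveN => MoveN | MoveR => MoveL end.

Definition mul_walk := (option nat * nat * move)%type.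

Fixpoint walks (l : seq mul_walk) (j : nat) : prog :=
  match l with
  | [::] => PMove j MoveN
  | (o, k, d) :: l' =>
      PSeq (if o is Some v then walk v k j d else power_loop k (PMove j d)) (walks l' j)
  end.

Definition test_cell (j : nat) (l : seq mul_walk) (a : symbol) : prog :=
  PSeq (walks l j) (PSeq (PIf j a (push true) (push false))
    (walks [seq (x.1, opposite x.2) | x <- l] j)).

Definition level_tape (D i : nat) : nat := 8 + (D.-1 - i).

(** A linear atom moves the head of tape 2 right by one side and left by the other, and holds if the
    head is back on the mark. A relational atom is read on tape 3 at the address whose base-[N]
    digits are the code of the relation and the three arguments. *)
Fixpoint eval (D : nat) (f : fo) : prog :=
  let v i := Some (level_tape D i) in
  match f with
  | FBit b x => test_cell 0 [:: (v x, 0, MoveR)] (bsym b)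
  | FLin l r c =>
      test_cell 2 ([seq (v x, 0, MoveR) | x <- l] ++ nseq c (None, 0, MoveR) ++
                   [seq (v x, 0, MoveL) | x <- r]) (bsym true)
  | FRel c x y z =>
      test_cell 3 (nseq (rel_code c) (None, 3, MoveR) ++
        [:: (v x, 2, MoveR); (v y, 1, MoveR); (v z, 0, MoveR)]) (bsym true)
  | FNot f =>
      PSeq (eval D f) (PSeq (PMove 1 MoveL) (PIf 1 (bsym true) (push false) (push true)))
  | FAnd f g =>
      PSeq (eval D f) (PSeq (PMove 1 MoveL)
        (PIf 1 (bsym true) (PSeq (PWrite 1 None) (eval D g)) (PMove 1 MoveR)))
  | FAll f =>
      PSeq (push true) (loop (8 + D) (PSeq (PMove 1 MoveL)
        (PIf 1 (bsym true) (PSeq (PWrite 1 None) (eval D.+1 f)) (PMove 1 MoveR))))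
  end.

Definition walks_time (N : nat) (l : seq mul_walk) : nat :=
  sumn [seq walk_time N x.1.2 + power_time N x.1.2 1 | x <- l] + 1.

Definition test_time (N : nat) (l : seq mul_walk) : nat :=
  walks_time N l + (3 + walks_time N l).

Fixpoint eval_time (N : nat) (f : fo) : nat :=
  match f with
  | FBit b x => test_time N [:: (None, 0, MoveR)]
  | FLin l r c => test_time N (nseq (size l + (c + size r)) (None, 0, MoveR))
  | FRel c x y z => test_time N (nseq (rel_code c) (None, 3, MoveR) ++
        [:: (None, 2, MoveR); (None, 1, MoveR); (None, 0, MoveR)])
  | FNot f => eval_time N f + (1 + 3)
  | FAnd f g => eval_time N f + (1 + (1 + (1 + eval_time N g)).+1)
  | FAll f => 2 + loop_time N (1 + (1 + (1 + eval_time N f)).+1)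
  end.

Section Evaluation.
Variables (N L : nat).

Definition pushed (b : bool) (x : ztape) : ztape :=
  (fun z => if z == x.2 then bsym b else x.1 z, x.2 + 1)%R.

Lemma runs_push b s : runs (push b) s 2 (upd s 1 (pushed b (tp s 1))).
Proof.
have -> : upd s 1 (pushed b (tp s 1)) = mv 1 (displacement MoveR) (upd s 1 (put (tp s 1) (bsym b))).
  by rewrite mv_upd_same.
by apply: (runs_seq (T1 := 1) (T2 := 1)); [exact: runs_write|exact: runs_move].
Qed.

(** The stack on tape 1 is left out, since it changes during the evaluation. The tapes of [ctx_free]
    are reserved for the variables of quantifiers not yet entered. *)
Record context (D : nat) (e : nat -> nat) (tabs : nat -> int -> symbol) (s : mem) : Prop :=
  Context {
    ctx_input : forall j, j \in [:: 0; 2; 3] -> tp s j = (tabs j, 0%R);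
    ctx_counters : counters N 4 s;
    ctx_vars : forall i, i < D -> tp s (level_tape D i) = (unary N, Posz (e i)) /\ e i < N;
    ctx_free : forall l, D <= l < L -> tp s (8 + l) = (unary N, 0%R)
  }.

Lemma context_upd1 D e tabs s x : context D e tabs s -> context D e tabs (upd s 1 x).
Proof.
case=> H1 H2 H3 H4; split=> //.
by move=> j Hj; rewrite tp_upd_neq ?H1 //; apply: contraTneq Hj => ->.
Qed.

Definition walk_value (D : nat) (e : nat -> nat) (x : mul_walk) : int :=
  (Posz (if x.1.1 is Some v then e (D.-1 - (v - 8)) else 1)%N * Posz (N ^ x.1.2)%N * displacement x.2)%R.

Definition walks_value D e (l : seq mul_walk) : int :=
  foldr (fun x z => walk_value D e x + z)%R 0%R l.

Definition good_walk D (x : mul_walk) : bool :=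
  (if x.1.1 is Some v then 8 <= v < 8 + D else true) && (x.1.2 <= 4).

Lemma mv_context D e tabs s j z : j \in [:: 0; 2; 3] ->
  context D e tabs s ->
  counters N 4 (mv j z s) /\
  forall i, i < D -> tp (mv j z s) (level_tape D i) = (unary N, Posz (e i)) /\ e i < N.
Proof.
move=> Hj [H1 H2 H3 H4]; have Hk k : 4 <= k -> k != j.
  by move: Hj; rewrite !inE => /or3P[] /eqP ->; case: k => [|[|[|[]]]].
split=> [i i4|i iD]; rewrite tp_upd_neq; [exact: H2|exact: Hk|exact: H3|exact: Hk].
Qed.

Lemma runs_walks D e tabs s z j l : j \in [:: 0; 2; 3] ->
  context D e tabs s -> all (good_walk D) l ->
  runs (walks l j) (mv j z s) (walks_time N l) (mv j (z + walks_value D e l)%R s).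
Proof.
move=> Hj Hs; elim: l z => [|[[o k] d] l IH] z /=.
  move=> _; rewrite GRing.addr0.
  by have := runs_move j MoveN (mv j z s); rewrite mv_mv GRing.add0r.
case/andP=> /andP[/= Ho Hk] Hl.
have [Hc Hv] := mv_context z Hj Hs.
have jk i : j != 4 + i by move: Hj; rewrite !inE => /or3P[] /eqP ->.
have Hck : counters N k (mv j z s) by move=> i ik; apply: Hc; lia.
rewrite [(_ + (_ + _))%R]GRing.addrA.
apply: runs_le (runs_seq (T1 := walk_time N k + power_time N k 1) _ (IH _ Hl)) _; last first.
  by rewrite /walks_time /=; lia.
rewrite [(z + _)%R]GRing.addrC -mv_mv /walk_value /=.
case: o Ho => [v|] Hv8; last first.
  rewrite GRing.mul1r; apply: runs_le (leq_addl _ _).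
  by apply: (@runs_power_move k j d N).
apply: runs_le (leq_addr _ _).
have iD : D.-1 - (v - 8) < D by lia.
have [] := Hv _ iD.
have -> : level_tape D (D.-1 - (v - 8)) = v by rewrite /level_tape; lia.
move=> vs vN; apply: runs_walk => //.
- by move=> i ik; lia.
- by move: Hj; rewrite !inE => /or3P[] /eqP ->; lia.
Qed.

Lemma walks_value_cat D e l1 l2 :
  walks_value D e (l1 ++ l2) = (walks_value D e l1 + walks_value D e l2)%R.
Proof.
by elim: l1 => [|x l IH] /=; rewrite ?GRing.add0r // IH GRing.addrA.
Qed.

Lemma walks_value_opposite D e l :
  walks_value D e [seq (x.1, opposite x.2) | x <- l] = (- walks_value D e l)%R.
Proof.
elim: l => //= x l ->; rewrite GRing.opprD; congr (_ + _)%R.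
by rewrite /walk_value /=; case: x.2 => /=; rewrite ?GRing.mulrN ?GRing.opprK ?GRing.mulr0.
Qed.

Lemma runs_test D e tabs s j l a : j \in [:: 0; 2; 3] ->
  context D e tabs s -> all (good_walk D) l ->
  runs (test_cell j l a) s (test_time N l)
    (upd s 1 (pushed (tabs j (walks_value D e l) == a) (tp s 1))).
Proof.
move=> Hj Hs Hl; set V := walks_value D e l; set s' := upd s 1 _.
have js : tp s j = (tabs j, 0%R) by case: Hs => H _ _ _; exact: H.
have j1 : 1 != j by move: Hj; rewrite !inE => /or3P[] /eqP ->.
have Hs' : context D e tabs s' by exact: context_upd1.
apply: (@runs_seq _ _ _ _ (mv j V s)).
  by have := runs_walks 0%R Hj Hs Hl; rewrite GRing.add0r mv0.
apply: (@runs_seq _ _ _ _ (mv j V s')).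
  rewrite /s' mv_upd //; apply: runs_if.
  rewrite {1}/mv tp_upd /zscan js /= GRing.add0r.
  have -> : tp s 1 = tp (mv j V s) 1 by rewrite tp_upd_neq.
  by case: eqP => _; exact: runs_push.
have Hl' : all (good_walk D) [seq (x.1, opposite x.2) | x <- l].
  by rewrite all_map.
have := runs_walks V Hj Hs' Hl'; rewrite walks_value_opposite GRing.subrr mv0.
move=> H; apply: runs_le H _; rewrite /walks_time -map_comp /=.
by rewrite (eq_map (g := fun x : mul_walk => walk_time N x.1.2 + power_time N x.1.2 1)).
Qed.

Lemma all_nseq_true (T : Type) (P : pred T) n x : P x -> all P (nseq n x).
Proof. by move=> Px; rewrite all_nseq Px orbT. Qed.

Lemma walks_value_nseq D e n k :
  walks_value D e (nseq n (None, k, MoveR)) = Posz (n * N ^ k).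
Proof.
elim: n => //= n ->; rewrite /walk_value /= GRing.mul1r GRing.mulr1; lia.
Qed.

Lemma walks_value_vars D e k d l : all (fun x => x < D) l ->
  walks_value D e [seq (Some (level_tape D x), k, d) | x <- l] =
  (Posz (sumn (map e l) * N ^ k)%N * displacement d)%R.
Proof.
elim: l => [|x l IH] //=; rewrite ?mul0n ?GRing.mul0r // => /andP[xD /IH ->].
rewrite /walk_value /=; have -> : D.-1 - (level_tape D x - 8) = x by rewrite /level_tape; lia.
by rewrite -GRing.mulrDl mulnDl PoszD !PoszM.
Qed.

Lemma good_vars D k d l : all (fun x => x < D) l -> k <= 4 ->
  all (good_walk D) [seq (Some (level_tape D x), k, d) | x <- l].
Proof.
move=> Hl Hk; rewrite all_map; apply: sub_all Hl => x xD /=.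
by rewrite /good_walk /= Hk andbT /level_tape; lia.
Qed.

(** The time of a walk depends on its exponent only, so [eval_time] can be defined without the depth
    at which a formula is evaluated. *)
Lemma walks_time_shape l l' : map (fun x => x.1.2) l = map (fun x => x.1.2) l' ->
  walks_time N l = walks_time N l'.
Proof.
move=> E; rewrite /walks_time; congr (sumn _ + 1).
have H (l0 : seq mul_walk) : [seq walk_time N x.1.2 + power_time N x.1.2 1 | x <- l0] =
   [seq walk_time N k + power_time N k 1 | k <- map (fun x => x.1.2) l0].
  by rewrite -map_comp.
by rewrite !H E.
Qed.

Definition structure_tapes (M : structure) (tabs : nat -> int -> symbol) : Prop :=
  [/\ sN M = N, tabs 0 = input_tape (sw M),
      forall z, (tabs 2 z == bsym true) = (z == 0%R)
    & forall c x y z, x < N -> y < N -> z < N ->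
        (tabs 3 (Posz (rel_code c * N ^ 3 + x * N ^ 2 + y * N + z)) == bsym true)
        = sG M c x y z].

(** With blanks from the head on, pushing a value and then erasing it restores the memory
    exactly. *)
Definition clean_stack (x : ztape) : Prop := forall z : int, (x.2 <= z)%R -> x.1 z = None.

Lemma scan_pushed b s x : zscan (tp (mv 1 (displacement MoveL) (upd s 1 (pushed b x))) 1) = bsym b.
Proof. by rewrite mv_upd_same tp_upd /zscan /= GRing.addrK eqxx. Qed.

(** Shared by conjunctions and by universal quantifiers, which are iterated conjunctions. A value
    [true] is popped and erased, giving back the memory in which [c] is known to run; a value
    [false] stays as the result and [c] is skipped. *)
Lemma runs_and c b b' s T : clean_stack (tp s 1) ->
  runs c s T (upd s 1 (pushed b' (tp s 1))) ->
  runs (PSeq (PMove 1 MoveL) (PIf 1 (bsym true) (PSeq (PWrite 1 None) c) (PMove 1 MoveR)))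
    (upd s 1 (pushed b (tp s 1))) (1 + (1 + (1 + T)).+1)
    (upd s 1 (pushed (b && b') (tp s 1))).
Proof.
move=> Hs Hc; apply: runs_seq; first exact: runs_move.
apply: runs_if; rewrite scan_pushed; case: b => /=.
  apply: runs_le (runs_seq (T1 := 1) (T2 := T) _ _) _; [exact: runs_write| |by []].
  suff -> : upd (mv 1 (- 1) (upd s 1 (pushed true (tp s 1)))) 1
     (put (tp (mv 1 (- 1) (upd s 1 (pushed true (tp s 1)))) 1) None) = s by [].
  rewrite mv_upd_same upd_upd upd_id // tp_upd /put /=.
  rewrite GRing.addrK [LHS]surjective_pairing; congr pair; apply: funext => z.
  by case: eqP => // ->; rewrite Hs.
set s' := upd s 1 _; have {2}-> : s' = mv 1 (displacement MoveR) (mv 1 (displacement MoveL) s').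
  by rewrite mv_mv mv0.
by apply: runs_le (runs_move _ _ _) _.
Qed.

Lemma runs_eval M tabs f D e s : structure_tapes M tabs ->
  context D e tabs s -> clean_stack (tp s 1) -> vars_lt D f -> D + depth f <= L ->
  runs (eval D f) s (eval_time N f) (upd s 1 (pushed (sat M e f) (tp s 1))).
Proof.
move=> [MN M0 M2 M3]; elim: f D e s => [b x|l r c|c x y z|f IH|f IHf g IHg|f IH] D e s Hs Hc Hf HD /=.
- have Hx : all (fun x => x < D) [:: x] by rewrite /= (Hf : x < D).
  have := runs_test (j := 0) (bsym b) isT Hs (@good_vars D 0 MoveR [:: x] Hx isT).
  rewrite walks_value_vars //= addn0 expn0 muln1 GRing.mulr1 M0 /=.
  by case: (onth _ _).
- move: Hf => /=; rewrite all_cat => /andP[Hl Hr].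
  set l' := _ ++ _; have Hl' : all (good_walk D) l'.
    by rewrite !all_cat !good_vars // all_nseq_true.
  have := runs_test (bsym true) (j := 2) isT Hs Hl'.
  rewrite /test_time (walks_time_shape (l' := nseq (size l + (c + size r)) (None, 0, MoveR))); last first.
    rewrite !map_cat -!map_comp !map_nseq /= !nseqD; congr (_ ++ (_ ++ _)).
      by elim: (l) => //= ? ? ->.
    by elim: (r) => //= ? ? ->.
  rewrite !walks_value_cat !walks_value_vars // walks_value_nseq M2.
  by congr (runs _ _ _ (upd _ _ (pushed _ _))) => /=; apply/eqP/eqP; lia.
- case/and3P: Hf => Hx Hy Hz.
  set l' := _ ++ _; have Hl' : all (good_walk D) l'.
    rewrite all_cat all_nseq_true //= /good_walk /= /level_tape; lia.
  have := runs_test (bsym true) (j := 3) isT Hs Hl'.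
  rewrite /test_time (walks_time_shape (l' := nseq (rel_code c) (None, 3, MoveR) ++
        [:: (None, 2, MoveR); (None, 1, MoveR); (None, 0, MoveR)])); last first.
    by rewrite !map_cat.
  suff -> : walks_value D e l' = Posz (rel_code c * N ^ 3 + e x * N ^ 2 + e y * N + e z).
    by case: Hs => _ _ Hv _; rewrite M3 //; [case: (Hv x)|case: (Hv y)|case: (Hv z)].
  rewrite walks_value_cat walks_value_nseq /= /walk_value /=.
  have lt i : i < D -> D.-1 - (level_tape D i - 8) = i by rewrite /level_tape; lia.
  rewrite !lt // !GRing.mulr1; lia.
- apply: runs_seq; first exact: (IH D e).
  apply: runs_seq; first exact: runs_move.
  apply: runs_if; rewrite scan_pushed; set b := sat M e f.
  have -> : upd s 1 (pushed (~~ b) (tp s 1)) =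
      upd (mv 1 (displacement MoveL) (upd s 1 (pushed b (tp s 1)))) 1
        (pushed (~~ b) (tp (mv 1 (displacement MoveL) (upd s 1 (pushed b (tp s 1)))) 1)).
    rewrite mv_upd_same upd_upd tp_upd; congr upd; rewrite /pushed /= GRing.addrK.
    by congr pair; apply: funext => z; case: eqP.
  by case: b; exact: runs_push.
- case/andP: Hf => Hf Hg; have [HDf HDg] : D + depth f <= L /\ D + depth g <= L.
    by move: HD => /=; lia.
  apply: runs_seq; first exact: (IHf D e).
  by apply: runs_and => //; exact: (IHg D e).
- apply: runs_seq; first exact: runs_push.
  (* Loop invariant: after [k] rounds the top of the stack tells whether [f] holds for all values
     below [k]. *)
  rewrite MN; pose g k := upd s 1 (pushed (all (fun x => sat M (scons x e) f) (iota 0 k)) (tp s 1)).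
  apply: (@runs_loop _ _ _ _ N g (marks_unary N)) => [k _|k kN].
    rewrite tp_upd_neq //; apply: (ctx_free Hs); by move: HD => /=; lia.
  rewrite /g !(updC _ (i := 1)) //.
  have -> : iota 0 k.+1 = iota 0 k ++ [:: k] by rewrite -addn1 iotaD.
  rewrite all_cat /= andbT; set s' := upd s (8 + D) _.
  have -> : tp s 1 = tp s' 1 by rewrite tp_upd_neq.
  apply: runs_and; first by rewrite tp_upd_neq.
  apply: IH => //; last by move: HD => /=; lia.
  split.
  + by move=> j Hj; rewrite tp_upd_neq ?(ctx_input Hs) //; move: Hj; rewrite !inE => /or3P[] /eqP ->.
  + by move=> j j4; rewrite tp_upd_neq ?(ctx_counters Hs) //; lia.
  + case=> [|i] iD.
      by rewrite (_ : level_tape D.+1 0 = 8 + D) ?tp_upd // /level_tape subn0.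
    rewrite tp_upd_neq; last by rewrite /level_tape; lia.
    have -> : level_tape D.+1 i.+1 = level_tape D i by rewrite /level_tape; lia.
    by apply: (ctx_vars Hs); lia.
  + by move=> l Hl; rewrite tp_upd_neq ?(ctx_free Hs) //; lia.
Qed.
End Evaluation.

(** * Preparation of the tapes *)

Definition append (t : nat) : prog := PSeq (PWrite t (bsym true)) (PMove t MoveR).

Fixpoint on_tapes (c : nat -> prog) (ts : seq nat) : prog :=
  if ts is t :: ts' then PSeq (c t) (on_tapes c ts') else PMove 0 MoveN.

Definition updates (s : mem) (ts : seq nat) (x : ztape) : mem :=
  Mem (fun k => if k \in ts then x else tp s k) (orc s).

(** The maximum covers both uses: rewriting a mark that is already there, and adding one at the
    end. *)
Lemma runs_append s t m k : k <= m -> tp s t = (unary m, k%:Z) ->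
  runs (append t) s 2 (upd s t (unary (maxn m k.+1), k.+1%:Z)).
Proof.
move=> km ts; apply: (@runs_seq _ _ _ 1 (upd s t (put (tp s t) (bsym true))) 1); first exact: runs_write.
have -> : upd s t (unary (maxn m k.+1), k.+1%:Z) =
    mv t (displacement MoveR) (upd s t (put (tp s t) (bsym true))).
  rewrite mv_upd_same ts; congr (upd _ t (_, _)); last by rewrite /=; lia.
  apply: funext => z; rewrite /unary /=; case: eqP => [->|ne].
    by rewrite ifT //; lia.
  by have -> : (0 <= z < (maxn m k.+1)%:Z)%R = (0 <= z < m%:Z)%R by lia.
exact: runs_move.
Qed.

Lemma runs_on_tapes c T x y ts s : uniq ts ->
  (forall s t, t \in ts -> tp s t = x -> runs (c t) s T (upd s t y)) ->
  runs (on_tapes c ts) (updates s ts x) (size ts * T + 1) (updates s ts y).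
Proof.
move=> + Hc; suff H ts1 ts2 : {subset ts2 <= ts} -> uniq (ts1 ++ ts2) ->
    runs (on_tapes c ts2) (updates (updates s ts2 x) ts1 y) (size ts2 * T + 1)
      (updates s (ts1 ++ ts2) y).
  move=> U; have := H [::] ts (fun t => id) U.
  by congr (runs _ _ _ _); apply: mem_eq.
elim: ts2 ts1 => [|t ts2 IH] ts1 sub U /=.
  have -> : updates (updates s [::] x) ts1 y = updates s (ts1 ++ [::]) y.
    by apply: mem_eq => // k /=; rewrite cats0.
  by have := runs_move 0 MoveN (updates s (ts1 ++ [::]) y); rewrite mv0.
have := U; rewrite cat_uniq /= negb_or => /and3P[_ /andP[t1 _] /andP[t2 _]].
rewrite mulSn -addnA; apply: runs_seq.
  apply: Hc; first by rewrite sub // mem_head.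
  by rewrite /= (negPf t1) mem_head.
have -> : upd (updates (updates s (t :: ts2) x) ts1 y) t y =
    updates (updates s ts2 x) (rcons ts1 t) y.
  apply: mem_eq => // k; rewrite /= mem_rcons !inE.
  by case: (eqVneq k t) => [->|].
rewrite -cat_rcons; apply: IH; last by rewrite cat_rcons.
by move=> u uts; rewrite sub // inE uts orbT.
Qed.

(** [D] is a scratch tape: it receives a copy of [E] and is erased cell by cell while [E] grows, so
    it is blank again for the next doubling. *)
Definition double (E D : nat) : prog :=
  PSeq (loop E (append D)) (PSeq (PWhile E None (PMove E MoveR)) (PSeq (PMove D MoveL)
  (PSeq (PWhile D None (PSeq (PWrite D None) (PSeq (PMove D MoveL) (append E))))
  (PSeq (PMove D MoveR) (rewind E))))).

Definition double_time (m : nat) : nat :=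
  loop_time m 2 + ((m * 2 + 1) + (1 + ((m * (1 + (1 + 2)).+1 + 1) + (1 + (2 * (m + m) + 3))))).

Lemma unary_max m : maxn m m.+1 = m.+1. Proof. by lia. Qed.

Lemma blank_unary : blank_tape = (unary 0, 0%R).
Proof. by congr pair; apply: funext => z; rewrite /unary ifF //; lia. Qed.

Lemma runs_double E D m s : E != D -> tp s E = (unary m, 0%R) -> tp s D = blank_tape ->
  runs (double E D) s (double_time m) (upd s E (unary (m + m), 0%R)).
Proof.
move=> ED sE sD; have DE : D != E by rewrite eq_sym.
pose st x y := upd (upd s E x) D y.
have stE x y : tp (st x y) E = x by rewrite tp_upd_neq // tp_upd.
have stD x y : tp (st x y) D = y by rewrite tp_upd.
have updE x y z : upd (st x y) E z = st z y by rewrite /st (updC _ _ _ DE) upd_upd.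
have updD x y z : upd (st x y) D z = st x z by rewrite /st upd_upd.
have mvE f p y z : mv E z (st (f, p) y) = st (f, p + z)%R y by rewrite /mv stE updE.
have mvD x f p z : mv D z (st x (f, p)) = st x (f, p + z)%R by rewrite /mv stD updD.
apply: (@runs_seq _ _ _ _ (st (unary m, 0%R) (unary m, m%:Z))).
  have {1}-> : s = st (unary m, 0%R) (unary 0, 0%:Z).
    by rewrite /st (upd_id sE) upd_id // -[RHS]blank_unary.
  apply: (@runs_loop _ _ _ _ m (fun k => st (unary m, 0%R) (unary k, k%:Z)) (marks_unary m)).
    by move=> k _; rewrite stE.
  move=> k km; rewrite !updE.
  have := @runs_append (st (unary m, k%:Z) (unary k, k%:Z)) D k k (leqnn k) (stD _ _).
  by rewrite updD unary_max.
apply: (@runs_seq _ _ _ _ (st (unary m, m%:Z) (unary m, m%:Z))).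
  apply: (@runs_until _ _ _ 1 m (fun k => st (unary m, k%:Z) (unary m, m%:Z))) => [k km||k km].
  - by rewrite stE /zscan /= /unary ifT //; lia.
  - by rewrite stE /zscan /= /unary ifF //; lia.
  - have -> : st (unary m, k.+1%:Z) (unary m, m%:Z) =
        mv E (displacement MoveR) (st (unary m, k%:Z) (unary m, m%:Z)).
      by rewrite mvE; congr (st (_, _) _) => /=; lia.
    exact: runs_move.
pose g k := st (unary (m + k), (m + k)%N%:Z) (unary (m - k), (m%:Z - k%:Z - 1)%R).
apply: (@runs_seq _ _ _ _ (g 0)).
  have -> : g 0 = mv D (displacement MoveL) (st (unary m, m%:Z) (unary m, m%:Z)).
    by rewrite mvD /g addn0 subn0; congr (st _ (_, _)) => /=; lia.
  exact: runs_move.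
apply: (@runs_seq _ _ _ _ (g m)).
  apply: (@runs_until _ _ _ (1 + (1 + 2)) m g) => [k km||k km].
  - by rewrite stD /zscan /= /unary ifT //; lia.
  - by rewrite stD /zscan /= /unary ifF //; lia.
  - apply: runs_seq; first exact: runs_write.
    rewrite stD updD.
    have -> : put (unary (m - k), (m%:Z - k%:Z - 1)%R) None = (unary (m - k.+1), (m%:Z - k%:Z - 1)%R).
      congr pair; apply: funext => z; rewrite /= /unary; case: eqP => [->|ne].
        by rewrite ifF //; lia.
      by have -> : (0 <= z < (m - k)%N%:Z)%R = (0 <= z < (m - k.+1)%N%:Z)%R by lia.
    apply: runs_seq; first exact: runs_move.
    rewrite mvD; set s' := st _ _.
    have := @runs_append s' E (m + k) (m + k) (leqnn _) (stE _ _).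
    rewrite updE unary_max -addnS; congr (runs _ _ _ (st _ (_, _))).
    by rewrite /=; lia.
apply: (@runs_seq _ _ _ _ (st (unary (m + m), (m + m)%N%:Z) blank_tape)).
  have -> : st (unary (m + m), (m + m)%N%:Z) blank_tape = mv D (displacement MoveR) (g m).
    by rewrite mvD blank_unary subnn; congr (st _ (_, _)) => /=; lia.
  exact: runs_move.
have := @runs_rewind E (unary (m + m)) (m + m) (m + m) (st (unary (m + m), (m + m)%N%:Z) blank_tape)
  (marks_unary _) (leqnn _) (stE _ _).
congr (runs _ _ _ _); rewrite updE /st upd_id //.
by rewrite tp_upd_neq.
Qed.

Lemma tp_override k h s j :
  tp (override k h s) j = if 4 <= j < 4 + k then h j else tp s j.
Proof. by []. Qed.

Section Preparation.
Variables (c0 L : nat).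

Let E := 8 + L.
Let D := (8 + L).+1.

Definition counter_tapes : seq nat := iota 4 (4 + L).

Fixpoint repeat (k : nat) (c : prog) : prog :=
  if k is k'.+1 then PSeq c (repeat k' c) else PMove 0 MoveN.

Lemma runs_repeat c T k (g : nat -> mem) :
  (forall i, i < k -> runs c (g i) T (g i.+1)) -> runs (repeat k c) (g 0) (k * T + 1) (g k).
Proof.
elim: k g => [|k IH] g H /=.
  by have := runs_move 0 MoveN (g 0); rewrite mv0.
rewrite mulSn -addnA; apply: runs_seq; first exact: H.
by apply: (IH (fun i => g i.+1)) => i Hi; apply: H.
Qed.

(* The counters first have the length [n + c0], where [n] is the length of the
   input; they are used to iterate [double], which gives their final length. *)
Definition prepare : prog :=
  let ts := counter_tapes in
  PSeq (loop 0 (on_tapes append ts)) (PSeq (repeat c0 (on_tapes append ts))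
  (PSeq (on_tapes rewind ts)
  (PSeq (append E) (PSeq (rewind E)
  (PSeq (power_loop 3 (double E D))
  (PSeq (loop E (on_tapes append ts)) (PSeq (on_tapes rewind ts)
  (PSeq (PWrite 2 (bsym true))
  (PSeq (power_loop 4 (PSeq (PGuess 3) (PMove 3 MoveR))) (rewind 3)))))))))).

Definition final_length (n : nat) : nat := 2 ^ ((n + c0) ^ 3).

Definition prepare_time (n : nat) : nat :=
  let N := final_length n in
  let a := (4 + L) * 2 + 1 in
  loop_time n a + ((c0 * a + 1) + (((4 + L) * (2 * (n + c0) + 3) + 1) +
  (2 + ((2 * 1 + 3) + (power_time (n + c0) 3 (double_time N) +
  (loop_time N a + (((4 + L) * (2 * N + 3) + 1) +
  (1 + (power_time N 4 2 + (2 * N ^ 4 + 3)))))))))).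

Definition guess_tape (o : nat -> bool) (k : nat) : int -> symbol :=
  fun z => if z is Posz i then (if i < k then bsym (o i) else None) else None.

Definition prepared (w : seq bool) (o : nat -> bool) (N : nat) : mem :=
  Mem (fun k =>
    if k == 0 then (input_tape w, 0%R) else
    if k == 2 then (put blank_tape (bsym true)) else
    if k == 3 then (guess_tape o (N ^ 4), 0%R) else
    if k \in counter_tapes then (unary N, 0%R) else
    if k == E then (unary N, 0%R) else blank_tape) (fun i => o (N ^ 4 + i)).

Lemma marks_guess o k : marks (guess_tape o k) k.
Proof. by case=> i //=; case: ifP => //=; lia. Qed.

Lemma counter_tapesE k : (k \in counter_tapes) = (4 <= k < 8 + L).
Proof. by rewrite mem_iota; lia. Qed.

Lemma runs_rewinds m s :
  runs (on_tapes rewind counter_tapes) (updates s counter_tapes (unary m, m%:Z))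
    ((4 + L) * (2 * m + 3) + 1) (updates s counter_tapes (unary m, 0%R)).
Proof.
have := @runs_on_tapes rewind (2 * m + 3) (unary m, m%:Z) (unary m, 0%R) counter_tapes s (iota_uniq _ _).
rewrite size_iota; apply => s' t _ st.
exact: runs_rewind (marks_unary m) (leqnn m) st.
Qed.

Lemma runs_appends m k s : k <= m ->
  runs (on_tapes append counter_tapes) (updates s counter_tapes (unary m, k%:Z))
    ((4 + L) * 2 + 1) (updates s counter_tapes (unary (maxn m k.+1), k.+1%:Z)).
Proof.
move=> km; have := @runs_on_tapes append 2 (unary m, k%:Z) (unary (maxn m k.+1), k.+1%:Z)
  counter_tapes s (iota_uniq _ _).
rewrite size_iota; apply => s' t _ st.
exact: runs_append km st.
Qed.

Lemma upd_updates s t x ts y : t \notin ts -> upd (updates s ts y) t x = updates (upd s t x) ts y.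
Proof.
move=> tts; apply: mem_eq => // k /=; case: (eqVneq k t) => [->|//].
by rewrite (negPf tts).
Qed.

Lemma runs_prepare w o :
  runs prepare (init_mem w o) (prepare_time (size w)) (prepared w o (final_length (size w))).
Proof.
set n := size w; set N := final_length n; set l := n + c0.
set s0 := init_mem w o; pose ct := counter_tapes.
have ct0 k : ~~ (4 <= k < 8 + L) -> k \notin ct by rewrite /ct counter_tapesE.
apply: (@runs_seq _ _ _ _ (updates s0 ct (unary n, n%:Z))).
  have {1}-> : s0 = updates s0 ct (unary 0, 0%:Z).
    apply: mem_eq => // k /=; case: (boolP (k \in ct)) => // H.
    have -> : (k == 0) = false.
      by apply: contraTF H => /eqP ->; exact: ct0.
    exact: blank_unary.
  apply: (@runs_loop _ _ _ _ n (fun k => updates s0 ct (unary k, k%:Z)) (marks_input w)).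
    by move=> k _; rewrite /= (negPf (ct0 _ _)).
  move=> k _; rewrite !upd_updates ?ct0 //.
  by have := @runs_appends k k (upd s0 0 (input_tape w, k%:Z)) (leqnn k); rewrite unary_max.
apply: (@runs_seq _ _ _ _ (updates s0 ct (unary l, l%:Z))).
  have := @runs_repeat (on_tapes append counter_tapes) ((4 + L) * 2 + 1) c0
    (fun k => updates s0 ct (unary (n + k), (n + k)%N%:Z)).
  rewrite addn0; apply => i _; rewrite (addnS n).
  by have := @runs_appends (n + i) (n + i) s0 (leqnn _); rewrite unary_max.
apply: runs_seq; first exact: runs_rewinds.
set s1 := updates s0 ct _.
have Ect : E \notin ct by apply: ct0; rewrite /E; lia.
have Dct : D \notin ct by apply: ct0; rewrite /D; lia.
have ED : E != D by rewrite /E /D; lia.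
pose g i := upd s1 E (unary (2 ^ i), 0%R).
apply: (@runs_seq _ _ _ _ (upd s1 E (unary 1, 1%:Z))).
  apply: (@runs_append s1 E 0 0) => //.
  by rewrite /= (negPf Ect) -blank_unary /E.
apply: (@runs_seq _ _ _ _ (g 0)).
  have := @runs_rewind E (unary 1) 1 1 (upd s1 E (unary 1, 1%:Z)) (marks_unary 1) isT (tp_upd _ _ _).
  by rewrite upd_upd.
apply: (@runs_seq _ _ _ _ (upd s1 E (unary N, 0%R))).
  apply: (@runs_power 3 _ (double_time N) l g (l ^ 3) 0) => [i h il|i j j3|//].
  - have E1 : (4 <= E < 4 + 3) = false by rewrite /E; lia.
    have D1 : (4 <= D < 4 + 3) = false by rewrite /D; lia.
    have -> : override 3 h (g i.+1) =
        upd (override 3 h (g i)) E (unary (2 ^ i + 2 ^ i), 0%R).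
      apply: mem_eq => // k; rewrite addnn -mul2n -expnS /g tp_override.
      case: (eqVneq k E) => [->|kE]; first by rewrite E1 !tp_upd.
      by rewrite !(tp_upd_neq _ _ kE) tp_override tp_upd_neq.
    apply: runs_le (runs_double ED _ _) _.
    + by rewrite tp_override E1 tp_upd.
    + rewrite tp_override D1 tp_upd_neq 1?eq_sym // /s1.
      by rewrite [LHS]/= (negPf Dct).
    + have : 2 ^ i <= N by rewrite leq_exp2l // ltnW.
      rewrite /double_time /loop_time; lia.
  - rewrite tp_upd_neq; last by rewrite /E; lia.
    by rewrite /= ifT // counter_tapesE; lia.
(* Appending first overwrites the [l] marks that the counters already carry, so they end with
   exactly [N] marks provided that [l <= N]. *)
have lN : l <= N.
  apply: leq_trans (ltnW (ltn_expl _ (isT : 1 < 2))) _.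
  rewrite /N /final_length -/l leq_exp2l //; case: (l) => // l'; exact: (@leq_pexp2l l'.+1 1 3).
set s2 := upd s0 E (unary N, 0%R).
have -> : upd s1 E (unary N, 0%R) = updates s2 ct (unary l, 0%:Z).
  by rewrite upd_updates.
apply: (@runs_seq _ _ _ _ (updates s2 ct (unary N, N%:Z))).
  have -> : updates s2 ct (unary N, N%:Z) = updates s2 ct (unary (maxn l N), N%:Z).
    by have -> : maxn l N = N by lia.
  have -> : updates s2 ct (unary l, 0%:Z) = updates s2 ct (unary (maxn l 0), 0%:Z).
    by rewrite maxn0.
  apply: (@runs_loop _ _ _ _ N (fun k => updates s2 ct (unary (maxn l k), k%:Z)) (marks_unary N)).
    by move=> k _; rewrite /= (negPf Ect) eqxx.
  move=> k _; rewrite !upd_updates //.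
  have := @runs_appends (maxn l k) k (upd s2 E (unary N, k%:Z)) (leq_maxr _ _).
  by have -> : maxn (maxn l k) k.+1 = maxn l k.+1 by lia.
apply: runs_seq; first exact: runs_rewinds.
apply: runs_seq; first exact: runs_write.
set s3 := upd _ 2 _.
pose g' i := Mem (fun k => if k == 3 then (guess_tape o i, i%:Z) else tp s3 k) (fun k => o (i + k)).
have -> : s3 = g' 0.
  apply: mem_eq => // k /=; case: (eqVneq k 3) => [->|//].
  rewrite (negPf (ct0 3 _)) // /blank_tape; congr pair.
  by apply: funext; case.
apply: (@runs_seq _ _ _ _ (g' (N ^ 4))).
  apply: (@runs_power 4 _ 2 N g' (N ^ 4) 0) => [i h _|i j j4|//].
  - apply: (@runs_seq _ _ _ 1 _ 1); first exact: runs_guess.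
    set s4 := upd _ 3 _.
    suff -> : override 4 h (g' i.+1) = mv 3 (displacement MoveR) s4 by exact: runs_move.
    apply: mem_eq => [k|]; last by apply: funext => k /=; rewrite addSnnS.
    rewrite /=; case: (eqVneq k 3) => [->|//] /=; rewrite addn0; congr pair; last by lia.
    apply: funext; case=> // z; rewrite /put /=; case: eqP => [[->]|ne]; first by rewrite ltnS leqnn.
    by have -> : (z < i.+1) = (z < i) by lia.
  - change (tp (g' i) (4 + j)) with (if 4 + j == 3 then (guess_tape o i, i%:Z) else tp s3 (4 + j)).
    have -> : (4 + j == 3) = false by lia.
    rewrite tp_upd_neq; last by lia.
    have H : (4 + j \in counter_tapes) by rewrite counter_tapesE; lia.
    by rewrite [LHS]/= H.
have -> : prepared w o N = upd (g' (N ^ 4)) 3 (guess_tape o (N ^ 4), 0%R).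
  apply: mem_eq => // k /=.
  case: (eqVneq k 3) => [->|k3] //=.
  case: (eqVneq k 2) => [->|k2] /=; first by rewrite (negPf (ct0 2 _)).
  case: (eqVneq k 0) => [->|k0] /=; first by rewrite (negPf (ct0 0 _)).
  by case: ifP => // _; rewrite /s2 /=.
apply: runs_rewind (marks_guess o _) (leqnn _) _.
by rewrite /=.
Qed.
End Preparation.

(** * Existential second-order definable languages are in NEXP *)

Definition exp_bounded (f : nat -> nat) : Prop :=
  exists p : {poly nat}, forall n, f n <= 2 ^ p.[n]%R.

Lemma exp_bounded_cst c : exp_bounded (fun _ => c).
Proof. by exists (c%:P)%R => n; rewrite hornerC; apply: ltnW; apply: ltn_expl. Qed.

Lemma exp_bounded_mul f g : exp_bounded f -> exp_bounded g -> exp_bounded (fun n => f n * g n).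
Proof.
case=> p Hp [q Hq]; exists (p + q)%R => n; rewrite hornerD expnD.
exact: leq_mul.
Qed.

Lemma exp_bounded_add f g : exp_bounded f -> exp_bounded g -> exp_bounded (fun n => f n + g n).
Proof.
case=> p Hp [q Hq]; exists (p + q + 1)%R => n.
have -> : (p + q + 1).[n]%R = (p.[n]%R + q.[n]%R).+1 by rewrite !hornerE; exact: addn1.
rewrite expnS expnD; have := Hp n; have := Hq n.
have := expn_gt0 2 p.[n]%R; have := expn_gt0 2 q.[n]%R.
move: (2 ^ p.[n]%R) (2 ^ q.[n]%R) (f n) (g n) => a b x y /=; nia.
Qed.

Lemma exp_bounded_succ f : exp_bounded f -> exp_bounded (fun n => (f n).+1).
Proof.
move=> Hf; have := exp_bounded_add (exp_bounded_cst 1) Hf.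
by [].
Qed.

Lemma exp_bounded_loop f g : exp_bounded f -> exp_bounded g ->
  exp_bounded (fun n => loop_time (f n) (g n)).
Proof.
move=> Hf Hg; rewrite /loop_time.
by do ![apply: exp_bounded_add | apply: exp_bounded_mul | apply: exp_bounded_succ
       | exact: exp_bounded_cst | assumption].
Qed.

Lemma exp_bounded_power f k g : exp_bounded f -> exp_bounded g ->
  exp_bounded (fun n => power_time (f n) k (g n)).
Proof. by move=> Hf Hg; elim: k => //= k IH; apply: exp_bounded_loop. Qed.

Lemma exp_bounded_expn f k : exp_bounded f -> exp_bounded (fun n => f n ^ k).
Proof.
move=> Hf; elim: k => [|k IH]; first exact: exp_bounded_cst.
case: (exp_bounded_mul Hf IH) => p Hp; exists p => n.
by rewrite expnS.
Qed.

Ltac exp_bounded := do ![assumption | exact: exp_bounded_cst | apply: exp_bounded_loop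
  | apply: exp_bounded_power | apply: exp_bounded_add | apply: exp_bounded_mul
  | apply: exp_bounded_succ | apply: exp_bounded_expn].

Lemma exp_bounded_test f l : exp_bounded f -> exp_bounded (fun n => test_time (f n) l).
Proof.
move=> Hf; have H : exp_bounded (fun n => walks_time (f n) l).
  rewrite /walks_time; apply: exp_bounded_add; last exact: exp_bounded_cst.
  elim: l => [|x l IH] /=; first exact: exp_bounded_cst.
  rewrite /walk_time; exp_bounded.
rewrite /test_time; exp_bounded.
Qed.

Lemma exp_bounded_eval f phi : exp_bounded f -> exp_bounded (fun n => eval_time (f n) phi).
Proof.
move=> Hf; elim: phi => /= *; try exact: exp_bounded_test; exp_bounded.
Qed.

Lemma exp_bounded_final_length c0 : exp_bounded (final_length c0).
Proof.
exists (('X + c0%:P) ^+ 3)%R => n.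
have -> : (('X + c0%:P) ^+ 3).[n]%R = (n + c0) ^ 3.
  by rewrite horner_exp hornerD hornerX hornerC.
by [].
Qed.

Lemma exp_bounded_prepare c0 L : exp_bounded (prepare_time c0 L).
Proof.
have H1 := exp_bounded_final_length c0.
have H2 : exp_bounded (fun n => n).
  by exists 'X%R => n; rewrite hornerX; apply: ltnW; apply: ltn_expl.
rewrite /prepare_time /double_time; exp_bounded.
Qed.

Lemma vars_lt_mono D D' f : D <= D' -> vars_lt D f -> vars_lt D' f.
Proof.
elim: f D D' => /= [b x|l r c|c x y z|f IH|f IHf g IHg|f IH] D D' DD'.
- by move=> /leq_trans; apply.
- by apply: sub_all => x /leq_trans; apply.
- by move=> /and3P[H1 H2 H3]; rewrite !(leq_trans _ DD').
- exact: IH.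
- by move=> /andP[/(IHf _ _ DD') -> /(IHg _ _ DD') ->].
- exact: IH.
Qed.

Lemma vars_lt_exists f : exists D, vars_lt D f.
Proof.
elim: f => /= [b x|l r c|c x y z|f IH|f [D1 H1] g [D2 H2]|f [D IH]].
- by exists x.+1.
- exists (sumn (l ++ r)).+1; elim: (l ++ r) => //= x s IH.
  rewrite ltnS leq_addr /=; apply: sub_all IH => y /leq_trans; apply; lia.
- by exists (x + y + z).+1; lia.
- by [].
- by exists (maxn D1 D2); rewrite (vars_lt_mono _ H1) ?(vars_lt_mono _ H2) //; lia.
- by exists D; apply: vars_lt_mono IH.
Qed.

Lemma sat_eq N w G G' f e :
  (forall c x y z, x < N -> y < N -> z < N -> G c x y z = G' c x y z) ->
  (forall i, e i < N) ->
  sat (Structure N w G) e f = sat (Structure N w G') e f.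
Proof.
move=> GG'; elim: f e => //= [c x y z|f IH|f IHf g IHg|f IH] e He.
- exact: GG'.
- by rewrite IH.
- by rewrite IHf ?IHg.
- apply: eq_in_all => x; rewrite mem_iota => /andP[_ xN]; apply: IH.
  by case=> [|i] /=; [lia|exact: He].
Qed.

(** * The machine that guesses the relations and evaluates the sentence *)

Section Definable.
Variables (c0 : nat) (f : fo).
Hypothesis c0_ge2 : 1 < c0.

Let D0 := sval (cid (vars_lt_exists f)).
Let L := D0 + depth f.

Definition decide : prog :=
  PSeq (prepare c0 L) (PSeq (eval D0 f) (PMove 1 MoveL)).

(** The address is the one used by [eval], within the [N ^ 4] guessed cells of tape 3. *)
Definition guessed (N : nat) (o : nat -> bool) (c : relsym) (x y z : nat) : bool :=
  let p := rel_code c * N ^ 3 + x * N ^ 2 + y * N + z in (p < N ^ 4) && o p.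

Lemma indices_on_tapes K c ts : (forall t, t <= K -> indices_le K (c t)) ->
  all (fun t => t <= K) ts -> indices_le K (on_tapes c ts).
Proof. by move=> Hc; elim: ts => //= t ts IH /andP[/Hc -> /IH ->]. Qed.

Lemma indices_power K k c : 3 + k <= K -> indices_le K c -> indices_le K (power_loop k c).
Proof. by elim: k => //= k IH H Hc; rewrite IH //=; lia. Qed.

Lemma indices_walks K D j l : 8 + D <= K -> j <= K -> all (good_walk D) l ->
  indices_le K (walks l j).
Proof.
move=> DK jK; elim: l => //= [[[o k] d] l] IH /andP[/andP[/= Ho Hk] /IH ->].
have Hp : indices_le K (power_loop k (PMove j d)) by apply: indices_power => //; lia.
case: o Ho => [v|] Ho /=; rewrite Hp //.
by have -> : v <= K by lia.
Qed.

Lemma indices_test K D j l a : 8 + D <= K -> j <= K -> all (good_walk D) l ->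
  indices_le K (test_cell j l a).
Proof.
move=> DK jK Hl; have K1 : 1 <= K by lia.
by rewrite /= !(indices_walks DK jK) // ?all_map // jK K1.
Qed.

Lemma indices_eval K D g : 8 + D + depth g <= K -> vars_lt D g -> indices_le K (eval D g).
Proof.
elim: g D => [b x|l r c|c x y z|g IH|g1 IH1 g2 IH2|g IH] D HK Hv;
  have K8 : 8 + D <= K by apply: leq_trans HK; exact: leq_addr.
- apply: (@indices_test K D _ _ (bsym b)) => //.
  by have := @good_vars D 0 MoveR [:: x]; apply=> //=; rewrite (Hv : x < D).
- move: Hv => /=; rewrite all_cat => /andP[Hl Hr].
  apply: (@indices_test K D _ _ (bsym true)) => //; first by lia.
  by rewrite !all_cat !good_vars // all_nseq_true.
- case/and3P: Hv => Hx Hy Hz.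
  apply: (@indices_test K D _ _ (bsym true)) => //; first by lia.
  by rewrite all_cat all_nseq_true //= /good_walk /= /level_tape; lia.
- have K1 : 1 <= K by lia.
  by rewrite /= IH //= K1.
- have K1 : 1 <= K by lia.
  case/andP: Hv => H1 H2; rewrite /= IH1 ?IH2 ?K1 //; move: HK => /=; lia.
- have K1 : 1 <= K by lia.
  have KD : 8 + D <= K by lia.
  by rewrite /= IH ?K1 ?KD //=; move: HK => /=; lia.
Qed.

Lemma indices_decide : indices_le (9 + L) decide.
Proof.
have Hts : all (fun t => t <= 9 + L) (counter_tapes L).
  by apply/allP => t; rewrite counter_tapesE; lia.
have Ha : indices_le (9 + L) (on_tapes append (counter_tapes L)).
  by apply: indices_on_tapes => // t tK /=; rewrite tK.
have Hr : indices_le (9 + L) (on_tapes rewind (counter_tapes L)).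
  by apply: indices_on_tapes => // t tK /=; rewrite tK.
have Hrep : indices_le (9 + L) (repeat c0 (on_tapes append (counter_tapes L))).
  by elim: (c0) => // k IH; exact/andP/(conj Ha IH).
have He : indices_le (9 + L) (eval D0 f).
  apply: indices_eval; first by rewrite /L; lia.
  by rewrite /D0; case: cid.
have Hseq a b : indices_le (9 + L) a -> indices_le (9 + L) b -> indices_le (9 + L) (PSeq a b).
  by rewrite /= => -> ->.
have Hloop t c : t <= 9 + L -> indices_le (9 + L) c -> indices_le (9 + L) (loop t c).
  by rewrite /= => -> ->.
have Hwhile t a c : t <= 9 + L -> indices_le (9 + L) c -> indices_le (9 + L) (PWhile t a c).
  by rewrite /= => -> ->.
have K8 : 8 + L <= 9 + L by lia.
have K9 : (8 + L).+1 <= 9 + L by lia.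
rewrite /decide /prepare /double.
by repeat first [assumption | apply Hseq | apply Hloop | apply Hwhile | apply indices_power | done].
Qed.

Lemma runs_decide w o : exists s',
  runs decide (init_mem w o)
    (prepare_time c0 L (size w) + (eval_time (final_length c0 (size w)) f + 1)) s' /\
  zscan (tp s' 1) = bsym (sat (Structure (final_length c0 (size w)) w
     (guessed (final_length c0 (size w)) o)) (fun _ => 0) f).
Proof.
set N := final_length c0 (size w); set M := Structure _ _ _.
set s := prepared L w o N.
have N_gt0 : 0 < N by rewrite expn_gt0.
pose tabs j := if j == 0 then input_tape w else if j == 2 then (put blank_tape (bsym true)).1
   else guess_tape o (N ^ 4).
have HM : structure_tapes N M tabs.
  split=> //.
  - by move=> z; rewrite /tabs /= ; case: (z == 0%R).
  - move=> c x y z xN yN zN; rewrite /tabs /= /guessed.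
    by case: ifP => // _; case: (o _).
have Hs : context N L D0 (fun _ => 0) tabs s.
  split.
  - by move=> j; rewrite !inE => /or3P[] /eqP ->.
  - move=> j j4; have H : 4 + j \in counter_tapes L by rewrite counter_tapesE; lia.
    by rewrite /s /prepared [LHS]/= H.
  - move=> i iD; have H : level_tape D0 i \in counter_tapes L.
      by rewrite counter_tapesE /level_tape /L; lia.
    by rewrite /s /prepared [tp _ _]/= H.
  - move=> l Hl; have H : 8 + l \in counter_tapes L by rewrite counter_tapesE; lia.
    by rewrite /s /prepared [LHS]/= H.
have s1 : tp s 1 = blank_tape.
  have H : (1 \in counter_tapes L) = false by rewrite counter_tapesE.
  by rewrite /s /prepared [LHS]/= H.
have Hc : clean_stack (tp s 1) by move=> z _; rewrite s1.
have Hv : vars_lt D0 f by rewrite /D0; case: cid.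
exists (mv 1 (displacement MoveL) (upd s 1 (pushed (sat M (fun _ => 0) f) (tp s 1)))).
split; last exact: scan_pushed.
apply: runs_seq; first exact: runs_prepare.
apply: runs_seq; last exact: runs_move.
exact: (@runs_eval N L M tabs f D0 _ s HM Hs Hc Hv (leqnn _)).
Qed.

(** Base-[N] addressing is injective as soon as the relation codes, at most 8, are digits; decoding
    an address then tells which bit the stream must provide. *)
Lemma guessed_surjective N (G : relsym -> nat -> nat -> nat -> bool) : 8 < N ->
  exists o, forall c x y z, x < N -> y < N -> z < N -> G c x y z = guessed N o c x y z.
Proof.
move=> N8; have N0 : 0 < N by lia.
pose rs := [:: RSet; RStep; RDom; RInd; RConcept; RRole; RAssign; RValue; RLabel].
exists (fun p => G (nth RSet rs (p %/ N %/ N %/ N)) (p %/ N %/ N %% N) (p %/ N %% N) (p %% N)).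
move=> c x y z xN yN zN; rewrite /guessed.
have -> : rel_code c * N ^ 3 + x * N ^ 2 + y * N + z = ((rel_code c * N + x) * N + y) * N + z.
  by rewrite !expnS expn0; nia.
have d a b : b < N -> (a * N + b) %/ N = a by move=> bN; rewrite divnMDl // divn_small // addn0.
have m a b : b < N -> (a * N + b) %% N = b by move=> bN; rewrite modnMDl modn_small.
rewrite !d // !m //; have -> : nth RSet rs (rel_code c) = c by case: c.
suff -> : ((rel_code c * N + x) * N + y) * N + z < N ^ 4 by [].
have cN : rel_code c < N by case: c => /=; lia.
have ltN a b k : a < k -> b < N -> a * N + b < N * k.
  move=> ak bN; have : a.+1 * N <= k * N by rewrite leq_mul2r ak orbT.
  by rewrite mulSn; lia.
by rewrite !expnS expn0 muln1 !ltN.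
Qed.

Theorem eso_NEXP : NEXP (fun w => exists G,
  sat (Structure (2 ^ ((size w + c0) ^ 3)) w G) (fun _ => 0) f).
Proof.
pose T n := prepare_time c0 L n + (eval_time (final_length c0 n) f + 1).
have HT : exp_bounded (fun n => (T n).+1).
  have H1 := exp_bounded_prepare c0 L.
  have H2 := exp_bounded_eval f (exp_bounded_final_length c0).
  rewrite /T; exp_bounded.
have Hterm w o : exists n s', n <= T (size w) /\ exec decide (init_mem w o) n s'.
  by have [s' [[n nT He] _]] := runs_decide w o; exists n, s'.
have [p Hp] := HT; exists (machine (9 + L) decide), p; split.
  move=> w n c Hc; apply: leq_trans (Hp _).
  exact: (machine_runs_in_time _ indices_decide Hterm Hc).
move=> w; rewrite (machine_accepts _ indices_decide Hterm) //.
(* Since [c0] is at least 2, the length is at least [2 ^ (2 ^ 3)]. *)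
have N8 : 8 < final_length c0 (size w).
  apply: (@leq_trans (2 ^ (2 ^ 3))) => //; rewrite leq_exp2l // leq_exp2r //; lia.
split=> [[G HG]|[o [n [s' [He Hs]]]]].
  have [o Ho] := guessed_surjective G N8.
  have [s' [[n nT He] Hs]] := runs_decide w o.
  exists o, n, s'; split=> //; rewrite Hs; congr bsym.
  rewrite -(@sat_eq _ w G) //; by lia.
have [s2 [[n2 _ He2] Hs2]] := runs_decide w o.
have E : s' = s2.
  have [_ /(_ erefl)[_ [->]]] := dsteps_det (exec_dsteps He) (exec_dsteps He2) erefl.
  by [].
exists (guessed (final_length c0 (size w)) o).
move: Hs; rewrite E Hs2 => - [].
by rewrite /final_length.
Qed.
End Definable.

(** * Definable predicates *)

(** The equivalence is restricted to environments with values in the structure. This bound makes the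
    difference that witnesses [definable_lt] an element. *)
Definition definable (P : structure -> (nat -> nat) -> Prop) : Prop :=
  exists f, forall M e, (forall i, e i < sN M) -> sat M e f <-> P M e.

Lemma definable_ext P Q :
  (forall M e, (forall i, e i < sN M) -> P M e <-> Q M e) -> definable P -> definable Q.
Proof.
by move=> PQ [f Hf]; exists f => M e He; rewrite -PQ; [apply: Hf|].
Qed.

Lemma definable_not P : definable P -> definable (fun M e => ~ P M e).
Proof.
by case=> f Hf; exists (FNot f) => M e He /=; rewrite -Hf //; split=> /negP.
Qed.

Lemma definable_and P Q : definable P -> definable Q -> definable (fun M e => P M e /\ Q M e).
Proof.
case=> f Hf [g Hg]; exists (FAnd f g) => M e He /=.
by rewrite -Hf // -Hg //; split=> /andP.
Qed.

Lemma definable_or P Q : definable P -> definable Q -> definable (fun M e => P M e \/ Q M e).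
Proof.
move=> HP HQ; apply: (definable_ext (P := fun M e => ~ (~ P M e /\ ~ Q M e))).
  move=> M e _; split; last by tauto.
  by move=> H; have [|] := pselect (P M e); have [|] := pselect (Q M e); tauto.
by apply/definable_not/definable_and; apply: definable_not.
Qed.

Lemma definable_imply P Q : definable P -> definable Q -> definable (fun M e => P M e -> Q M e).
Proof.
move=> HP HQ; apply: (definable_ext (P := fun M e => ~ P M e \/ Q M e)).
  by move=> M e _; have [|] := pselect (P M e); tauto.
by apply: definable_or => //; apply: definable_not.
Qed.

Lemma definable_iff P Q : definable P -> definable Q -> definable (fun M e => P M e <-> Q M e).
Proof. by move=> HP HQ; apply: definable_and; apply: definable_imply. Qed.

Lemma definable_all (P : structure -> nat -> (nat -> nat) -> Prop) :
  definable (fun M e => P M (e 0) (fun i => e i.+1)) ->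
  definable (fun M e => forall x, x < sN M -> P M x e).
Proof.
case=> f Hf; exists (FAll f) => M e He /=.
have Hs x : x < sN M -> sat M (scons x e) f <-> P M x e.
  by move=> xN; apply: Hf; case.
split=> [/allP H x xN|H]; first by apply/Hs => //; apply: H; rewrite mem_iota.
by apply/allP => x; rewrite mem_iota => xN; apply/Hs => //; apply: H.
Qed.

Lemma definable_ex (P : structure -> nat -> (nat -> nat) -> Prop) :
  definable (fun M e => P M (e 0) (fun i => e i.+1)) ->
  definable (fun M e => exists2 x, x < sN M & P M x e).
Proof.
move=> H; apply: (definable_ext (P := fun M e => ~ forall x, x < sN M -> ~ P M x e)).
  move=> M e _; split=> [|[x xN Px] /(_ x xN)]; last by [].
  move/existsNP => [x /not_implyP[xN /contrapT Px]]; by exists x.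
exact/definable_not/(@definable_all (fun M x e => ~ P M x e))/definable_not.
Qed.

Lemma definable_bit b i : definable (fun M e => onth (sw M) (e i) = Some b).
Proof. by exists (FBit b i) => M e He /=; split=> /eqP. Qed.

Lemma definable_rel c i j k : definable (fun M e => sG M c (e i) (e j) (e k)).
Proof. by exists (FRel c i j k). Qed.

Lemma definable_eq i j : definable (fun M e => e i = e j).
Proof. by exists (FLin [:: i] [:: j] 0) => M e He /=; split=> [/eqP|] ?; [lia|apply/eqP; lia]. Qed.

Lemma definable_cst i c : definable (fun M e => e i = c).
Proof. by exists (FLin [::] [:: i] c) => M e He /=; split=> [/eqP|] ?; [lia|apply/eqP; lia]. Qed.

Lemma definable_sum i j c k : definable (fun M e => e i + e j + c = e k).
Proof. by exists (FLin [:: i; j] [:: k] c) => M e He /=; split=> [/eqP|] ?; [lia|apply/eqP; lia]. Qed.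

Lemma definable_sums i j k l : definable (fun M e => e i + e j = e k + e l).
Proof. by exists (FLin [:: i; j] [:: k; l] 0) => M e He /=; split=> [/eqP|] ?; [lia|apply/eqP; lia]. Qed.

Lemma definable_succ i j c : definable (fun M e => e j = e i + c).
Proof. by exists (FLin [:: i] [:: j] c) => M e He /=; split=> [/eqP|] ?; [lia|apply/eqP; lia]. Qed.

Lemma definable_lt i j : definable (fun M e => e i < e j).
Proof.
apply: (definable_ext (P := fun M e => exists2 x, x < sN M & e i + x + 1 = e j)).
  move=> M e He; split=> [[x _ H]|H]; first by lia.
  by exists (e j - (e i).+1); [have := He j; lia|lia].
exact/(@definable_ex (fun M x e => e i + x + 1 = e j))/(definable_sum i.+1 0 1 j.+1).
Qed.

Fixpoint rename (r : nat -> nat) (f : fo) : fo :=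
  match f with
  | FBit b x => FBit b (r x)
  | FLin l r' c => FLin (map r l) (map r r') c
  | FRel c x y z => FRel c (r x) (r y) (r z)
  | FNot f => FNot (rename r f)
  | FAnd f g => FAnd (rename r f) (rename r g)
  | FAll f => FAll (rename (fun i => if i is i'.+1 then (r i').+1 else 0) f)
  end.

Lemma sat_rename M r e f : sat M e (rename r f) = sat M (e \o r) f.
Proof.
elim: f r e => //= [l r' c|f IH|f IHf g IHg|f IH] r e.
- by rewrite -!map_comp.
- by rewrite IH.
- by rewrite IHf IHg.
- apply: eq_all => x; rewrite IH; congr (sat M _ f).
  by apply: funext; case.
Qed.

Lemma definable_rename P r : definable P -> definable (fun M e => P M (e \o r)).
Proof.
by case=> f Hf; exists (rename r f) => M e He; rewrite sat_rename Hf // => i; exact: He.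
Qed.

Definition definable1 (Q : structure -> nat -> Prop) := definable (fun M e => Q M (e 0)).
Definition definable2 (Q : structure -> nat -> nat -> Prop) :=
  definable (fun M e => Q M (e 0) (e 1)).
Definition definable3 (Q : structure -> nat -> nat -> nat -> Prop) :=
  definable (fun M e => Q M (e 0) (e 1) (e 2)).
Definition definable4 (Q : structure -> nat -> nat -> nat -> nat -> Prop) :=
  definable (fun M e => Q M (e 0) (e 1) (e 2) (e 3)).

Lemma definable1_at Q i : definable1 Q -> definable (fun M e => Q M (e i)).
Proof. exact: (definable_rename (nth 0 [:: i])). Qed.
Lemma definable2_at Q i j : definable2 Q -> definable (fun M e => Q M (e i) (e j)).
Proof. exact: (definable_rename (nth 0 [:: i; j])). Qed.
Lemma definable3_at Q i j k : definable3 Q -> definable (fun M e => Q M (e i) (e j) (e k)).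
Proof. exact: (definable_rename (nth 0 [:: i; j; k])). Qed.
Lemma definable4_at Q i j k l :
  definable4 Q -> definable (fun M e => Q M (e i) (e j) (e k) (e l)).
Proof. exact: (definable_rename (nth 0 [:: i; j; k; l])). Qed.

Create HintDb definable.

(** Higher-order patterns abstract the bound variable of a quantifier, which becomes [e 0]. Atoms
    are recognised by their syntactic shape, and predicates treated earlier are applied to variables
    by renaming. *)
Ltac definable_step :=
  cbv beta;
  lazymatch goal with
  | |- definable (fun M e => _ /\ _) => apply definable_and
  | |- definable (fun M e => _ \/ _) => apply definable_or
  | |- definable (fun M e => _ <-> _) => apply definable_iff
  | |- definable (fun M e => ~ _) => apply definable_not
  | |- definable (fun M e => forall x, is_true (x < sN M) -> @?P M e x) =>
      refine (@definable_all (fun M x e => P M e x) _)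
  | |- definable (fun M e => exists2 x, is_true (x < sN M) & @?P M e x) =>
      refine (@definable_ex (fun M x e => P M e x) _)
  | |- definable (fun M e => _ -> _) => apply definable_imply
  | |- _ => first
     [ exact (definable_bit _ _) | exact (definable_eq _ _) | exact (definable_cst _ _)
     | exact (definable_sum _ _ _ _) | exact (definable_sums _ _ _ _)
     | exact (definable_succ _ _ _) | exact (definable_lt _ _)
     | exact (definable_rel _ _ _ _)
     | refine (@definable1_at _ _ _); solve [eauto with definable]
     | refine (@definable2_at _ _ _ _); solve [eauto with definable]
     | refine (@definable3_at _ _ _ _ _); solve [eauto with definable]
     | refine (@definable4_at _ _ _ _ _ _); solve [eauto with definable] ]
  end.

Ltac definable := repeat definable_step.

(** * Parsing *)

Notation "'all' x 'of' M , P" := (forall x, x < sN M -> P)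
  (at level 200, x name, M at level 0, P at level 200).
Notation "'some' x 'of' M , P" := (exists2 x, x < sN M & P)
  (at level 200, x name, M at level 0, P at level 200).

Definition bit (b : bool) (M : structure) (i : nat) : Prop := onth (sw M) i = Some b.
Definition inpos (M : structure) (i : nat) : Prop := bit false M i \/ bit true M i.
(** All tables are ternary; relations of smaller arity repeat their last argument, here as in [dom]
    or [tind]. *)
Definition sset (M : structure) (X i : nat) : Prop := sG M RSet X i i.

(* Every set of positions is coded by a number. *)
Definition set_axiom (M : structure) : Prop :=
  (some X of M, all i of M, ~ sset M X i) /\
  (all X of M, all i of M, inpos M i ->
     some Y of M, all k of M, (sset M Y k <-> sset M X k \/ k = i)).

(** Transitive closure is not first-order definable; it is replaced by membership in every coded set
    that contains [i] and is closed under the step. The parameter [c] is passed on to the step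
    relation. *)
Definition reach (R : structure -> nat -> nat -> nat -> Prop) M (c i j : nat) : Prop :=
  all X of M, (sset M X i ->
    (all a of M, all b of M, (sset M X a -> R M c a b -> sset M X b)) -> sset M X j).

Definition parser := structure -> nat -> nat -> Prop.

Definition pbit : parser := fun M i j => j = i + 1 /\ inpos M i.
Definition pseq (T1 T2 : parser) : parser := fun M i j => some k of M, (T1 M i k /\ T2 M k j).
Definition ptag (b : bool) (T : parser) : parser := fun M i j =>
  bit b M i /\ some k of M, (k = i + 1 /\ T M k j).
Definition por (T1 T2 : parser) : parser := fun M i j => T1 M i j \/ T2 M i j.
(** The end [b] has to lie in the word because the coded sets available by [set_axiom] are built
    from positions of the word. *)
Definition lstep (T : parser) M (c a b : nat) : Prop :=
  bit true M a /\ inpos M b /\ some k of M, (k = a + 1 /\ T M k b).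
Definition lreach (T : parser) M (i j : nat) : Prop := inpos M i /\ reach (lstep T) M i i j.
Definition plist (T : parser) : parser := fun M i j =>
  some k of M, (lreach T M i k /\ bit false M k /\ j = k + 1).
Definition litem (T : parser) M (i a : nat) : Prop := lreach T M i a /\ bit true M a.

Definition pword := plist pbit.
Definition prole := por (ptag false pword) (ptag true pword).
Definition pconcept := por (ptag false pword) (ptag true prole).
Definition pincl :=
  por (ptag false (por (ptag false (pseq pconcept pconcept)) (ptag true (pseq pconcept pconcept))))
      (ptag true (por (ptag false (pseq prole prole)) (ptag true (pseq prole prole)))).
Definition passert := por (ptag false (pseq pword pword)) (ptag true (pseq pword (pseq pword pword))).
Definition pterm := por (ptag false pword) (ptag true pword).
Definition patom := por (ptag false (pseq pword pterm)) (ptag true (pseq pword (pseq pterm pterm))).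

Lemma definable_bitp b : definable1 (bit b).
Proof. exact: definable_bit. Qed.
#[global] Hint Resolve definable_bitp : definable.

Lemma definable_inpos : definable1 inpos.
Proof. rewrite /definable1 /inpos; definable. Qed.
#[global] Hint Resolve definable_inpos : definable.

Lemma definable_sset : definable2 sset.
Proof. rewrite /definable2 /sset; definable. Qed.
#[global] Hint Resolve definable_sset : definable.

Lemma definable_reach R : definable3 R -> definable3 (reach R).
Proof. move=> HR; rewrite /definable3 /reach; definable. Qed.

Lemma definable_pbit : definable2 pbit.
Proof. rewrite /definable2 /pbit; definable. Qed.
Lemma definable_pseq T1 T2 : definable2 T1 -> definable2 T2 -> definable2 (pseq T1 T2).
Proof. move=> H1 H2; rewrite /definable2 /pseq; definable. Qed.
Lemma definable_ptag b T : definable2 T -> definable2 (ptag b T).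
Proof. move=> H1; rewrite /definable2 /ptag; definable. Qed.
Lemma definable_por T1 T2 : definable2 T1 -> definable2 T2 -> definable2 (por T1 T2).
Proof. move=> H1 H2; rewrite /definable2 /por; definable. Qed.
Lemma definable_lstep T : definable2 T -> definable3 (lstep T).
Proof. move=> H1; rewrite /definable3 /lstep; definable. Qed.
#[global] Hint Resolve definable_lstep definable_reach : definable.
Lemma definable_lreach T : definable2 T -> definable2 (lreach T).
Proof.
move=> HT; rewrite /definable2 /lreach.
apply: definable_and; first by definable.
exact/(definable3_at 0 0 1)/definable_reach/definable_lstep.
Qed.
#[global] Hint Resolve definable_lreach : definable.
Lemma definable_plist T : definable2 T -> definable2 (plist T).
Proof. move=> HT; rewrite /definable2 /plist; definable. Qed.
Lemma definable_litem T : definable2 T -> definable2 (litem T).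
Proof. move=> HT; rewrite /definable2 /litem; definable. Qed.
#[global] Hint Resolve definable_pbit definable_pseq definable_ptag definable_por
  definable_plist definable_litem : definable.
Ltac definable_parser :=
  repeat first [solve [eauto 2 with definable] | apply definable_por
    | apply definable_ptag | apply definable_pseq | apply definable_plist].

Lemma definable_pword : definable2 pword.
Proof. rewrite /pword; definable_parser. Qed.
#[global] Hint Resolve definable_pword : definable.
Lemma definable_prole : definable2 prole.
Proof. rewrite /prole; definable_parser. Qed.
#[global] Hint Resolve definable_prole : definable.
Lemma definable_pconcept : definable2 pconcept.
Proof. rewrite /pconcept; definable_parser. Qed.
#[global] Hint Resolve definable_pconcept : definable.
Lemma definable_pincl : definable2 pincl.
Proof. rewrite /pincl; definable_parser. Qed.
Lemma definable_passert : definable2 passert.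
Proof. rewrite /passert; definable_parser. Qed.
Lemma definable_pterm : definable2 pterm.
Proof. rewrite /pterm; definable_parser. Qed.
#[global] Hint Resolve definable_pterm : definable.
Lemma definable_patom : definable2 patom.
Proof. rewrite /patom; definable_parser. Qed.
#[global] Hint Resolve definable_pincl definable_passert definable_patom : definable.

Lemma definable_set_axiom : definable (fun M _ => set_axiom M).
Proof. rewrite /set_axiom; definable. Qed.

(** * Positions of encoded objects *)

Definition seg (w : seq bool) (i : nat) (u : seq bool) (j : nat) : Prop :=
  drop i w = u ++ drop j w /\ j = i + size u.

Lemma seg_nil w i j : seg w i [::] j <-> j = i.
Proof. by split=> [[_ ->]|->]; [rewrite addn0|split; rewrite ?addn0]. Qed.

Lemma seg_cat w i u v j : seg w i (u ++ v) j <-> exists2 k, seg w i u k & seg w k v j.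
Proof.
split=> [[E Ej]|[k [E1 Ek] [E2 Ej]]]; subst.
  have H : drop (i + size u) w = v ++ drop (i + size (u ++ v)) w.
    by rewrite addnC -drop_drop E -catA drop_size_cat.
  exists (i + size u); split=> //; first by rewrite H E -catA.
  by rewrite size_cat addnA.
by rewrite /seg size_cat addnA; split=> //; rewrite E1 E2 catA.
Qed.

Lemma seg_det w i u j k : seg w i u j -> seg w i u k -> j = k.
Proof. by case=> _ -> [_ ->]. Qed.

Lemma seg_bit M i b : bit b M i <-> seg (sw M) i [:: b] i.+1.
Proof.
rewrite /bit; split=> [H|[E _]].
  split; last by rewrite addn1.
  elim: (sw M) i H => [|c s IH] [|i] //=; first by case=> ->; rewrite drop0.
  exact: IH.
elim: (sw M) i E => [|c s IH] [|i] //=; first by case=> ->.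
exact: IH.
Qed.

Lemma seg_cons M i b u j : seg (sw M) i (b :: u) j <-> bit b M i /\ seg (sw M) i.+1 u j.
Proof.
rewrite -cat1s seg_cat seg_bit; split=> [[k H1 H2]|[H1 H2]]; last by exists i.+1.
by have E := seg_det H1 (conj (proj1 H1) (proj2 H1)); have [_ Ek] := H1; move: H1 H2; rewrite Ek addn1.
Qed.

Lemma bit_lt M i b : bit b M i -> i < size (sw M).
Proof. by rewrite /bit; elim: (sw M) i => [|c s IH] [|i] //=; exact: IH. Qed.

Lemma bit_det M i b c : bit b M i -> bit c M i -> b = c.
Proof. by rewrite /bit => -> []. Qed.

Lemma inposP M i : inpos M i <-> i < size (sw M).
Proof.
split=> [[]|]; first exact: bit_lt.
  exact: bit_lt.
rewrite /inpos /bit; elim: (sw M) i => [|c s IH] [|i] //=; last exact: IH.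
by case: c; [right|left].
Qed.

Lemma seg_le w i u j : seg w i u j -> 0 < size u -> i < size w /\ j <= size w.
Proof.
case=> E -> u0; have := congr1 size E; rewrite size_cat !size_drop; lia.
Qed.

Inductive chain (R : nat -> nat -> Prop) (i : nat) : nat -> nat -> Prop :=
| chain0 : chain R i 0 i
| chainS n j k : chain R i n j -> R j k -> chain R i n.+1 k.

(** Prefix-freeness in cancellation form, as needed to compare two decompositions of the same word;
    non-emptiness of the codes keeps their positions inside the word. *)
Definition proper (T : Type) (enc : T -> seq bool) : Prop :=
  (forall x y s t, enc x ++ s = enc y ++ t -> x = y /\ s = t) /\
  (forall x, 0 < size (enc x)).

Definition items (T : Type) (enc : T -> seq bool) (s : seq T) : seq bool :=
  flatten [seq true :: enc x | x <- s].

Lemma items_cat T (enc : T -> seq bool) s t : items enc (s ++ t) = items enc s ++ items enc t.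
Proof. by rewrite /items map_cat flatten_cat. Qed.

Lemma seg_unique T (enc : T -> seq bool) w i x y j k : proper enc ->
  seg w i (enc x) j -> seg w i (enc y) k -> x = y /\ j = k.
Proof.
case=> H _ [E1 Ej] [E2 Ek]; subst; rewrite E1 in E2.
by case: (H _ _ _ _ E2) => -> _.
Qed.

Lemma proper_list T (enc : T -> seq bool) : proper enc -> proper (enc_list enc).
Proof.
case=> H H0; split; last by move=> x; rewrite /enc_list size_cat addn1.
rewrite /enc_list; elim=> [|x s IH] [|y t] u v //=.
- by case.
- rewrite -!catA => -[/H[-> E]].
  by have [|-> ->] := IH t u v; rewrite -?catA.
Qed.

(** * Correctness of the parsers *)

Section Specification.
Variable M : structure.
Hypotheses (set_ok : set_axiom M) (long : size (sw M) + 2 < sN M).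

(** The axiom provides the empty set and the adjunction of one position; going through the positions
    of the word one after the other reaches any set. *)
Lemma set_exists (P : nat -> Prop) : some X of M,
  all k of M, (sset M X k <-> k < size (sw M) /\ P k).
Proof.
suff H m : m <= size (sw M) -> some X of M, all k of M, (sset M X k <-> k < m /\ P k).
  exact: H.
elim: m => [|m IH] Hm.
  by case: set_ok => -[X XN HX] _; exists X => // k kN; split=> [/HX|[]//]; exact.
have [X XN HX] := IH (ltnW Hm).
have mN : m < sN M by lia.
have [Pm|nPm] := pselect (P m).
  have [Y YN HY] := set_ok.2 X XN m mN ((inposP M m).2 Hm).
  exists Y => // k kN; rewrite HY // HX //; split=> [[[km Pk]|->]|[km Pk]].
  - by split=> //; lia.
  - by [].
  - by case: (eqVneq k m) => ?; [right|left; split=> //; lia].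
exists X => // k kN; rewrite HX //; split=> [[km Pk]|[km Pk]]; split=> //; first by lia.
by case: (eqVneq k m) => [E|?]; [rewrite E in Pk|lia].
Qed.

(** For the direct implication, take as closed set the positions reachable in some number of steps;
    it is coded because steps end in the word. *)
Lemma reachP R c i j : j < sN M -> inpos M i -> (forall a b, R M c a b -> inpos M b) ->
  reach R M c i j <-> exists n, chain (R M c) i n j.
Proof.
move=> jN /inposP iM RM; split=> [H|[n Hn] X XN Xi HX].
  have [X XN HX] := set_exists (fun k => exists n, chain (R M c) i n k).
  have iN : i < sN M by lia.
  have := H X XN; rewrite HX // => /(_ (conj iM (ex_intro _ 0 (chain0 _ _)))).
  case/(fun H1 H2 => (HX j jN).1 (H1 H2)) => [a aN b bN|_] //.
  rewrite !HX // => -[aM [n Hn]] Rab; split; first exact/inposP/(RM _ _ Rab).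
  by exists n.+1; apply: chainS Rab.
elim: Hn jN => // {}n k l Hk IH Rkl lN.
have kN : k < sN M.
  by case: Hk => [|m a b _ /RM /inposP] *; lia.
exact: HX (IH kN) Rkl.
Qed.

Definition parses T (P : parser) (enc : T -> seq bool) : Prop :=
  forall i j, P M i j <-> exists x, seg (sw M) i (enc x) j.

(** Keeping the number of steps, which is the number of items passed, makes it usable later as the
    index of an item ([word_chain]). *)
Lemma chain_list T (P : parser) (enc : T -> seq bool) c i n k : parses P enc -> proper enc ->
  inpos M i ->
  chain (lstep P M c) i n k <->
  inpos M k /\ exists2 s : seq T, size s = n & seg (sw M) i (items enc s) k.
Proof.
move=> PE [_ enc0] iM; split.
  elim=> [|{}n j {}k _ [_ [s Hs Hseg]] [Hb [kM [j' j'N [-> /PE[x Hx]]]]]].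
    by split=> //; exists [::] => //; apply/seg_nil.
  split=> //; exists (rcons s x); first by rewrite size_rcons Hs.
  rewrite -cats1 items_cat; apply/seg_cat; exists j => //.
  by rewrite /items /= cats0; apply/seg_cons; rewrite addn1 in Hx.
case=> kM [s Hs]; elim/last_ind: s n Hs k kM => [|s x IH] [|n] //=; rewrite ?size_rcons //.
  by move=> _ k _ /seg_nil ->; exact: chain0.
move=> [Hs] k kM; rewrite -cats1 items_cat => /seg_cat[j Hj].
rewrite /items /= cats0 => /seg_cons[Hb Hx].
have jM : inpos M j by right.
apply: chainS (IH _ Hs j jM Hj) _; split=> //; split=> //.
exists j.+1; first by have := bit_lt Hb; lia.
by rewrite addn1; split=> //; apply/PE; exists x.
Qed.

Lemma lreachP T (P : parser) (enc : T -> seq bool) i k : parses P enc -> proper enc ->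
  k < sN M ->
  lreach P M i k <-> [/\ inpos M i, inpos M k & exists s : seq T, seg (sw M) i (items enc s) k].
Proof.
move=> PE enc_proper kN; rewrite /lreach.
have [iM|iM] := pselect (inpos M i); last by split=> [[]|[]].
rewrite reachP //; last by move=> a b [_ []].
split=> [[_ [n /(chain_list _ _ _ PE enc_proper iM)[kM [s _ Hs]]]]|[_ kM [s Hs]]].
  by split=> //; exists s.
by split=> //; exists (size s); apply/(chain_list _ _ _ PE enc_proper iM); split=> //; exists s.
Qed.

Lemma parses_list T (P : parser) (enc : T -> seq bool) : parses P enc -> proper enc ->
  parses (plist P) (enc_list enc).
Proof.
move=> PE enc_proper i j; split.
  case=> k kN [/(lreachP _ PE enc_proper kN)[iM _ [s Hs]] [Hk ->]].
  exists s; apply/seg_cat; exists k => //.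
  by rewrite addn1; apply/seg_bit.
case=> s /seg_cat[k Hs Hj].
have /seg_cons[Hk /seg_nil ->] := Hj.
have kM : inpos M k by left.
have kN : k < sN M by have /inposP := kM; lia.
exists k => //; split; last by rewrite addn1.
apply/(lreachP _ PE enc_proper kN); split=> //; last by exists s.
apply/inposP; have /inposP kn := kM.
by case: Hs => _ Ek; lia.
Qed.

Lemma parses_seq T1 T2 (P1 P2 : parser) (enc1 : T1 -> seq bool) (enc2 : T2 -> seq bool) :
  parses P1 enc1 -> parses P2 enc2 -> proper enc1 ->
  parses (pseq P1 P2) (fun x : T1 * T2 => enc1 x.1 ++ enc2 x.2).
Proof.
move=> H1 H2 [_ E1] i j; split.
  by case=> k kN [/H1[x Hx] /H2[y Hy]]; exists (x, y); apply/seg_cat; exists k.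
case=> -[x y] /seg_cat[k Hx Hy]; exists k; last by split; [apply/H1; exists x|apply/H2; exists y].
by have [] := seg_le Hx (E1 x); lia.
Qed.

Lemma parses_tag T b (P : parser) (enc : T -> seq bool) :
  parses P enc -> parses (ptag b P) (fun x => b :: enc x).
Proof.
move=> H i j; split.
  by case=> Hb [k kN [-> /H[x Hx]]]; exists x; apply/seg_cons; rewrite addn1 in Hx.
case=> x /seg_cons[Hb Hx]; split=> //; exists i.+1; first by have := bit_lt Hb; lia.
by rewrite addn1; split=> //; apply/H; exists x.
Qed.

Lemma parses_or T1 T2 T (P1 P2 : parser) (enc1 : T1 -> seq bool) (enc2 : T2 -> seq bool)
    (enc : T -> seq bool) (f1 : T1 -> T) (f2 : T2 -> T) :
  (forall x, enc (f1 x) = enc1 x) -> (forall x, enc (f2 x) = enc2 x) ->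
  (forall x, (exists y, x = f1 y) \/ (exists y, x = f2 y)) ->
  parses P1 enc1 -> parses P2 enc2 -> parses (por P1 P2) enc.
Proof.
move=> E1 E2 Hf H1 H2 i j; split.
  by case=> [/H1|/H2] [x Hx]; [exists (f1 x); rewrite E1|exists (f2 x); rewrite E2].
case=> x; have [[y ->]|[y ->]] := Hf x; rewrite ?E1 ?E2 => Hy.
  by left; apply/H1; exists y.
by right; apply/H2; exists y.
Qed.

Lemma parses_bit : parses pbit (fun b => [:: b]).
Proof.
move=> i j; split.
  case=> -> [] H; [exists false|exists true]; rewrite addn1; exact/seg_bit.
case=> b /seg_cons[Hb /seg_nil ->]; split; first by rewrite addn1.
by case: b Hb; [right|left].
Qed.

Lemma proper_bit : proper (fun b : bool => [:: b]).
Proof. by split=> // x y s t []. Qed.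

Lemma proper_word : proper enc_word.
Proof. exact/proper_list/proper_bit. Qed.

Lemma parses_word : parses pword enc_word.
Proof. exact/parses_list/proper_bit/parses_bit. Qed.

Lemma parses_role : parses prole enc_role.
Proof.
by apply: (@parses_or _ _ _ _ _ _ _ _ Direct Inverse (fun _ => erefl) (fun _ => erefl));
  [case=> P; [left|right]; exists P|apply/parses_tag/parses_word|apply/parses_tag/parses_word].
Qed.

Lemma proper_role : proper enc_role.
Proof.
split; last by case.
by have [H _] := proper_word; case=> P [] Q s t //= [] /H[-> ->].
Qed.

Lemma parses_concept : parses pconcept enc_basic_concept.
Proof.
by apply: (@parses_or _ _ _ _ _ _ _ _ Atomic Exists (fun _ => erefl) (fun _ => erefl));
  [case=> P; [left|right]; exists P|apply/parses_tag/parses_word|apply/parses_tag/parses_role].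
Qed.

Lemma proper_concept : proper enc_basic_concept.
Proof.
split; last by case.
have [H _] := proper_word; have [H' _] := proper_role.
by case=> P [] Q s t //= [] => [/H|/H'] [-> ->].
Qed.

Lemma parses_incl : parses pincl enc_inclusion.
Proof.
pose f1 (x : basic_concept * basic_concept + basic_concept * basic_concept) :=
  match x with inl x => ConceptIncl x.1 x.2 | inr x => ConceptDisj x.1 x.2 end.
pose f2 (x : role * role + role * role) :=
  match x with inl x => RoleIncl x.1 x.2 | inr x => RoleDisj x.1 x.2 end.
pose e1 x := behead (enc_inclusion (f1 x)); pose e2 x := behead (enc_inclusion (f2 x)).
apply: (@parses_or _ _ _ _ _ (fun x => false :: e1 x) (fun x => true :: e2 x) _ f1 f2).
- by case.
- by case.
- case=> [x y|x y|x y|x y]; [left; exists (inl (x, y))|left; exists (inr (x, y))|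
    right; exists (inl (x, y))|right; exists (inr (x, y))]; done.
- apply: parses_tag; apply: (@parses_or _ _ _ _ _
     (fun x => false :: (enc_basic_concept x.1 ++ enc_basic_concept x.2))
     (fun x => true :: (enc_basic_concept x.1 ++ enc_basic_concept x.2)) e1 inl inr) => //.
  + by case=> x; [left|right]; exists x.
  + exact/parses_tag/parses_seq/proper_concept/parses_concept/parses_concept.
  + exact/parses_tag/parses_seq/proper_concept/parses_concept/parses_concept.
- apply: parses_tag; apply: (@parses_or _ _ _ _ _
     (fun x => false :: (enc_role x.1 ++ enc_role x.2))
     (fun x => true :: (enc_role x.1 ++ enc_role x.2)) e2 inl inr) => //.
  + by case=> x; [left|right]; exists x.
  + exact/parses_tag/parses_seq/proper_role/parses_role/parses_role.
  + exact/parses_tag/parses_seq/proper_role/parses_role/parses_role.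
Qed.

Lemma proper_incl : proper enc_inclusion.
Proof.
split; last by case.
have [H _] := proper_concept; have [H' _] := proper_role.
case=> a b [] c d s t //= []; rewrite -!catA.
- by move=> /H[-> /H[-> ->]].
- by move=> /H[-> /H[-> ->]].
- by move=> /H'[-> /H'[-> ->]].
- by move=> /H'[-> /H'[-> ->]].
Qed.

Lemma parses_assert : parses passert enc_assertion.
Proof.
apply: (@parses_or _ _ _ _ _ (fun x => false :: (enc_word x.1 ++ enc_word x.2))
  (fun x => true :: (enc_word x.1 ++ (enc_word x.2.1 ++ enc_word x.2.2)))
  _ (fun x => ConceptAssertion x.1 x.2) (fun x => RoleAssertion x.1 x.2.1 x.2.2)) => //.
- by case=> [x y|x y z]; [left; exists (x, y)|right; exists (x, (y, z))].
- exact/parses_tag/parses_seq/proper_word/parses_word/parses_word.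
- apply: parses_tag; apply: (@parses_seq _ _ _ _ enc_word (fun y => enc_word y.1 ++ enc_word y.2)
    parses_word _ proper_word).
  exact/parses_seq/proper_word/parses_word/parses_word.
Qed.

Lemma proper_assert : proper enc_assertion.
Proof.
split; last by case.
have [H _] := proper_word.
case=> [a b|a b c] [d e|d e f] s t //= []; move: enc_word H => encw H; rewrite -!catA.
- by move=> /H[-> /H[-> ->]].
- by move=> /H[-> /H[-> /H[-> ->]]].
Qed.

Lemma parses_term : parses pterm enc_term.
Proof.
by apply: (@parses_or _ _ _ _ _ _ _ _ Var Cst (fun _ => erefl) (fun _ => erefl));
  [case=> P; [left|right]; exists P|apply/parses_tag/parses_word|apply/parses_tag/parses_word].
Qed.

Lemma proper_term : proper enc_term.
Proof.
split; last by case.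
by have [H _] := proper_word; case=> P [] Q s t //= [] /H[-> ->].
Qed.

Lemma parses_atom : parses patom enc_atom.
Proof.
apply: (@parses_or _ _ _ _ _ (fun x => false :: (enc_word x.1 ++ enc_term x.2))
  (fun x => true :: (enc_word x.1 ++ (enc_term x.2.1 ++ enc_term x.2.2)))
  _ (fun x => ConceptAtom x.1 x.2) (fun x => RoleAtom x.1 x.2.1 x.2.2)) => //.
- by case=> [x y|x y z]; [left; exists (x, y)|right; exists (x, (y, z))].
- exact/parses_tag/parses_seq/proper_word/parses_term/parses_word.
- apply: parses_tag; apply: (@parses_seq _ _ _ _ enc_word (fun y => enc_term y.1 ++ enc_term y.2)
    parses_word _ proper_word).
  exact/parses_seq/proper_term/parses_term/parses_term.
Qed.

Lemma proper_atom : proper enc_atom.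
Proof.
split; last by case.
have [H' _] := proper_term; have [H _] := proper_word.
case=> [a b|a b c] [d e|d e f] s t //= []; move: enc_word H => encw H; rewrite -!catA.
- by move=> /H[-> /H'[-> ->]].
- by move=> /H[-> /H'[-> /H'[-> ->]]].
Qed.

(** By prefix-freeness, any items parsed from the start of a list code are its own first items, and
    the next bit tells whether the list goes on. *)
Lemma list_prefix T (enc : T -> seq bool) i j (s s1 : seq T) b a : proper enc ->
  seg (sw M) i (enc_list enc s) j -> seg (sw M) i (items enc s1) a -> bit b M a ->
  if b then exists x s2, s = s1 ++ x :: s2 else s = s1.
Proof.
case=> H _ [E _] [E1 _] /seg_bit[Ea _].
rewrite {}E1 {}Ea in E; move: (drop j (sw M)) (drop a.+1 (sw M)) E => t r.
rewrite /enc_list -catA; elim: s1 s => [|y s1 IH] [|z s] //=.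
- by case=> ->.
- by case=> -> _; exists z, s.
- rewrite -!catA => -[/H[-> /IH]]; case: (b) => [[x [s2 ->]]|->] //.
  by exists x, s2.
Qed.

Lemma litemP T (P : parser) (enc : T -> seq bool) i j (s : seq T) a :
  parses P enc -> proper enc -> seg (sw M) i (enc_list enc s) j ->
  litem P M i a <-> exists s1 x s2, s = s1 ++ x :: s2 /\ seg (sw M) i (items enc s1) a.
Proof.
move=> PE enc_proper Hs.
have [iM jM] := seg_le Hs ((proper_list enc_proper).2 s).
split.
  case=> H1 Ha; have aN : a < sN M by have := bit_lt Ha; lia.
  have [_ _ [s1 Hs1]] := (lreachP _ PE enc_proper aN).1 H1.
  by have [x [s2 ->]] := list_prefix enc_proper Hs Hs1 Ha; exists s1, x, s2.
case=> s1 [x [s2 [Es Hs1]]].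
move: Hs; rewrite Es /enc_list -/(items enc _) items_cat -catA => /seg_cat[k Hk].
rewrite (seg_det Hk Hs1) => Hx.
have Ha : bit true M a.
  by move: Hx; rewrite /items /= => /seg_cons[].
split=> //; apply/(lreachP _ PE enc_proper); first by have := bit_lt Ha; lia.
by split; [apply/inposP|right|exists s1].
Qed.

Lemma litem_all T (P : parser) (enc : T -> seq bool) i j (s : seq T) :
  parses P enc -> proper enc -> seg (sw M) i (enc_list enc s) j ->
  (forall a, litem P M i a -> exists x k, List.In x s /\ seg (sw M) a.+1 (enc x) k) /\
  (forall x, List.In x s -> exists a k, [/\ a < size (sw M), litem P M i a & seg (sw M) a.+1 (enc x) k]).
Proof.
move=> PE enc_proper Hs; split.
  move=> a /(litemP _ PE enc_proper Hs)[s1 [x [s2 [Es Hs1]]]].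
  move: Hs; rewrite Es /enc_list -/(items enc _) items_cat -catA => /seg_cat[k Hk].
  rewrite (seg_det Hk Hs1) /items /= -catA => /seg_cons[_ /seg_cat[l Hl _]].
  by exists x, l; split=> //; apply: List.in_or_app; right; left.
move=> x /(@List.in_split _ _ _)[s1 [s2 Es]].
move: (Hs); rewrite Es /enc_list -/(items enc _) items_cat -catA => /seg_cat[a Ha].
rewrite /items /= -catA => /seg_cons[Hb /seg_cat[l Hl _]].
exists a, l; split=> //; first exact: bit_lt Hb.
by apply/(litemP _ PE enc_proper Hs); exists s1, x, s2.
Qed.
End Specification.

(** * Small countermodels *)

Section StructInt.
Variables (D : Type) (C : concept_name -> D -> Prop) (R : role_name -> D -> D -> Prop).
Variables (ns : seq individual) (f : individual -> D).
Hypothesis f_inj : {in ns &, injective f}.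

(** The unique name assumption concerns infinitely many names, which a finite [D] cannot interpret
    injectively; the names outside [ns] therefore interpret themselves. *)
Definition struct_ind (a : individual) : D + individual :=
  if a \in ns then inl (f a) else inr a.

Lemma struct_ind_inj : injective struct_ind.
Proof.
move=> a b; rewrite /struct_ind; case: ifP => ha; case: ifP => hb // [] //.
exact: f_inj.
Qed.

(* The individuals outside [ns] are interpreted by isolated elements. *)
Definition struct_int : interpretation := {|
  domain := D + individual;
  concept_int := fun A x => if x is inl d then C A d else False;
  role_int := fun P x y => if x is inl d then (if y is inl e then R P d e else False) else False;
  ind_int := struct_ind;
  ind_int_inj := struct_ind_inj |}.
End StructInt.

Definition role_name_of (R : role) : role_name :=
  match R with Direct P | Inverse P => P end.

Definition concept_name_of (B : basic_concept) : seq bool :=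
  match B with Atomic A => A | Exists R => role_name_of R end.

Definition incl_names (F : inclusion) : seq (seq bool) :=
  match F with
  | ConceptIncl B1 B2 | ConceptDisj B1 B2 => [:: concept_name_of B1; concept_name_of B2]
  | RoleIncl R1 R2 | RoleDisj R1 R2 => [:: role_name_of R1; role_name_of R2]
  end.

Definition assertion_names (F : assertion) : seq (seq bool) :=
  match F with
  | ConceptAssertion A b => [:: A; b]
  | RoleAssertion P a b => [:: P; a; b]
  end.

Definition term_name (t : term) : seq bool := match t with Var v => v | Cst a => a end.

Definition atom_names (F : atom) : seq (seq bool) :=
  match F with
  | ConceptAtom A t => [:: A; term_name t]
  | RoleAtom P t u => [:: P; term_name t; term_name u]
  end.

Definition body_terms (q : query) : seq term := flatten (map atom_terms (body q)).

Lemma In_flatten_map (S T : Type) (g : S -> seq T) (s : seq S) y :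
  List.In y (flatten (map g s)) <-> exists2 x, List.In x s & List.In y (g x).
Proof.
elim: s => [|x s IH] /=; first by split=> // - [].
rewrite List.in_app_iff IH; split.
  by case=> [Hy|[z Hz Hy]]; [exists x; [left|]|exists z; [right|]].
by case=> z [<-|Hz] Hy; [left|right; exists z].
Qed.

Lemma In_mem (T : eqType) (x : T) s : List.In x s <-> x \in s.
Proof.
elim: s => //= y s IH; rewrite inE IH eq_sym; split=> [[->|->]|/orP[/eqP|]].
- by rewrite eqxx.
- by rewrite orbT.
- by left.
- by right.
Qed.

Lemma mem_map_In (S : Type) (T : eqType) (g : S -> T) s x : List.In x s -> g x \in map g s.
Proof.
by elim: s => //= y s IH [->|/IH]; rewrite inE ?eqxx // => ->; rewrite orbT.
Qed.

(** Elements are collected one at a time: after [k] attempts there are either [k] distinct ones or a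
    complete list of fewer than [k]. *)
Lemma finitely_many (T : Type) (P : T -> Prop) m :
  ~ (exists f : 'I_m -> T, injective f /\ forall i, P (f i)) ->
  exists2 s : seq T, size s < m & forall x, P x <-> List.In x s.
Proof.
move=> H; pose E : eqType := {classic T}.
suff K k : (exists s : seq E, [/\ uniq s, size s = k & forall x, x \in s -> P x]) \/
           (exists2 s : seq T, size s < k & forall x, P x <-> List.In x s).
  have [[[|x0 s] [U Hs Ps]]|//] := K m.
    by case: H; rewrite -Hs; exists (fun i : 'I_0 => False_rect T (notF (ltn_ord i))); split; case.
  case: H; exists (fun i : 'I_m => nth x0 (x0 :: s) i); split=> [i j Hij|i].
    have Hn : ((nth x0 (x0 :: s) i : E) == nth x0 (x0 :: s) j) = (i == j :> nat).
      by rewrite nth_uniq ?Hs.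
    by apply/val_inj/eqP; rewrite -Hn; apply/eqP.
  by apply: Ps; rewrite mem_nth ?Hs.
elim: k => [|k [[s [U Hs Ps]]|[s Hs Ps]]]; first by left; exists [::].
  have [[x [Px xs]]|nx] := pselect (exists x : E, P x /\ x \notin s).
    left; exists (x :: s); split; rewrite /= ?xs ?Hs // => y.
    by rewrite inE => /orP[/eqP ->|/Ps].
  right; exists s; first by rewrite Hs.
  move=> x; split=> [Px|/(@In_mem E)/Ps //].
  by apply/(@In_mem E); apply: contrapT => /negP xs; apply: nx; exists x.
by right; exists s => //; lia.
Qed.

Section SmallCountermodel.
Variables (K : kb) (q : query) (a : seq individual) (I : interpretation).
(** A single list collects the names of all sorts occurring in the input. *)
Variable ns : seq (seq bool).
Hypothesis tbox_ns : forall F, List.In F (kb_tbox K) -> {subset incl_names F <= ns}.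
Hypothesis abox_ns : forall F, List.In F (kb_abox K) -> {subset assertion_names F <= ns}.
Hypothesis body_ns : forall F, List.In F (body q) -> {subset atom_names F <= ns}.
Hypothesis a_ns : {subset a <= ns}.
Hypotheses (q_ccq : is_ccq q) (q_exh : exhaustive q) (q_rooted : rooted q).
Hypothesis I_model : model I K.

Let E : choiceType := {classic domain I}.

Variable cs : seq (seq (domain I)).
Hypothesis cs_all : forall c, c_match q a c <-> List.In c cs.

Let ds : seq E := undup ((map (@ind_int I) ns : seq E) ++ flatten cs).
Let n := size (body_terms q).
Let s := size ns.

Let rcode := ('I_s * bool)%type.
Let role_of (r : rcode) : role :=
  if r.2 then Inverse (nth [::] ns r.1) else Direct (nth [::] ns r.1).

Lemma role_ofP R : role_name_of R \in ns -> exists r, role_of r = R.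
Proof.
move=> H; have Hi : index (role_name_of R) ns < s by rewrite /s index_mem.
exists (Ordinal Hi, if R is Inverse _ then true else false).
by rewrite /role_of /= nth_index //; case: R {H Hi}.
Qed.

Lemma role_of_ns r : role_name_of (role_of r) \in ns.
Proof. by rewrite /role_of; case: r.2; rewrite mem_nth. Qed.

Let has_role (r : rcode) (e : E) : Prop := exists e', role_ext (role_of r) e e'.

Definition successor (e : E) (r : rcode) : E :=
  if pselect (has_role r e) is left H then sval (cid H) else e.

Lemma successorP e r : has_role r e -> role_ext (role_of r) e (successor e r).
Proof. by rewrite /successor; case: pselect => // H _; case: (cid H). Qed.

Let etype := ({set 'I_s} * {set rcode})%type.
Let ptype := (etype * {set rcode} * etype)%type.

Definition type_of (e : E) : etype :=
  ([set i : 'I_s | `[< concept_int (nth [::] ns i) e >]], [set r | `[< has_role r e >]]).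

(** A merged node remembers the type of its element as the last component, and the roles from its
    predecessor as the middle one. *)
Definition pair_type (e f : E) : ptype :=
  (type_of e, [set r | `[< role_ext (role_of r) e f >]], type_of f).

Lemma type_concept B e e' : type_of e = type_of e' -> concept_name_of B \in ns ->
  concept_ext B e -> concept_ext B e'.
Proof.
case=> /setP H1 /setP H2; case: B => [A|R] /= HA.
  have Hi : index A ns < s by rewrite /s index_mem.
  have := H1 (Ordinal Hi); rewrite !inE /= nth_index // => Hr; exact: (asbool_eq_equiv Hr).1.
have [r <-] := role_ofP HA.
by have := H2 r; rewrite !inE => Hr; exact: (asbool_eq_equiv Hr).1.
Qed.

Lemma pair_type_role R e f e' f' : pair_type e f = pair_type e' f' ->
  role_name_of R \in ns -> role_ext R e f -> role_ext R e' f'.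
Proof.
case=> _ _ /setP H _ _ /role_ofP[r <-].
by have := H r; rewrite !inE => Hr; exact: (asbool_eq_equiv Hr).1.
Qed.

(* The roots are the individuals and the values of the matches; the other
   elements at depth at most [n + 1] are given by a root and the roles leading
   to them; further elements only remember a pair type, and their depth modulo
   3, so that no two of them are related in both directions. *)
Let node := (seq_sub ds + 'I_n.+1 * seq_sub ds * {ffun 'I_n.+1 -> rcode} + 'I_3 * ptype)%type.

Fixpoint descend (e : E) (p : {ffun 'I_n.+1 -> rcode}) (k : nat) : E :=
  if k is k'.+1 then successor (descend e p k') (p (inord k')) else e.

(** A merged node stands for several elements, which share a type by [stands_type]. The condition on
    [k = ord0] bars the roots from depth one; this is what keeps the matches of exhaustive queries
    on the root nodes ([path_level0]). *)
Definition stands (x : node) (e : E) : Prop :=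
  match x with
  | inl (inl d) => e = ssval d
  | inl (inr (k, d, p)) => e = descend (ssval d) p k.+1 /\ (k = ord0 -> e \notin ds)
  | inr (i, t) => exists e0, pair_type e0 e = t
  end.

(** [(e, f)] is a pair of elements of [I] whose roles are copied to the two nodes. In the unravelled
    part arrows depend on the depths and not on the paths: any nodes at consecutive depths that
    stand for [e] and [f] are joined. *)
Definition arrow (x y : node) (e f : E) : Prop :=
  match x, y with
  | inl (inl _), inl (inl _) => stands x e /\ stands y f
  | inl (inl _), inl (inr (k, _, _)) => [/\ k = ord0, stands x e & stands y f]
  | inl (inr (k, _, _)), inl (inr (k', _, _)) => [/\ k' = k.+1 :> nat, stands x e & stands y f]
  | inl (inr (k, _, _)), inr (i, t) =>
      [/\ k = ord_max, i = ord0, stands x e & pair_type e f = t]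
  | inr (i, t), inr (i', t') =>
      [/\ i' = i.+1 %% 3 :> nat, exists e0 e1, pair_type e0 e1 = t,
          type_of e = t.2 & pair_type e f = t']
  | _, _ => False
  end.

Definition linked (x y : node) (e f : E) : Prop := arrow x y e f \/ arrow y x f e.

Lemma stands_type x e e' : stands x e -> stands x e' -> type_of e = type_of e'.
Proof.
case: x => [[d|[[k d] p]]|[i t]] /=; first by move=> -> ->.
  by move=> [-> _] [-> _].
by move=> [e0 <-] [e1 /(congr1 snd) /= ->].
Qed.

(** Between merged nodes, the source [e] is only known to have the type prescribed by its node;
    hence the detour through an element [e0] of the same type. *)
Lemma arrow_stands x y e f : arrow x y e f ->
  (exists2 e0, stands x e0 & type_of e = type_of e0) /\ stands y f.
Proof.
case: x y => [[d|[[k d] p]]|[i t]] [[d'|[[k' d'] p']]|[i' t']] //.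
- by move=> [H1 H2]; split=> //; exists e.
- by move=> [_ H1 H2]; split=> //; exists e.
- by move=> [_ H1 H2]; split=> //; exists e.
- by move=> [_ _ H1 H2]; split; [exists e|exists e].
- case=> _ [e0 [e1 He]] H1 H2; split; last by exists e.
  by exists e1; [exists e0|rewrite H1 -He].
Qed.

Lemma linked_sym x y e f : linked x y e f -> linked y x f e.
Proof. by case; [right|left]. Qed.

Lemma linked_stands x y e f : linked x y e f -> exists2 e0, stands x e0 & type_of e = type_of e0.
Proof. by case=> /arrow_stands[] // *; exists e. Qed.

Lemma arrow_roles x y e f e' f' R : arrow x y e f -> arrow x y e' f' ->
  role_name_of R \in ns -> role_ext R e f -> role_ext R e' f'.
Proof.
case: x y => [[d|[[k d] p]]|[i t]] [[d'|[[k' d'] p']]|[i' t']] //.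
- by move=> [/= -> ->] [/= -> ->].
- by move=> [/= _ -> [-> _]] [/= _ -> [-> _]].
- by move=> [/= _ [-> _] [-> _]] [/= _ [-> _] [-> _]].
- by move=> [_ _ _ <-] [_ _ _ H2]; apply: pair_type_role.
- by move=> [_ _ _ <-] [_ _ _ H2]; apply: pair_type_role.
Qed.

(** All arrows except those between roots increase the depth, in the merged part modulo 3. So only
    two roots can be joined in both directions, and a root stands for a single element. *)
Lemma arrow_opposite x y e f e' f' : arrow x y e f -> arrow y x f' e' -> e = e' /\ f = f'.
Proof.
case: x y => [[d|[[k d] p]]|[i t]] [[d'|[[k' d'] p']]|[i' t']] //.
- by move=> [/= -> ->] [/= -> ->].
- by move=> [/= H1 _ _] [/= H2 _ _]; exfalso; lia.
- by move=> [/= H1 _ _ _] [/= H2 _ _ _]; exfalso; have := ltn_ord i; have := ltn_ord i'; lia.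
Qed.

(** The roles between two nodes do not depend on the pair they are copied from; otherwise two pairs
    could together violate a role disjointness that each of them satisfies. *)
Lemma linked_roles x y e f e' f' R : linked x y e f -> linked x y e' f' ->
  role_name_of R \in ns -> role_ext R e f -> role_ext R e' f'.
Proof.
move=> [H1|H1] [H2|H2] HR.
- exact: arrow_roles H1 H2 HR.
- by have [-> ->] := arrow_opposite H1 H2.
- by have [-> ->] := arrow_opposite H1 H2.
- have HR' : role_name_of (match R with Direct P => Inverse P | Inverse P => Direct P end) \in ns.
    by case: R HR.
  by have := arrow_roles H1 H2 HR'; case: R {HR HR'}.
Qed.

(** The witness is the chosen successor. It is represented by a root if it is one, else by extending
    the path; from the last depth on it is represented by its pair type, and the merged part never
    runs out of successors. *)
Lemma linked_successor x e r : stands x e -> has_role r e ->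
  exists y e' f, linked x y e' f /\ role_ext (role_of r) e' f.
Proof.
move=> xe /successorP Hr; set g := successor e r in Hr.
case: x xe => [[d|[[k d] p]]|[i t]] xe.
- have [gs|gs] := boolP (g \in ds).
    by exists (inl (inl (SeqSub gs))), e, g; split=> //; left.
  exists (inl (inr (ord0, d, [ffun=> r]))), e, g; split=> //; left; split=> //=.
  by rewrite ffunE -xe.
- have [kn|kn] := eqVneq k ord_max.
    by exists (inr (ord0, pair_type e g)), e, g; split=> //; left.
  have kn' : k.+1 < n.+1.
    by have := ltn_ord k; rewrite ltnS leq_eqVlt -val_eqE in kn * => /orP[/eqP H|]; [rewrite /= H eqxx in kn|].
  pose p' := [ffun j : 'I_n.+1 => if j == k.+1 :> nat then r else p j].
  have Hp' l : l <= k.+1 -> descend (ssval d) p' l = descend (ssval d) p l.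
    elim: l => //= l IH lk; rewrite IH; last by lia.
    rewrite ffunE inordK; last by have := ltn_ord k; lia.
    by rewrite ifF //; lia.
  exists (inl (inr (Ordinal kn', d, p'))), e, g; split=> //; left; split=> //=.
  split; last by move/(congr1 val).
  case: xe => xe _; rewrite -[successor (descend _ _ _) _]/(descend (ssval d) p' k.+1) Hp' //.
  by rewrite -xe ffunE inordK // eqxx.
- exists (inr (inord (i.+1 %% 3), pair_type e g)), e, g; split=> //; left.
  case: xe => e0 <-; split=> //; first by rewrite inordK // ltn_mod.
  by exists e0, e.
Qed.

Lemma root_mem b : b \in ns -> (ind_int I b : E) \in ds.
Proof. by move=> Hb; rewrite mem_undup mem_cat map_f. Qed.

(** The second branch is a default that the names of [ns] never reach. *)
Definition root_of (b : individual) : node :=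
  if insub (ind_int I b : E) is Some d then inl (inl d) else inr (ord0, pair_type (ind_int I b) (ind_int I b)).

Lemma root_ofE b (Hb : b \in ns) : root_of b = inl (inl (SeqSub (root_mem Hb))).
Proof.
rewrite /root_of; case: insubP => [d _ Hd|]; last by rewrite root_mem.
by congr (inl (inl _)); apply: val_inj.
Qed.

Lemma root_of_inj : {in ns &, injective root_of}.
Proof.
by move=> b c Hb Hc; rewrite !root_ofE => -[/(@ind_int_inj I)].
Qed.

Definition node_concept (A : concept_name) (x : node) : Prop :=
  A \in ns /\ exists2 e, stands x e & concept_int A e.

Definition node_role (P : role_name) (x y : node) : Prop :=
  P \in ns /\ exists e f, linked x y e f /\ role_int P e f.

Let J := struct_int node_concept node_role root_of_inj.

Lemma J_role R (x y : domain J) : role_ext (I := J) R x y ->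
  exists x' y' e f, [/\ x = inl x', y = inl y', linked x' y' e f & role_ext R e f].
Proof.
case: R => P; case: x y => [x|x] [y|y] //= [_ [e [f [H1 H2]]]].
  by exists x, y, e, f.
by exists x, y, f, e; split=> //; apply: linked_sym.
Qed.

Lemma J_roleI R x y e f : linked x y e f -> role_name_of R \in ns -> role_ext R e f ->
  role_ext (I := J) R (inl x) (inl y).
Proof.
case: R => P H HP HR /=; split=> //; first by exists e, f.
by exists f, e; split=> //; apply: linked_sym.
Qed.

Lemma J_concept B (x : domain J) : concept_ext (I := J) B x ->
  exists x' e, [/\ x = inl x', stands x' e & concept_name_of B \in ns -> concept_ext B e].
Proof.
case: B => [A|R] /=.
  by case: x => // x [HA [e xe Ae]]; exists x, e.
case=> y /J_role[x' [y' [e [f [-> _ /[dup] H /linked_stands[e0 H0 He] HR]]]]].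
exists x', e0; split=> // Rns.
by apply: (@type_concept (Exists R) e) => //; exists f.
Qed.

Lemma J_conceptI B x e : stands x e -> concept_name_of B \in ns -> concept_ext B e ->
  concept_ext (I := J) B (inl x).
Proof.
case: B => [A|R] /= xe Hns; first by move=> Ae; split=> //; exists e.
have [r Er] := role_ofP Hns; rewrite -Er => /(linked_successor xe)[y [e' [f [H1 H2]]]].
by exists (inl y); apply: J_roleI H1 _ H2; apply: role_of_ns.
Qed.

Lemma J_model : model J K.
Proof.
have [HT HA] := I_model; split=> F HF.
  have sub := tbox_ns HF; have := HT F HF.
  have H1 : {subset incl_names F <= ns} by [].
  case: F sub {HF H1} => [B1 B2|B1 B2|R1 R2|R1 R2] sub HF.
  - move=> d /J_concept[x [e [-> xe H]]].
    apply: J_conceptI xe _ _; first by apply: sub; rewrite !inE eqxx orbT.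
    by apply/HF/H/sub; rewrite mem_head.
  - move=> d /J_concept[x [e [-> xe H1]]] /J_concept[x' [e' [[<-] xe' H2]]].
    have N1 : concept_name_of B1 \in ns by apply: sub; rewrite mem_head.
    have N2 : concept_name_of B2 \in ns by apply: sub; rewrite !inE eqxx orbT.
    apply: (HF e (H1 N1)); apply: type_concept (H2 N2) => //.
    exact: stands_type xe' xe.
  - move=> d d' /J_role[x [y [e [f [-> -> H HR]]]]].
    apply: J_roleI H _ _; first by apply: sub; rewrite !inE eqxx orbT.
    exact: HF.
  - move=> d d' /J_role[x [y [e [f [-> -> H HR]]]]] /J_role[x' [y' [e' [f' [[<-] [<-] H' HR']]]]].
    have N2 : role_name_of R2 \in ns by apply: sub; rewrite !inE eqxx orbT.
    by apply: (HF e f HR); apply: linked_roles H' H N2 HR'.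
have sub := abox_ns HF; have := HA F HF.
case: F sub {HF} => [A b|P b c] sub /= HF; rewrite /struct_ind.
  have Hb : b \in ns by apply: sub; rewrite !inE eqxx orbT.
  rewrite Hb; split; first by apply: sub; rewrite mem_head.
  by rewrite root_ofE; exists (ind_int I b).
have Hb : b \in ns by apply: sub; rewrite !inE eqxx orbT.
have Hc : c \in ns by apply: sub; rewrite !inE eqxx !orbT.
rewrite Hb Hc; split; first by apply: sub; rewrite mem_head.
by rewrite !root_ofE; exists (ind_int I b), (ind_int I c); split=> //; left.
Qed.

(** Unravelled nodes have levels 1 to [n.+1], and merged nodes come just above. Isolated elements
    get level 0, so that all individuals have it. *)
Definition level (x : domain J) : nat :=
  match x with
  | inl (inl (inl _)) => 0
  | inl (inl (inr (k, _, _))) => k.+1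
  | inl (inr _) => n.+2
  | inr _ => 0
  end.

Definition value (x : domain J) : E :=
  match x with
  | inl (inl (inl d)) => ssval d
  | inl (inl (inr (k, d, p))) => descend (ssval d) p k.+1
  | _ => ind_int I [::]
  end.

Lemma linked_level x y e f : linked x y e f -> level (inl x) <= n.+1 ->
  level (inl y) <= (level (inl x)).+1.
Proof.
case; case: x y => [[d|[[k d] p]]|[i t]] [[d'|[[k' d'] p']]|[i' t']] //=;
  try by rewrite ltnn.
- by case=> ->.
- by case=> ->.
- by case=> -> _ _ _ _ /=.
- by case=> ->; lia.
Qed.

Lemma linked_value x y e f : linked x y e f ->
  level (inl x) <= n.+1 -> level (inl y) <= n.+1 ->
  e = value (inl x) /\ f = value (inl y).
Proof.
case; case: x y => [[d|[[k d] p]]|[i t]] [[d'|[[k' d'] p']]|[i' t']] //=;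
  try by rewrite ltnn.
- by case=> _ -> [-> _].
- by case=> _ [-> _] [-> _].
- by case=> -> ->.
- by case=> _ -> [-> _].
- by case=> _ [-> _] [-> _].
Qed.

Lemma stands_value x e : stands x e -> level (inl x) <= n.+1 -> e = value (inl x).
Proof.
by case: x => [[d|[[k d] p]]|[i t]] //=; [case|rewrite ltnn].
Qed.

Lemma value_ind b : b \in ns -> value (ind_int J b) = ind_int I b.
Proof. by move=> Hb; rewrite /= /struct_ind Hb root_ofE. Qed.

Lemma level_ind b : level (ind_int J b) = 0.
Proof.
by rewrite /= /struct_ind; case: (boolP (b \in ns)) => // Hb; rewrite root_ofE.
Qed.

Lemma rt1n_path t u : gaifman_connected q t u ->
  Relation_Operators.clos_refl_trans_1n _ (gaifman_edge q) t u.
Proof. exact: Operators_Properties.clos_rt_rt1n. Qed.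

(** * Matches in the collapsed model *)

Section Match.
Variable sg : variable -> domain J.
Hypotheses (sg_match : is_match q sg) (sg_answer : map sg (answer_vars q) = map (ind_int J) a).

Let tv := term_val sg.

Lemma edge_linked t u : gaifman_edge q t u ->
  [/\ List.In t (body_terms q), List.In u (body_terms q) &
      exists x y e f, [/\ tv t = inl x, tv u = inl y & linked x y e f]].
Proof.
have H P t' u' : List.In (RoleAtom P t' u') (body q) ->
   [/\ List.In t' (body_terms q), List.In u' (body_terms q) &
      exists x y e f, [/\ tv t' = inl x, tv u' = inl y & linked x y e f]].
  move=> HP; split.
  - by apply/In_flatten_map; exists (RoleAtom P t' u') => //; left.
  - by apply/In_flatten_map; exists (RoleAtom P t' u') => //; right; left.
  - have := sg_match HP => /=; rewrite -!/(tv _).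
    case: (tv t') (tv u') => [x|//] [y|//] [_ [e [f [Hl _]]]].
    by exists x, y, e, f.
case=> P [/H //|/H[Hu Ht [x [y [e [f [H1 H2 /linked_sym H3]]]]]]]; split=> //.
by exists y, x, f, e.
Qed.

Lemma anchor_level t : anchor q t -> level (tv t) = 0.
Proof.
case: t => [v /(map_f sg)|b _] /=; last exact: level_ind.
by rewrite sg_answer => /mapP[b _ ->]; exact: level_ind.
Qed.

(** The path ends at level 0 and, below the merged part, a link changes the level by at most one; so
    it visits every level on the way down. *)
Lemma path_levels t u k : Relation_Operators.clos_refl_trans_1n _ (gaifman_edge q) t u ->
  anchor q u -> 0 < k -> k <= level (tv t) -> k <= n.+1 ->
  k \in [seq level (tv t) | t <- body_terms q].
Proof.
elim=> {t u} [t /anchor_level ->|t t1 u tt1 _ IH u_anchor k0 kt kn]; first by lia.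
have [kt1|kt1] := leqP k (level (tv t1)); first exact: IH.
have [Ht _ [x [y [e [f [Ex Ey /linked_sym /linked_level]]]]]] := edge_linked tt1.
rewrite -Ex -Ey => H; have {}H := H (leq_trans (ltnW kt1) kn).
by have -> : k = level (tv t); [lia|exact: (mem_map_In (fun t => level (tv t)))].
Qed.

(** Pigeonhole: a term in the merged part would force [n.+1] different levels on the [n] occurrences
    of terms in the body. *)
Lemma query_term_level t : query_term q t -> level (tv t) <= n.+1.
Proof.
move=> /q_rooted[u /rt1n_path tu u_anchor].
have [//|Ht] := leqP (level (tv t)) n.+1.
have sub : {subset iota 1 n.+1 <= [seq level (tv t) | t <- body_terms q]}.
  move=> k; rewrite mem_iota => /andP[k0 kn].
  by apply: path_levels tu u_anchor k0 _ _; lia.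
by have := uniq_leq_size (iota_uniq _ _) sub; rewrite size_iota size_map -/n; lia.
Qed.

Let sv (v : variable) : domain I := value (sg v).

Lemma body_term t : List.In t (body_terms q) -> query_term q t.
Proof. by move=> /In_flatten_map[F HF Ht]; right; exists F. Qed.

Lemma body_term_name t : List.In t (body_terms q) -> term_name t \in ns.
Proof.
move=> /In_flatten_map[F HF]; have := body_ns HF.
case: F {HF} => [A u|P u v] sub /= [<-|[]] //.
- by apply: sub; rewrite !inE eqxx orbT.
- by apply: sub; rewrite !inE eqxx orbT.
- by move=> <-; apply: sub; rewrite !inE eqxx !orbT.
Qed.

Lemma value_term t : List.In t (body_terms q) -> value (tv t) = term_val (I := I) sv t.
Proof. by case: t => [v //|b /body_term_name Hb] /=; rewrite value_ind. Qed.

(** All terms lie in the unravelled part, where the pair behind a link is determined by the two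
    nodes ([linked_value]). *)
Lemma value_match : is_match q sv.
Proof.
move=> F HF; have := sg_match HF.
have terms t : List.In t (atom_terms F) -> List.In t (body_terms q).
  by move=> Ht; apply/In_flatten_map; exists F.
have levels t : List.In t (atom_terms F) -> level (tv t) <= n.+1.
  by move=> /terms/body_term/query_term_level.
case: F HF terms levels => [A t|P t u] HF terms levels /=.
  have Ht : List.In t [:: t] by left.
  rewrite -!/(tv _) -(value_term (terms t Ht)); have := levels t Ht.
  by case: (tv t) => // x lx [_ [e /stands_value <-]].
have Ht : List.In t [:: t; u] by left.
have Hu : List.In u [:: t; u] by right; left.
rewrite -!/(tv _) -(value_term (terms t Ht)) -(value_term (terms u Hu)).
have := levels t Ht; have := levels u Hu.
case: (tv t) (tv u) => [x|//] [y|//] ly lx [_ [e [f [/linked_value H1 H2]]]].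
by have [<- <-] := H1 lx ly.
Qed.

Lemma value_answer : map sv (answer_vars q) = map (ind_int I) a.
Proof.
have -> : map sv (answer_vars q) = map value (map sg (answer_vars q)) by rewrite -map_comp.
by rewrite sg_answer -map_comp; apply/eq_in_map => b /a_ns Hb /=; rewrite value_ind.
Qed.

(** Answer variables take named individuals as values. Since there are no existential variables, any
    other variable is a counting one, and its value occurs in a counting match of [I], the image of
    [sg]; such values were made roots. *)
Lemma value_mem t : query_term q t -> (value (tv t) \in ds) \/ exists b, tv t = inr b.
Proof.
move=> Hq; have Hcs : List.In (map sv (count_vars q)) cs.
  by apply/cs_all; exists sv; split=> //; [exact: value_match|exact: value_answer].
have var v : v \in query_vars q -> value (sg v) \in ds.
  rewrite /query_vars q_exh mem_cat => /orP[Hv|Hv]; rewrite mem_undup mem_cat.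
    apply/orP; left; have : sv v \in (map sv (answer_vars q) : seq E) by apply: map_f.
    rewrite value_answer => /mapP[b /a_ns Hb Eb].
    by rewrite -[value (sg v)]/(sv v) Eb; exact: map_f.
  apply/orP; right; apply/flattenP; exists (map sv (count_vars q) : seq E); last exact: map_f.
  by elim: (cs) Hcs => //= c cs' IH [->|/IH]; rewrite inE ?eqxx // => ->; rewrite orbT.
case: t Hq => [v|b] Hq /=.
  left; apply: var; case: Hq => [[w Hw [->]] //|[F HF HFv]].
  by case: q_ccq => _ _ _ /(_ F v HF HFv).
rewrite /struct_ind; case: (boolP (b \in ns)) => Hb; last by right; exists b.
left; have Eb := value_ind Hb; have := root_mem Hb; rewrite -Eb.
by rewrite /= /struct_ind Hb.
Qed.

(** Going backwards from the anchor, a neighbour of a term at level 0 has level 0 or 1. At level 1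
    its value would not be a root, against [value_mem]. *)
Lemma path_level0 t u : Relation_Operators.clos_refl_trans_1n _ (gaifman_edge q) t u ->
  anchor q u -> level (tv t) = 0.
Proof.
elim=> {t u} [t /anchor_level //|t t1 u tt1 _ IH /IH t10].
have [Ht _ [x [y [e [f [Ex Ey Hl]]]]]] := edge_linked tt1.
have [|[b Eb]] := value_mem (body_term Ht); last by rewrite Ex in Eb.
move: t10; rewrite Ex Ey.
case: y {Ey} Hl => [[d'|[[k' d'] p']]|[i' t']] // [] //.
  case: x {Ex} => [[d|[[k d] p]]|[i t']] //.
case: x {Ex} => [[d|[[k d] p]]|[i t']] // [/= -> _ [-> Hn]] _ Hds.
by case/negP: (Hn erefl); exact: Hds.
Qed.

Lemma query_term_level0 t : query_term q t -> level (tv t) = 0.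
Proof.
by move=> /q_rooted[u /rt1n_path tu u_anchor]; exact: path_level0 tu u_anchor.
Qed.
End Match.

(** A counting variable is not an anchor, so its path to an anchor has an edge, which comes from an
    atom. *)
Lemma count_var_in_body v : v \in count_vars q -> List.In (Var v) (body_terms q).
Proof.
move=> Hv; have Hq : query_term q (Var v).
  by left; exists v => //; rewrite !mem_cat Hv !orbT.
have [u /rt1n_path vu] := q_rooted Hq.
case: vu => [/=|w u' [P []] HP _ _].
- case: q_ccq => _ Hd _ _ Ha; case/hasP: Hd; by exists v.
- by apply/In_flatten_map; exists (RoleAtom P (Var v) w) => //; left.
- by apply/In_flatten_map; exists (RoleAtom P w (Var v)) => //; right; left.
Qed.

(** Counting variables are mapped to root nodes, where [value] is injective, so distinct counting
    matches have distinct images. Isolated elements also have level 0, but variables occurring in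
    atoms avoid them. *)
Lemma J_few m : ~ at_least_c_matches I q a m -> ~ at_least_c_matches J q a m.
Proof.
move=> HI [f [f_inj Hf]]; apply: HI.
exists (fun i => map value (f i)); split=> [i j|i]; last first.
  have [sg [Hm Ha ->]] := Hf i.
  exists (fun v => value (sg v)); split; [exact: value_match|exact: value_answer|].
  by rewrite -map_comp.
have [s1 [Hm1 Ha1 E1]] := Hf i; have [s2 [Hm2 Ha2 E2]] := Hf j.
rewrite E1 E2 -!map_comp => /eq_in_map H; apply: f_inj; rewrite E1 E2.
apply/eq_in_map => v Hv; have := H v Hv => /=.
have Hq : query_term q (Var v) by left; exists v => //; rewrite !mem_cat Hv !orbT.
have /In_flatten_map[F HF Hvt] := count_var_in_body Hv.
have inl_of s' : is_match (I := J) q s' -> exists x, s' v = inl x.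
  move=> /(_ F HF); case: F {HF} Hvt => [A t|P t u] /= Ht.
    by case: Ht => [->|[]] /=; case: (s' v) => // x _; exists x.
  case: Ht => [->|[->|[]]] /=; first by case: (s' v) => // x _; exists x.
  by case: (term_val s' t) => // y; case: (s' v) => // x _; exists x.
have [x1 X1] := inl_of s1 Hm1; have [x2 X2] := inl_of s2 Hm2.
have := query_term_level0 Hm1 Ha1 Hq; have := query_term_level0 Hm2 Ha2 Hq.
rewrite /= X1 X2.
case: x1 {X1} => [[d|[[k d] p]]|[i' t]] //; case: x2 {X2} => [[d'|[[k' d'] p']]|[i'' t']] // _ _ /= Hd.
by congr (inl (inl (inl _))); apply: val_inj.
Qed.

Definition node_bound (s n r : nat) : nat :=
  r + n.+1 * r * (s * 2) ^ n.+1 + 3 * ((2 ^ s * 2 ^ (s * 2)) * 2 ^ (s * 2) * (2 ^ s * 2 ^ (s * 2))).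

Lemma card_node : #|{: node}| <= node_bound s n (size ds).
Proof.
rewrite /node_bound !card_sum !card_prod !card_ord card_ffun !card_prod !card_ord !card_bool.
have card_set (T : finType) : #|{: {set T}}| = 2 ^ #|T|.
  by have := card_powerset [set: T]; rewrite powersetT !cardsT.
by rewrite !card_set card_seq_sub ?undup_uniq // card_prod card_ord card_bool.
Qed.

Lemma size_roots m z : size cs < m -> (forall c, List.In c cs -> size c = z) ->
  size ds <= s + m * z.
Proof.
move=> Hm Hz; apply: leq_trans (size_undup _) _.
rewrite size_cat size_map leq_add2l; apply: (@leq_trans (size cs * z)); last by rewrite leq_mul2r ltnW ?orbT.
elim: (cs) Hz => //= c cs' IH Hz; rewrite size_cat mulSn (Hz c (or_introl erefl)) leq_add2l.
by apply: IH => c' Hc'; apply: Hz; right.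
Qed.
End SmallCountermodel.

Theorem small_countermodel K q (a : seq individual) m I (ns : seq (seq bool)) :
  (forall F, List.In F (kb_tbox K) -> {subset incl_names F <= ns}) ->
  (forall F, List.In F (kb_abox K) -> {subset assertion_names F <= ns}) ->
  (forall F, List.In F (body q) -> {subset atom_names F <= ns}) ->
  {subset a <= ns} -> is_ccq q -> exhaustive q -> rooted q ->
  model I K -> ~ at_least_c_matches I q a m ->
  exists (D : finType) C R (f : individual -> D) (f_inj : {in ns &, injective f}),
    [/\ #|D| <= node_bound (size ns) (size (body_terms q)) (size ns + m * size (count_vars q)),
        model (struct_int C R f_inj) K
      & ~ at_least_c_matches (struct_int C R f_inj) q a m].
Proof.
move=> HT HA Hb Ha q_ccq q_exh q_rooted HI few.
have [cs cs_m cs_all] := finitely_many few.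
have H := @size_roots I ns cs m (size (count_vars q)) cs_m.
have {}H := H (fun c Hc => let: ex_intro sg H := (cs_all c).2 Hc in
  let: And3 _ _ E := H in etrans (congr1 size E) (size_map _ _)).
exists _, (@node_concept q I ns cs), (@node_role q I ns cs), _, (@root_of_inj q I ns cs).
split.
- apply: leq_trans (@card_node q I ns cs) _.
  by rewrite /node_bound leq_add // leq_add // leq_mul2r leq_mul2l H !orbT.
- exact: (J_model q HT HA HI cs).
- exact: (J_few Hb Ha q_ccq q_exh q_rooted cs_all few).
Qed.

(** * The formula *)

Definition dom M d : Prop := sG M RDom d d d.
Definition tind M p d : Prop := sG M RInd p d d.
Definition tcon M p d : Prop := sG M RConcept p d d.
Definition trol M p d e : Prop := sG M RRole p d e.
Definition tasg M t p d : Prop := sG M RAssign t p d.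
Definition tval M i v : Prop := sG M RValue i v v.
Definition tlab M t j : Prop := sG M RLabel t j j.
Definition tcnt M k b j : Prop := sG M RStep k b j.

Definition named M p := some j of M, pword M p j.

(** Names are handled through the positions where their codes start, so a name has as many
    representatives as occurrences. The equation [p + k = q + j] compares the lengths of the
    codes. *)
Definition name_eq M p q := some j of M, some k of M,
  (pword M p j /\ pword M q k /\ p + k = q + j /\
   all d of M, all x of M, all y of M,
     (* The summand 0 gives the equations the shape of [definable_sum]. *)
     (p + d + 0 = x -> q + d + 0 = y -> x < j -> (bit true M x <-> bit true M y))).

Definition role_sat M p d e := some p1 of M, (p1 = p + 1 /\
  ((bit false M p /\ trol M p1 d e) \/ (bit true M p /\ trol M p1 e d))).

Definition concept_sat M p d := some p1 of M, (p1 = p + 1 /\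
  ((bit false M p /\ tcon M p1 d) \/
   (bit true M p /\ some e of M, (dom M e /\ role_sat M p1 d e)))).

Definition incl_sat M p := some p1 of M, some p2 of M, some k of M,
  (p1 = p + 1 /\ p2 = p + 2 /\
   ((bit false M p /\ pconcept M p2 k /\ all d of M, (dom M d -> concept_sat M p2 d ->
       ((bit false M p1 /\ concept_sat M k d) \/ (bit true M p1 /\ ~ concept_sat M k d)))) \/
    (bit true M p /\ prole M p2 k /\ all d of M, all e of M, (dom M d -> dom M e ->
       role_sat M p2 d e ->
       ((bit false M p1 /\ role_sat M k d e) \/ (bit true M p1 /\ ~ role_sat M k d e)))))).

Definition assert_sat M p := some p1 of M, some p2 of M,
  (p1 = p + 1 /\ pword M p1 p2 /\
   ((bit false M p /\ some d of M, (tind M p2 d /\ tcon M p1 d)) \/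
    (bit true M p /\ some p3 of M, (pword M p2 p3 /\ some d of M, some e of M,
       (tind M p2 d /\ tind M p3 e /\ trol M p1 d e))))).

Definition term_sat M t p d := some p1 of M, (p1 = p + 1 /\
  ((bit false M p /\ tasg M t p1 d) \/ (bit true M p /\ tind M p1 d))).

Definition atom_sat M t p := some p1 of M, some p2 of M,
  (p1 = p + 1 /\ pword M p1 p2 /\
   ((bit false M p /\ some d of M, (term_sat M t p2 d /\ tcon M p1 d)) \/
    (bit true M p /\ some p3 of M, (pterm M p2 p3 /\ some d of M, some e of M,
       (term_sat M t p2 d /\ term_sat M t p3 e /\ trol M p1 d e))))).

(* [kv], [kb] and [ka] are the positions of the lists of answer variables, of
   atoms and of individuals of the answer. *)
Definition body_sat M t kb := all x of M, (litem patom M kb x ->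
  some p of M, (p = x + 1 /\ atom_sat M t p)).

(** The common count [i] pairs an answer variable with the individual at the same index of the
    answer. *)
Definition answer_sat M t kv ka := all x of M, all y of M, all i of M,
  (tcnt M kv x i -> bit true M x -> tcnt M ka y i -> bit true M y ->
   some p of M, some q of M, some d of M,
     (p = x + 1 /\ q = y + 1 /\ tasg M t p d /\ tind M q d)).

Definition match_sat M t kv kb ka := body_sat M t kb /\ answer_sat M t kv ka.

(** The tables are indexed by positions, so they must agree on all occurrences of a name. For
    individuals the equivalence also contains the unique name assumption. *)
Definition structure_axiom M :=
  (some d of M, dom M d) /\
  (all p of M, (named M p -> some d of M, (dom M d /\ tind M p d))) /\
  (all p of M, all q of M, all d of M, all e of M,
     (tind M p d -> tind M q e -> (d = e <-> name_eq M p q))) /\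
  (all p of M, all q of M, all d of M, (name_eq M p q -> tcon M p d -> tcon M q d)) /\
  (all p of M, all q of M, all d of M, all e of M,
     (name_eq M p q -> trol M p d e -> trol M q d e)).

(* The assignments are closed under updates, hence all of them are coded. *)
Definition assignment_axiom M :=
  (all t of M, all p of M, (named M p -> some d of M, (dom M d /\ tasg M t p d))) /\
  (all t of M, all p of M, all q of M, all d of M, all e of M,
     (tasg M t p d -> tasg M t q e -> name_eq M p q -> d = e)) /\
  (all t of M, all p of M, all d of M, (named M p -> dom M d ->
     some u of M, all q of M, all e of M, (named M q ->
       (tasg M u q e <->
        (name_eq M p q /\ e = d) \/ (~ name_eq M p q /\ tasg M t q e))))).

(** Binary values, least significant digit first, every digit being preceded by [true]. Only the
    correctness of the entries is demanded; [few_matches] asks for the presence of the one it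
    uses. *)
Definition value_axiom M := all i of M, all v of M, (tval M i v ->
  (bit false M i /\ v = 0) \/
  (bit true M i /\ some i1 of M, some i2 of M, some u of M,
     (i1 = i + 1 /\ i2 = i + 2 /\ tval M i2 u /\
      ((bit true M i1 /\ u + u + 1 = v) \/ (bit false M i1 /\ u + u + 0 = v))))).

(** A recursion on the count [j], which determines the table. The table gives access to the words of
    a list by index. *)
Definition step_axiom M := all k of M, all y of M, all j of M,
  (tcnt M k y j <-> (y = k /\ j = 0) \/
   some x of M, some i of M, (tcnt M k x i /\ lstep pword M k x y /\ j = i + 1)).

Definition items_sat (T : parser) (P : structure -> nat -> Prop) M k :=
  all x of M, (litem T M k x -> some p of M, (p = x + 1 /\ P M p)).

(** The labels of matches are below [v - 1] and determine the values of the counting variables, so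
    there are at most [v - 1] counting matches. A bound 0 is excluded, being always attained. *)
Definition few_matches M kv kc kb ka kn := some v of M,
  (tval M kn v /\ ~ v = 0 /\
   (all t of M, (match_sat M t kv kb ka ->
      some j of M, (tlab M t j /\ some j1 of M, (j1 = j + 1 /\ j1 < v)))) /\
   (all t of M, all u of M, all j of M, (match_sat M t kv kb ka -> match_sat M u kv kb ka ->
      tlab M t j -> tlab M u j ->
      all x of M, all p of M, all d of M, (litem pword M kc x -> p = x + 1 ->
        tasg M t p d -> tasg M u p d)))).

Definition countermodel M kt kx kv kc kb ka kn :=
  structure_axiom M /\ assignment_axiom M /\ value_axiom M /\
  items_sat pincl incl_sat M kt /\ items_sat passert assert_sat M kx /\
  few_matches M kv kc kb ka kn.

Definition role_ends M kb p q := some x of M, some x1 of M, some x2 of M,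
  (litem patom M kb x /\ x1 = x + 1 /\ x2 = x + 2 /\ bit true M x1 /\ pword M x2 p /\ pterm M p q).

Definition concept_end M kb p := some x of M, some x1 of M, some x2 of M,
  (litem patom M kb x /\ x1 = x + 1 /\ x2 = x + 2 /\ bit false M x1 /\ pword M x2 p).

Definition body_pos M kb p :=
  concept_end M kb p \/ some q of M, (role_ends M kb p q \/ role_ends M kb q p).

Definition next_eq M p q := some p1 of M, some q1 of M,
  (p1 = p + 1 /\ q1 = q + 1 /\ name_eq M p1 q1).

(** Vertices are occurrences of terms: besides the edges of role atoms, steps lead between
    occurrences of the same term, those with equal tag and equal name. *)
Definition gaifman_step M kb p q := inpos M q /\
  (role_ends M kb p q \/ role_ends M kb q p \/
   (body_pos M kb p /\ body_pos M kb q /\ next_eq M p q /\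
    ((bit false M p /\ bit false M q) \/ (bit true M p /\ bit true M q)))).

Definition anchor_pos M kv p := bit true M p \/
  (bit false M p /\ some y of M, (litem pword M kv y /\ next_eq M p y)).

(** Query terms include variables in no atom. Answer variables are anchors themselves, whereas a
    counting variable outside the body would be an isolated vertex without anchor; hence the second
    clause. *)
Definition rooted_sat M kv kc kb :=
  (all p of M, (body_pos M kb p ->
     some q of M, (reach gaifman_step M kb p q /\ anchor_pos M kv q))) /\
  (all y of M, (litem pword M kc y ->
     some p of M, (body_pos M kb p /\ bit false M p /\ next_eq M p y))).

Definition assertion_ind M x p := some x1 of M, some x2 of M, some p0 of M,
  (x1 = x + 1 /\ x2 = x + 2 /\ pword M x2 p0 /\ (p = p0 \/ (bit true M x1 /\ pword M p0 p))).

(** An empty list of existential variables is coded by a single 0. Equal lengths of two lists are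
    tested by comparing the counts at their ends. The last clause excludes leading zeros: the most
    significant digit of a nonzero number is at position [kz - 2]. *)
Definition valid M kx kv ke kc kb ka kn kz :=
  bit false M ke /\
  (all x of M, all y of M, (litem pword M kv x -> litem pword M kc y -> ~ next_eq M x y)) /\
  (all p of M, (body_pos M kb p -> bit false M p ->
     some y of M, ((litem pword M kv y \/ litem pword M kc y) /\ next_eq M p y))) /\
  (some x of M, some y of M, some i of M,
     (tcnt M kv x i /\ bit false M x /\ tcnt M ka y i /\ bit false M y)) /\
  (all y of M, (litem pword M ka y -> some x of M, some p of M, some y1 of M,
     (litem passert M kx x /\ assertion_ind M x p /\ y1 = y + 1 /\ name_eq M p y1))) /\
  rooted_sat M kv kc kb /\
  (bit false M kn \/ some l of M, (kz = l + 2 /\ bit true M l)).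

Definition decomposed M kt kx kv ke kc kb ka kn kz :=
  kt = 0 /\ plist pincl M kt kx /\ plist passert M kx kv /\ plist pword M kv ke /\
  plist pword M ke kc /\ plist pword M kc kb /\ plist patom M kb ka /\
  plist pword M ka kn /\ pword M kn kz /\ ~ inpos M kz.

(** The nine positions are unique if they exist ([pieces_unique]). Words that code no valid instance
    satisfy the implication vacuously, as they should, being outside the language. *)
Definition no_answer M :=
  set_axiom M /\ step_axiom M /\
  all kt of M, all kx of M, all kv of M, all ke of M, all kc of M, all kb of M,
  all ka of M, all kn of M, all kz of M,
    (decomposed M kt kx kv ke kc kb ka kn kz -> valid M kx kv ke kc kb ka kn kz ->
     countermodel M kt kx kv kc kb ka kn).

Lemma definable_tind : definable2 tind. Proof. rewrite /definable2 /tind; definable. Qed.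
Lemma definable_dom : definable1 dom. Proof. rewrite /definable1 /dom; definable. Qed.
Lemma definable_tcon : definable2 tcon. Proof. rewrite /definable2 /tcon; definable. Qed.
Lemma definable_trol : definable3 trol. Proof. rewrite /definable3 /trol; definable. Qed.
Lemma definable_tasg : definable3 tasg. Proof. rewrite /definable3 /tasg; definable. Qed.
Lemma definable_tval : definable2 tval. Proof. rewrite /definable2 /tval; definable. Qed.
Lemma definable_tlab : definable2 tlab. Proof. rewrite /definable2 /tlab; definable. Qed.
Lemma definable_tcnt : definable3 tcnt. Proof. rewrite /definable3 /tcnt; definable. Qed.
Lemma definable_named : definable1 named. Proof. rewrite /definable1 /named; definable. Qed.
Lemma definable_name_eq : definable2 name_eq. Proof. rewrite /definable2 /name_eq; definable. Qed.
#[global] Hint Resolve definable_tind definable_dom definable_tcon definable_trol definable_tasg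
  definable_tval definable_tlab definable_tcnt definable_named definable_name_eq : definable.
Lemma definable_role_sat : definable3 role_sat.
Proof. rewrite /definable3 /role_sat; definable. Qed.
#[global] Hint Resolve definable_role_sat : definable.
Lemma definable_concept_sat : definable2 concept_sat.
Proof. rewrite /definable2 /concept_sat; definable. Qed.
#[global] Hint Resolve definable_concept_sat : definable.
Lemma definable_incl_sat : definable1 incl_sat.
Proof. rewrite /definable1 /incl_sat; definable. Qed.
Lemma definable_assert_sat : definable1 assert_sat.
Proof. rewrite /definable1 /assert_sat; definable. Qed.
Lemma definable_term_sat : definable3 term_sat.
Proof. rewrite /definable3 /term_sat; definable. Qed.
#[global] Hint Resolve definable_incl_sat definable_assert_sat definable_term_sat : definable.
Lemma definable_atom_sat : definable2 atom_sat.
Proof. rewrite /definable2 /atom_sat; definable. Qed.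
#[global] Hint Resolve definable_atom_sat : definable.
Lemma definable_match_sat : definable4 match_sat.
Proof. rewrite /definable4 /match_sat /body_sat /answer_sat; definable. Qed.
#[global] Hint Resolve definable_match_sat : definable.
Lemma definable_items_sat T P : definable2 T -> definable1 P -> definable1 (items_sat T P).
Proof. move=> HT HP; rewrite /definable1 /items_sat; definable. Qed.
#[global] Hint Resolve definable_items_sat : definable.
Lemma definable_role_ends : definable3 role_ends.
Proof. rewrite /definable3 /role_ends; definable. Qed.
#[global] Hint Resolve definable_role_ends : definable.
Lemma definable_concept_end : definable2 concept_end.
Proof. rewrite /definable2 /concept_end; definable. Qed.
#[global] Hint Resolve definable_concept_end : definable.
Lemma definable_body_pos : definable2 body_pos.
Proof. rewrite /definable2 /body_pos; definable. Qed.
Lemma definable_next_eq : definable2 next_eq.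
Proof. rewrite /definable2 /next_eq; definable. Qed.
#[global] Hint Resolve definable_body_pos definable_next_eq : definable.
Lemma definable_gaifman_step : definable3 gaifman_step.
Proof. rewrite /definable3 /gaifman_step; definable. Qed.
Lemma definable_anchor_pos : definable2 anchor_pos.
Proof. rewrite /definable2 /anchor_pos; definable. Qed.
#[global] Hint Resolve definable_gaifman_step definable_anchor_pos : definable.
Lemma definable_assertion_ind : definable2 assertion_ind.
Proof. rewrite /definable2 /assertion_ind; definable. Qed.
#[global] Hint Resolve definable_assertion_ind : definable.

Lemma definable_no_answer : definable (fun M _ => no_answer M).
Proof.
apply: definable_and; first exact: definable_set_axiom.
rewrite /step_axiom /decomposed /valid /rooted_sat /countermodel /few_matches
  /structure_axiom /assignment_axiom /value_axiom; definable.
Qed.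

(** * Semantics of the formula *)

Lemma onth_drop (T : Type) (s : seq T) p d : onth (drop p s) d = onth s (p + d).
Proof. by elim: s p => [|x s IH] [|p] //=; rewrite ?drop0 //; case: d. Qed.

Lemma onth_catl (T : Type) (s t : seq T) d : d < size s -> onth (s ++ t) d = onth s d.
Proof. by elim: s d => [|x s IH] [|d] //= Hd; apply: IH. Qed.

Lemma seg_onth w p u j d : seg w p u j -> d < size u -> onth w (p + d) = onth u d.
Proof. by case=> E _ Hd; rewrite -onth_drop E onth_catl. Qed.

Definition nm M p A : Prop := exists j, seg (sw M) p (enc_word A) j.

Lemma nm_det M p A B : nm M p A -> nm M p B -> A = B.
Proof. by case=> j H [k H']; case: (seg_unique proper_word H H'). Qed.

Lemma nm_lt M p A : nm M p A -> p < size (sw M).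
Proof. by case=> j /seg_le[] //; case: proper_word => _; apply. Qed.

Section Names.
Variable M : structure.
Hypotheses (set_ok : set_axiom M) (long : size (sw M) + 2 < sN M).

Lemma pos_lt p u j : seg (sw M) p u j -> 0 < size u -> j < sN M.
Proof. by move=> /seg_le H /H[]; lia. Qed.

Lemma word_lt p A j : seg (sw M) p (enc_word A) j -> j < sN M.
Proof. by move=> /pos_lt; apply; case: proper_word => _; apply. Qed.

Lemma namedP p : named M p <-> exists A, nm M p A.
Proof.
split=> [[j _ /(parses_word set_ok long)[A HA]]|[A [j HA]]].
  by exists A, j.
exists j; first exact: word_lt HA.
by apply/(parses_word set_ok long); exists A.
Qed.

Lemma name_eqP p q : name_eq M p q <-> exists A, nm M p A /\ nm M q A.
Proof.
split.
  case=> j jN [k kN [/(parses_word set_ok long)[A HA] [/(parses_word set_ok long)[B HB] [Es H]]]].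
  exists A; split; first by exists j.
  suff -> : A = B by exists k.
  have [_ Ej] := HA; have [_ Ek] := HB.
  have Hsize : size (enc_word A) = size (enc_word B) by lia.
  have [pfree _] := proper_word.
  suff E : enc_word A = enc_word B.
    by have [] := pfree A B [::] [::]; rewrite ?cats0.
  apply: (@eq_from_nth _ false) => // d Hd.
  have dA := seg_onth HA Hd; have dB := seg_onth HB; rewrite -Hsize in dB; have {}dB := dB d Hd.
  have E1 (u : seq bool) : d < size u -> onth u d = Some (nth false u d).
    by elim: u (d) => [|x u IH] [|d'] //= Hd'; apply: IH.
  rewrite E1 // in dA; rewrite E1 -?Hsize // in dB.
  have A0 : 0 < size (enc_word A) by case: proper_word => _; apply.
  have := seg_le HA A0; have := seg_le HB; rewrite -Hsize => /(_ A0) HB' HA'.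
  have := H d _ (p + d) _ (q + d) _ (addn0 _) (addn0 _) _.
  rewrite /bit dA dB => H'; have {}H' := H' ltac:(lia) ltac:(lia) ltac:(lia) ltac:(lia).
  move: H'; case: (nth false (enc_word A) d); case: (nth false (enc_word B) d) => // -[H1 H2].
    by have := H1 erefl.
  by have := H2 erefl.
case=> A [[j HA] [k HB]]; exists j; first exact: word_lt HA.
exists k; first exact: word_lt HB.
split; first by apply/(parses_word set_ok long); exists A.
split; first by apply/(parses_word set_ok long); exists A.
have [_ Ej] := HA; have [_ Ek] := HB; split; first by lia.
move=> d _ x _ y _; rewrite !addn0 => <- <- dj.
have Hd : d < size (enc_word A) by lia.
by rewrite /bit (seg_onth HA Hd) (seg_onth HB Hd).
Qed.

Lemma pconcept_end p B j k : seg (sw M) p (enc_basic_concept B) j -> pconcept M p k -> k = j.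
Proof.
by move=> H /(parses_concept set_ok long)[B' /(seg_unique proper_concept H)[]].
Qed.

Lemma prole_end p R j k : seg (sw M) p (enc_role R) j -> prole M p k -> k = j.
Proof.
by move=> H /(parses_role set_ok long)[R' /(seg_unique proper_role H)[]].
Qed.

Lemma pword_end p A j k : seg (sw M) p (enc_word A) j -> pword M p k -> k = j.
Proof.
by move=> H /(parses_word set_ok long)[R' /(seg_unique proper_word H)[]].
Qed.

Lemma pterm_end p u j k : seg (sw M) p (enc_term u) j -> pterm M p k -> k = j.
Proof.
by move=> H /(parses_term set_ok long)[R' /(seg_unique proper_term H)[]].
Qed.

Lemma some_succ p c (P : nat -> Prop) : p + c < sN M ->
  (some q of M, (q = p + c /\ P q)) <-> P (p + c).
Proof. by move=> H; split=> [[q _ [-> //]]|HP]; exists (p + c). Qed.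

Lemma bit_succ b p : bit b M p -> p.+1 < sN M.
Proof. by move=> /bit_lt; lia. Qed.

Lemma items_satP T (P : parser) (enc : T -> seq bool) (S : structure -> nat -> Prop)
    (Q : T -> Prop) k s j :
  parses M P enc -> proper enc -> seg (sw M) k (enc_list enc s) j ->
  (forall p F l, seg (sw M) p (enc F) l -> S M p <-> Q F) ->
  items_sat P S M k <-> forall F, List.In F s -> Q F.
Proof.
move=> PE enc_proper Hs HS; have [H1 H2] := litem_all set_ok long PE enc_proper Hs.
split=> [H F /H2[x [l [xM Hx HF]]]|H x xN /[dup] Hx /H1[F [l [HF Hseg]]]].
  have [|p _ [->]] := H x _ Hx; first by lia.
  by rewrite addn1 => /(HS _ _ _ HF).
have xM : x < size (sw M) by case: Hx => _ /bit_lt.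
exists x.+1; first by lia.
by rewrite addn1; split=> //; apply/(HS _ _ _ Hseg)/H.
Qed.

(** * Satisfaction of inclusions, assertions and atoms in a represented interpretation *)

Section Representation.
Variables (D : Type) (g : D -> nat) (C : concept_name -> D -> Prop).
Variables (R : role_name -> D -> D -> Prop) (f : individual -> D) (ns : seq individual).
Hypothesis f_inj : {in ns &, injective f}.
Let J := struct_int C R f_inj.

(* The tables of [M] describe [J], [g] being the numbering of the elements. *)
Record represents_int : Prop := RepresentsInt {
  rep_lt : forall x, g x < sN M;
  rep_inj : injective g;
  rep_dom : forall d, d < sN M -> dom M d <-> exists x, d = g x;
  rep_names : forall A, A \in ns <-> exists p, nm M p A;
  rep_ind : forall p b d, d < sN M -> nm M p b -> tind M p d <-> d = g (f b);
  rep_con : forall p A x, nm M p A -> tcon M p (g x) <-> C A x;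
  rep_rol : forall p P x y, nm M p P -> trol M p (g x) (g y) <-> R P x y
}.

Hypothesis rep : represents_int.

Lemma role_satP p S j x y : seg (sw M) p (enc_role S) j ->
  role_sat M p (g x) (g y) <-> role_ext (I := J) S (inl x) (inl y).
Proof.
case: S => P /seg_cons[Hb Hs]; have Hp : nm M p.+1 P by [exists j];
  (rewrite /role_sat some_succ; last by rewrite addn1; exact: bit_succ Hb); rewrite addn1.
- split=> [[[_ /(rep_rol rep _ _ Hp)//]|[/(bit_det Hb)//]]|H].
  by left; split=> //; apply/(rep_rol rep _ _ Hp).
- split=> [[[/(bit_det Hb)//]|[_ /(rep_rol rep _ _ Hp)//]]|H].
  by right; split=> //; apply/(rep_rol rep _ _ Hp).
Qed.

Lemma concept_satP p B j x : seg (sw M) p (enc_basic_concept B) j ->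
  concept_sat M p (g x) <-> concept_ext (I := J) B (inl x).
Proof.
case: B => [A|S] /seg_cons[Hb Hs];
  (rewrite /concept_sat some_succ; last by rewrite addn1; exact: bit_succ Hb); rewrite addn1.
- have Hp : nm M p.+1 A by exists j.
  split=> [[[_ /(rep_con rep _ Hp)//]|[/(bit_det Hb)//]]|H].
  by left; split=> //; apply/(rep_con rep _ Hp).
- split=> [[[/(bit_det Hb)//]|[_ [e eN [/(rep_dom rep eN)[y ->] /(role_satP _ _ Hs) H]]]]|].
    by exists (inl y).
  case=> -[y|y] H; last by case: S H Hs.
  right; split=> //; exists (g y); first exact: rep_lt.
  split; last exact/(role_satP _ _ Hs).
  by apply/(rep_dom rep (rep_lt rep y)); exists y.
Qed.

Lemma concept_inr B b : ~ concept_ext (I := J) B (inr b).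
Proof. by case: B => [A|[P|P]] //= [] []. Qed.

Lemma role_inl S (x y : domain J) : role_ext (I := J) S x y ->
  exists x' y', x = inl x' /\ y = inl y'.
Proof. by case: S => P; case: x y => [x|x] [y|y] //= _; exists x, y. Qed.

Lemma dom_g x : dom M (g x).
Proof. by apply/(rep_dom rep (rep_lt rep x)); exists x. Qed.

Lemma incl_satP p F j : seg (sw M) p (enc_inclusion F) j ->
  incl_sat M p <-> sat_inclusion J F.
Proof.
have Hlt B l k : seg (sw M) l (enc_basic_concept B) k -> k < sN M.
  by move=> /pos_lt; apply; case: proper_concept => _; apply.
have Hlt' B l k : seg (sw M) l (enc_role B) k -> k < sN M.
  by move=> /pos_lt; apply; case: proper_role => _; apply.
have E1 : p + 1 = p.+1 by lia.
have E2 : p + 2 = p.+2 by lia.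
case: F => [B1 B2|B1 B2|R1 R2|R1 R2] /seg_cons[Hb /seg_cons[Hb1 /seg_cat[k H1 H2]]];
  have p1N := bit_succ Hb; have p2N := bit_succ Hb1; split.
- case=> _ _ [_ _ [k' _ [-> [->]]]]; rewrite {}E1 {}E2.
  case=> [[_ [/(pconcept_end H1) -> H]]|[/(bit_det Hb)//]] [x|b] Hx; last by case: (concept_inr Hx).
  have [|[_ /(concept_satP _ H2)//]|[/(bit_det Hb1)//]] := H (g x) (rep_lt rep x) (dom_g x).
  exact/(concept_satP _ H1).
- move=> H; exists p.+1 => //; exists p.+2 => //; exists k; first exact: Hlt H1.
  rewrite E1 E2; split=> //; split=> //; left; split=> //; split.
    by apply/(parses_concept set_ok long); exists B1.
  move=> d dN /(rep_dom rep dN)[x ->] /(concept_satP _ H1) Hx; left; split=> //.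
  exact/(concept_satP _ H2)/H.
- case=> _ _ [_ _ [k' _ [-> [->]]]]; rewrite {}E1 {}E2.
  case=> [[_ [/(pconcept_end H1) -> H]]|[/(bit_det Hb)//]] [x|b] Hx; last by case: (concept_inr Hx).
  have [|[/(bit_det Hb1)//]|[_ Hn] Hx2] := H (g x) (rep_lt rep x) (dom_g x).
    exact/(concept_satP _ H1).
  exact/Hn/(concept_satP _ H2).
- move=> H; exists p.+1 => //; exists p.+2 => //; exists k; first exact: Hlt H1.
  rewrite E1 E2; split=> //; split=> //; left; split=> //; split.
    by apply/(parses_concept set_ok long); exists B1.
  move=> d dN /(rep_dom rep dN)[x ->] /(concept_satP _ H1) Hx; right; split=> //.
  by move=> /(concept_satP _ H2); apply: H.
- case=> _ _ [_ _ [k' _ [-> [->]]]]; rewrite {}E1 {}E2.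
  case=> [[/(bit_det Hb)//]|[_ [/(prole_end H1) -> H]]] d e /[dup] /role_inl[x [y [-> ->]]] Hxy.
  have [|[_ /(role_satP _ _ H2)//]|[/(bit_det Hb1)//]] := H _ (rep_lt rep x) _ (rep_lt rep y) (dom_g x) (dom_g y).
  exact/(role_satP _ _ H1).
- move=> H; exists p.+1 => //; exists p.+2 => //; exists k; first exact: Hlt' H1.
  rewrite E1 E2; split=> //; split=> //; right; split=> //; split.
    by apply/(parses_role set_ok long); exists R1.
  move=> d dN e eN /(rep_dom rep dN)[x ->] /(rep_dom rep eN)[y ->] /(role_satP _ _ H1) Hx.
  left; split=> //; exact/(role_satP _ _ H2)/H.
- case=> _ _ [_ _ [k' _ [-> [->]]]]; rewrite {}E1 {}E2.
  case=> [[/(bit_det Hb)//]|[_ [/(prole_end H1) -> H]]] d e /[dup] /role_inl[x [y [-> ->]]] Hxy.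
  have [|[/(bit_det Hb1)//]|[_ Hn] Hx2] := H _ (rep_lt rep x) _ (rep_lt rep y) (dom_g x) (dom_g y).
    exact/(role_satP _ _ H1).
  exact/Hn/(role_satP _ _ H2).
- move=> H; exists p.+1 => //; exists p.+2 => //; exists k; first exact: Hlt' H1.
  rewrite E1 E2; split=> //; split=> //; right; split=> //; split.
    by apply/(parses_role set_ok long); exists R1.
  move=> d dN e eN /(rep_dom rep dN)[x ->] /(rep_dom rep eN)[y ->] /(role_satP _ _ H1) Hx.
  right; split=> //; move=> /(role_satP _ _ H2); exact: H.
Qed.

Lemma ind_ext b p : nm M p b -> ind_int J b = inl (f b).
Proof.
move=> Hb; have : b \in ns by apply/(rep_names rep); exists p.
by rewrite /= /struct_ind => ->.
Qed.

Lemma tind_f b p : nm M p b -> tind M p (g (f b)).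
Proof. by move=> Hb; apply/(rep_ind rep _ Hb); first exact: rep_lt. Qed.

Lemma assert_satP p F j : seg (sw M) p (enc_assertion F) j ->
  assert_sat M p <-> sat_assertion J F.
Proof.
have E1 : p + 1 = p.+1 by lia.
case: F => [A b|P b c] /seg_cons[Hb /seg_cat[k HA]].
  move=> Hk; have HA' : nm M p.+1 A by exists k.
  have Hk' : nm M k b by exists j.
  rewrite /sat_assertion (ind_ext Hk') /=; split.
    case=> _ _ [k' _ [->]]; rewrite E1 => -[/(pword_end HA) ->].
    case=> [[_ [d dN [/(rep_ind rep dN Hk') -> ]]]|[/(bit_det Hb)//]].
    by move=> /(rep_con rep _ HA').
  move=> /(rep_con rep _ HA') H; exists p.+1; first exact: bit_succ Hb.
  exists k; first exact: word_lt HA.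
  split=> //; split; first by apply/(parses_word set_ok long); exists A.
  left; split=> //; exists (g (f b)); first exact: rep_lt.
  by split=> //; exact: tind_f.
move=> /seg_cat[l Hk Hl]; have HA' : nm M p.+1 P by exists k.
have Hk' : nm M k b by exists l.
have Hl' : nm M l c by exists j.
rewrite /sat_assertion (ind_ext Hk') (ind_ext Hl') /=; split.
  case=> _ _ [k' _ [->]]; rewrite E1 => -[/(pword_end HA) ->].
  case=> [[/(bit_det Hb)//]|[_ [l' _ [/(pword_end Hk) ->]]]].
  case=> d dN [e eN [/(rep_ind rep dN Hk') -> [/(rep_ind rep eN Hl') ->]]].
  by move=> /(rep_rol rep _ _ HA').
move=> /(rep_rol rep _ _ HA') H; exists p.+1; first exact: bit_succ Hb.
exists k; first exact: word_lt HA.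
split=> //; split; first by apply/(parses_word set_ok long); exists P.
right; split=> //; exists l; first exact: word_lt Hk.
split; first by apply/(parses_word set_ok long); exists b.
exists (g (f b)); first exact: rep_lt.
exists (g (f c)); first exact: rep_lt.
by split; [exact: tind_f|split=> //; exact: tind_f].
Qed.

Section Assignment.
Variables (t : nat) (sg : variable -> domain J).

Definition represents_asg : Prop := forall p A d, d < sN M -> nm M p A ->
  tasg M t p d <-> exists x, sg A = inl x /\ d = g x.

Hypothesis rep_t : represents_asg.

Lemma term_satP p u j d : d < sN M -> seg (sw M) p (enc_term u) j ->
  term_sat M t p d <-> exists x, term_val sg u = inl x /\ d = g x.
Proof.
move=> dN; case: u => [v|b] /seg_cons[Hb Hs];
  (rewrite /term_sat some_succ; last by rewrite addn1; exact: bit_succ Hb); rewrite addn1.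
- have Hp : nm M p.+1 v by exists j.
  split=> [[[_ /(rep_t dN Hp)//]|[/(bit_det Hb)//]]|H].
  by left; split=> //; apply/(rep_t dN Hp).
- have Hp : nm M p.+1 b by exists j.
  rewrite -[term_val sg (Cst b)]/(ind_int J b) (ind_ext Hp).
  split=> [[[/(bit_det Hb)//]|[_ /(rep_ind rep dN Hp) ->]]|[x [[<-] ->]]].
    by exists (f b).
  by right; split=> //; exact: tind_f.
Qed.

Lemma atom_satP p F j : seg (sw M) p (enc_atom F) j ->
  atom_sat M t p <-> sat_atom sg F.
Proof.
have E1 : p + 1 = p.+1 by lia.
case: F => [A u|P u v] /seg_cons[Hb /seg_cat[k HA]].
  move=> Hk; have HA' : nm M p.+1 A by exists k.
  rewrite /=; split.
    case=> _ _ [k' _ [->]]; rewrite E1 => -[/(pword_end HA) ->].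
    case=> [[_ [d dN [/(term_satP dN Hk)[x [-> ->]]]]]|[/(bit_det Hb)//]].
    by move=> /(rep_con rep _ HA').
  case Ex: (term_val sg u) => [x|//] H; exists p.+1; first exact: bit_succ Hb.
  exists k; first exact: word_lt HA.
  split=> //; split; first by apply/(parses_word set_ok long); exists A.
  left; split=> //; exists (g x); first exact: rep_lt.
  split; last exact/(rep_con rep _ HA').
  by apply/(term_satP (rep_lt rep x) Hk); exists x.
move=> /seg_cat[l Hk Hl]; have HA' : nm M p.+1 P by exists k.
rewrite /=; split.
  case=> _ _ [k' _ [->]]; rewrite E1 => -[/(pword_end HA) ->].
  case=> [[/(bit_det Hb)//]|[_ [l' _ [/(pterm_end Hk) ->]]]].
  case=> d dN [e eN [/(term_satP dN Hk)[x [-> ->]] [/(term_satP eN Hl)[y [-> ->]]]]].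
  by move=> /(rep_rol rep _ _ HA').
case Ex: (term_val sg u) => [x|//]; case Ey: (term_val sg v) => [y|//] H.
exists p.+1; first exact: bit_succ Hb.
exists k; first exact: word_lt HA.
split=> //; split; first by apply/(parses_word set_ok long); exists P.
right; split=> //; exists l.
  by apply: pos_lt Hk _; case: proper_term => _; apply.
split; first by apply/(parses_term set_ok long); exists u.
exists (g x); first exact: rep_lt.
exists (g y); first exact: rep_lt.
split; first by apply/(term_satP (rep_lt rep x) Hk); exists x.
split; first by apply/(term_satP (rep_lt rep y) Hl); exists y.
exact/(rep_rol rep _ _ HA').
Qed.
End Assignment.
End Representation.

(** * Access to the words of a list by index *)

Section Steps.
Hypothesis step_ok : step_axiom M.

Lemma tcntP k y j : k < sN M -> y < sN M -> j < sN M ->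
  tcnt M k y j <-> chain (lstep pword M k) k j y.
Proof.
move=> kN; elim: j y => [|j IH] y yN jN.
  rewrite step_ok //; split=> [[[-> _]|[x _ [i _ [_ [_ Ei]]]]]|H].
  - exact: chain0.
  - by exfalso; lia.
  - by left; inversion H.
rewrite step_ok //; split=> [[[_ //]|[x xN [i iN [Hx [Hxy Ei]]]]]|H].
  have {Ei}Ei : i = j by lia.
  by subst i; apply: chainS Hxy; apply/IH => //; lia.
right; inversion H as [|n' x z Hx Hxy]; subst.
have xN : x < sN M by case: Hxy => /bit_lt; lia.
exists x => //; exists j; first by lia.
by split; [apply/IH => //; lia|rewrite addn1].
Qed.

Lemma word_chain k y i s l : seg (sw M) k (enc_list enc_word s) l -> i < sN M -> y < sN M ->
  tcnt M k y i <-> inpos M y /\ exists2 s1, size s1 = i & seg (sw M) k (items enc_word s1) y.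
Proof.
move=> Hs iN yN; have [kM _] := seg_le Hs ((proper_list proper_word).2 s).
rewrite tcntP //; last by lia.
apply: (chain_list long k i y (parses_word set_ok long) proper_word).
exact/inposP.
Qed.

Lemma word_at k y i s l b : seg (sw M) k (enc_list enc_word s) l -> i < sN M -> y < sN M ->
  tcnt M k y i -> bit b M y ->
  if b then i < size s /\ nm M y.+1 (nth [::] s i) else i = size s.
Proof.
move=> Hs iN yN /(word_chain Hs iN yN)[_ [s1 Es1 Hs1]] Hb.
have := list_prefix proper_word Hs Hs1 Hb; case: b Hb => Hb; last by move=> ->.
case=> x [s2 Es]; subst s i; rewrite nth_cat ltnn subnn /= size_cat /=; split; first by lia.
move: Hs; rewrite /enc_list -/(items enc_word _) items_cat -catA => /seg_cat[y' Hy'].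
rewrite (seg_det Hy' Hs1) /items /= -catA => /seg_cons[_ /seg_cat[l' Hl' _]].
by exists l'.
Qed.

Lemma word_exists k s l i : seg (sw M) k (enc_list enc_word s) l -> i <= size s -> exists y,
  [/\ y < sN M, i < sN M, tcnt M k y i & bit (i < size s) M y].
Proof.
move=> Hs Hi; have := Hs; rewrite -{1}(cat_take_drop i s).
rewrite /enc_list -/(items enc_word _) items_cat -catA => /seg_cat[y Hy Hy'].
have Hb : bit (i < size s) M y.
  move: Hy'; case: (ltnP i (size s)) => His.
    by rewrite (drop_nth [::] His) /items /= => /seg_cons[].
  by rewrite drop_oversize // => /seg_cons[].
have yM := bit_lt Hb; have yN : y < sN M by lia.
have iN : i < sN M.
  have := Hy => -[_ Ey]; suff : size (take i s) <= size (items enc_word (take i s)).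
    by rewrite size_take; case: ifP; lia.
  by elim: (take i s) => //= x s' IH; rewrite /items /= size_cat; move: IH; rewrite /items; lia.
exists y; split=> //; apply/(word_chain Hs iN yN); split; first exact/inposP.
by exists (take i s) => //; rewrite size_takel.
Qed.
End Steps.
End Names.

(** * Correctness of the validity test *)

Section Instance.
Variable M : structure.
Hypotheses (set_ok : set_axiom M) (long : size (sw M) + 2 < sN M) (step_ok : step_axiom M).
Variables (tb : tbox) (ab : abox) (av ev cv : seq variable) (bd : seq atom).
Variables (an : seq individual) (dg : seq bool) (kt kx kv ke kc kb ka kn kz : nat).
Hypotheses (Ht : seg (sw M) kt (enc_list enc_inclusion tb) kx)
  (Hx : seg (sw M) kx (enc_list enc_assertion ab) kv)
  (Hv : seg (sw M) kv (enc_list enc_word av) ke)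
  (He : seg (sw M) ke (enc_list enc_word ev) kc)
  (Hc : seg (sw M) kc (enc_list enc_word cv) kb)
  (Hb : seg (sw M) kb (enc_list enc_atom bd) ka)
  (Ha : seg (sw M) ka (enc_list enc_word an) kn)
  (Hn : seg (sw M) kn (enc_word dg) kz).

Let q := Query av ev cv bd.

Lemma word_items k s l : seg (sw M) k (enc_list enc_word s) l ->
  (forall y, litem pword M k y -> exists A, A \in s /\ nm M y.+1 A) /\
  (forall A, A \in s -> exists y, [/\ y < size (sw M), litem pword M k y & nm M y.+1 A]).
Proof.
move=> Hs; have [H1 H2] := litem_all set_ok long (parses_word set_ok long) proper_word Hs.
split=> [y /H1[A [j [/In_mem HA Hj]]]|A /In_mem/H2[y [j [yM Hy Hj]]]].
  by exists A; split=> //; exists j.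
by exists y; split=> //; exists j.
Qed.

Lemma next_eqP p r A B : nm M p.+1 A -> nm M r.+1 B -> next_eq M p r <-> A = B.
Proof.
move=> HA HB; have pM := nm_lt HA; have rM := nm_lt HB; split.
  case=> _ _ [_ _ [-> [->]]]; rewrite !addn1 => /(name_eqP set_ok long)[C [HA' HB']].
  by rewrite (nm_det HA HA') (nm_det HB HB').
move=> E; subst B; exists p.+1; first by lia.
exists r.+1; first by lia.
by rewrite !addn1; split=> //; split=> //; apply/(name_eqP set_ok long); exists A.
Qed.

Definition at_term p (t : term) : Prop := exists j, seg (sw M) p (enc_term t) j.

Lemma at_term_det p t u : at_term p t -> at_term p u -> t = u.
Proof. by case=> j H [k /(seg_unique proper_term H)[]]. Qed.

Lemma at_term_lt p t : at_term p t -> p < size (sw M).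
Proof. by case=> j /seg_le[] //; case: proper_term => _; apply. Qed.

Lemma at_var p v : at_term p (Var v) <-> bit false M p /\ nm M p.+1 v.
Proof.
split=> [[j /seg_cons[H1 H2]]|[H1 [j H2]]]; first by split=> //; exists j.
by exists j; apply/seg_cons.
Qed.

Lemma at_cst p b : at_term p (Cst b) <-> bit true M p /\ nm M p.+1 b.
Proof.
split=> [[j /seg_cons[H1 H2]]|[H1 [j H2]]]; first by split=> //; exists j.
by exists j; apply/seg_cons.
Qed.

Lemma atoms_at : (forall x, litem patom M kb x -> exists F k, List.In F bd /\ seg (sw M) x.+1 (enc_atom F) k) /\
  (forall F, List.In F bd -> exists x k, [/\ x < size (sw M), litem patom M kb x & seg (sw M) x.+1 (enc_atom F) k]).
Proof. exact: (litem_all set_ok long (parses_atom set_ok long) proper_atom Hb). Qed.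

Lemma role_endsP p r : role_ends M kb p r ->
  exists P t u, [/\ List.In (RoleAtom P t u) bd, at_term p t & at_term r u].
Proof.
case=> x _ [_ _ [_ _ [/(proj1 atoms_at)[F [k [HF Hk]]] [-> [->]]]]].
rewrite addn1 addn2 => -[Hbit []].
case: F HF Hk => [A t|P t u] HF /seg_cons[Hbit']; first by have := bit_det Hbit Hbit'.
case/seg_cat=> l1 H1 /seg_cat[l2 H2 H3] /(pword_end set_ok long H1) -> /(pterm_end set_ok long H2) ->.
by exists P, t, u; split=> //; [exists l2|exists k].
Qed.

Lemma role_ends_exists P t u : List.In (RoleAtom P t u) bd ->
  exists p r, [/\ role_ends M kb p r, at_term p t & at_term r u].
Proof.
case/(proj2 atoms_at) => x [k [xM Hl /seg_cons[Hbit /seg_cat[l1 H1 /seg_cat[l2 H2 H3]]]]].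
exists l1, l2; split; [|by exists l2|by exists k].
exists x; first by lia.
exists x.+1; first by lia.
exists x.+2; first by lia.
rewrite addn1 addn2; do !split=> //; first by apply/(parses_word set_ok long); exists P.
by apply/(parses_term set_ok long); exists t.
Qed.

Lemma body_posP p : body_pos M kb p ->
  exists F t, [/\ List.In F bd, List.In t (atom_terms F) & at_term p t].
Proof.
case=> [[x _ [_ _ [_ _ [/(proj1 atoms_at)[F [k [HF Hk]]] [-> [->]]]]]]|[r _ [/role_endsP|/role_endsP]]].
- rewrite addn1 addn2 => -[Hbit].
  case: F HF Hk => [A t|P t u] HF /seg_cons[Hbit']; last by have := bit_det Hbit Hbit'.
  case/seg_cat=> l1 H1 H2 /(pword_end set_ok long H1) ->.
  by exists (ConceptAtom A t), t; split=> //; [left|exists k].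
- by case=> P [t [u [HF H1 H2]]]; exists (RoleAtom P t u), t; split=> //; left.
- by case=> P [t [u [HF H1 H2]]]; exists (RoleAtom P t u), u; split=> //; right; left.
Qed.

Lemma body_pos_exists F t : List.In F bd -> List.In t (atom_terms F) ->
  exists p, body_pos M kb p /\ at_term p t.
Proof.
case: F => [A u|P u v] HF /=.
  case=> [<-|[]]; have [x [k [xM Hl /seg_cons[Hbit /seg_cat[l1 H1 H2]]]]] := proj2 atoms_at _ HF.
  exists l1; split; last by exists k.
  left; exists x; first by lia.
  exists x.+1; first by lia.
  exists x.+2; first by lia.
  rewrite addn1 addn2; do !split=> //; by apply/(parses_word set_ok long); exists A.
have [p [r [H Hp Hr]]] := role_ends_exists HF.
have pM := at_term_lt Hp; have rM := at_term_lt Hr.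
case=> [<-|[<-|[]]]; [exists p|exists r]; split=> //; right; [exists r|exists p]; try lia.
  by left.
by right.
Qed.

Lemma gaifman_stepP p r t : gaifman_step M kb p r -> at_term p t ->
  exists u, at_term r u /\ gaifman_connected q t u.
Proof.
case=> _ [/role_endsP|[/role_endsP|[_ [/body_posP[F [u [HF Hu Hr]]] [Heq Hbits]]]]] Hp.
- case: Hp => P [t' [u [HF Hp Hr]]] Hp'; exists u; split=> //.
  by rewrite (at_term_det Hp' Hp); apply: Relation_Operators.rt_step; exists P; left.
- case: Hp => P [u [t' [HF Hr Hp]]] Hp'; exists u; split=> //.
  by rewrite (at_term_det Hp' Hp); apply: Relation_Operators.rt_step; exists P; right.
- exists u; split=> //; suff -> : t = u by exact: Relation_Operators.rt_refl.
  case: t u Hp Hr {Hu} => [v|b] [v'|b'] => [/at_var|/at_var|/at_cst|/at_cst] [Hb1 H1]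
    => [/at_var|/at_cst|/at_var|/at_cst] [Hb2 H2].
  + by rewrite ((next_eqP H1 H2).1 Heq).
  + by case: Hbits => -[Hb3 Hb4]; [have := bit_det Hb2 Hb4|have := bit_det Hb1 Hb3].
  + by case: Hbits => -[Hb3 Hb4]; [have := bit_det Hb1 Hb3|have := bit_det Hb2 Hb4].
  + by rewrite ((next_eqP H1 H2).1 Heq).
Qed.

Lemma same_term_step p r t : body_pos M kb p -> body_pos M kb r -> at_term p t -> at_term r t ->
  gaifman_step M kb p r.
Proof.
move=> Bp Br Hp Hr; split; first exact/inposP/(at_term_lt Hr).
right; right; do !split=> //.
  case: t Hp Hr => [v|b] => [/at_var|/at_cst] [_ H1] => [/at_var|/at_cst] [_ H2].
    exact/(next_eqP H1 H2).
  exact/(next_eqP H1 H2).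
case: t Hp Hr => [v|b] => [/at_var|/at_cst] [H1 _] => [/at_var|/at_cst] [H2 _].
  by left.
by right.
Qed.

Lemma body_pos_ends p r : role_ends M kb p r -> body_pos M kb p /\ body_pos M kb r.
Proof.
move=> H; have [P [t [u [_ /at_term_lt Hp /at_term_lt Hr]]]] := role_endsP H.
split; right; [exists r|exists p]; try lia.
  by left.
by right.
Qed.

Lemma chain_connected p r t n : chain (gaifman_step M kb) p n r -> at_term p t ->
  exists u, at_term r u /\ gaifman_connected q t u.
Proof.
move=> H Hp; elim: H => [|{}n r1 r2 _ [u [Hu tu]] H].
  by exists t; split=> //; exact: Relation_Operators.rt_refl.
have [u' [Hu' uu']] := gaifman_stepP H Hu.
by exists u'; split=> //; apply: Relation_Operators.rt_trans tu uu'.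
Qed.

(** Each edge takes two steps: from the occurrence reached so far to the occurrence of the same term
    in the role atom, then across this atom. *)
Lemma connected_chain p t u : gaifman_connected q t u -> body_pos M kb p -> at_term p t ->
  exists n r, [/\ chain (gaifman_step M kb) p n r, body_pos M kb r & at_term r u].
Proof.
move=> tu Bp Hp.
elim: (Operators_Properties.clos_rt_rtn1 _ _ _ _ tu) => {tu u} [|u1 u2 u12 _ [n [r [Hch Br Hr]]]].
  by exists 0, p; split=> //; exact: chain0.
have [p1 [r1 [Hpr [B1 B2] H1 H2]]] : exists p1 r1,
   [/\ gaifman_step M kb p1 r1, body_pos M kb p1 /\ body_pos M kb r1, at_term p1 u1 & at_term r1 u2].
  case: u12 => P [/role_ends_exists[p1 [r1 [H H1 H2]]]|/role_ends_exists[r1 [p1 [H H2 H1]]]];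
    exists p1, r1; have [B1 B2] := body_pos_ends H; split=> //; split; try exact/inposP/(at_term_lt H2).
    by left.
  by right; left.
exists n.+2, r1; split=> //; apply: chainS Hpr; apply: chainS Hch _.
exact: same_term_step Br B1 Hr H1.
Qed.

Lemma anchor_posP p t : at_term p t -> anchor_pos M kv p <-> anchor q t.
Proof.
have [W1 W2] := word_items Hv.
case: t => [v|b] => [/at_var|/at_cst] [Hbit Hp] /=; last first.
  by split=> // _; left.
split=> [[/(bit_det Hbit)//|[_ [y _ [/W1[A [HA HyA]] /(next_eqP Hp HyA) ->]]]] //|].
move=> /W2[y [yM Hl Hy]]; right; split=> //; exists y; first by lia.
by split=> //; apply/(next_eqP Hp Hy).
Qed.

Lemma rooted_satP : ev = [::] -> is_ccq q -> rooted_sat M kv kc kb <-> rooted q.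
Proof.
move=> ev0 q_ccq; have [W1 W2] := word_items Hc.
have RM a b : gaifman_step M kb a b -> inpos M b by case.
split=> [[H1 H2]|H].
  have body t : List.In t (body_terms q) -> exists2 u, gaifman_connected q t u & anchor q u.
    move=> /In_flatten_map[F HF HFt]; have [p [Bp Hp]] := body_pos_exists HF HFt.
    have pM := at_term_lt Hp.
    have [|r rN [Hr Ar]] := H1 p _ Bp; first by lia.
    have [n Hn'] := (@reachP M set_ok long gaifman_step kb p r rN ((inposP M p).2 pM) RM).1 Hr.
    have [u [Hu tu]] := chain_connected Hn' Hp.
    by exists u => //; apply/(anchor_posP Hu).
  move=> t [[v Hvq ->]|[F HF HFt]]; last first.
    by apply: body; apply/In_flatten_map; exists F.
  move: Hvq; rewrite /query_vars /= ev0 cat0s mem_cat => /orP[Hva|/W2[y [yM Hl Hy]]].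
    by exists (Var v) => //; exact: Relation_Operators.rt_refl.
  have [|p pN [/body_posP[F [t' [HF HFt Hp]]] [Hbit Heq]]] := H2 y _ Hl; first by lia.
  apply: body; apply/In_flatten_map; exists F => //.
  case: t' HFt Hp => [v'|b'] HFt => [/at_var|/at_cst] [Hbit' Hp].
    by rewrite -((next_eqP Hp Hy).1 Heq).
  by have := bit_det Hbit Hbit'.
split=> [p pN Bp|y yN /W1[A [HA Hy]]].
  have [F [t [HF HFt Hp]]] := body_posP Bp.
  have [|u tu Au] := H t; first by right; exists F.
  have [n [r [Hc' Br Hr]]] := connected_chain tu Bp Hp.
  have rM := at_term_lt Hr; have pM := at_term_lt Hp.
  have rN : r < sN M by lia.
  exists r => //; split; last exact/(anchor_posP Hr).
  apply/(@reachP M set_ok long gaifman_step kb p r rN ((inposP M p).2 pM) RM).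
  by exists n.
have /In_flatten_map[F HF HFv] := count_var_in_body (q := q) q_ccq H HA.
have [p [Bp Hp]] := body_pos_exists HF HFv.
have pM := at_term_lt Hp; exists p; first by lia.
have /at_var[Hbit Hp'] := Hp.
by split=> //; split=> //; apply/(next_eqP Hp' Hy).
Qed.

Lemma assertions_at :
  (forall x, litem passert M kx x ->
     exists F k, List.In F ab /\ seg (sw M) x.+1 (enc_assertion F) k) /\
  (forall F, List.In F ab ->
     exists x k, [/\ x < size (sw M), litem passert M kx x & seg (sw M) x.+1 (enc_assertion F) k]).
Proof. exact: (litem_all set_ok long (parses_assert set_ok long) proper_assert Hx). Qed.

Lemma assertion_indP x p : litem passert M kx x -> assertion_ind M x p ->
  exists b, b \in Ind ab /\ nm M p b.
Proof.
move=> /(proj1 assertions_at)[F [k [HF Hk]]] [_ _ [_ _ [p0 _ [-> [->]]]]].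
rewrite addn1 addn2.
have sub b : b \in assertion_inds F -> b \in Ind ab.
  by move=> /In_mem Hb'; apply/In_mem/In_flatten_map; exists F.
case: F HF Hk sub => [A b|P b c] HF /seg_cons[Hbit /seg_cat[l1 H1]].
  move=> H2 sub [/(pword_end set_ok long H1) -> [->|[/(bit_det Hbit)//]]].
  by exists b; split; [apply: sub; rewrite /= mem_head|exists k].
case/seg_cat=> l2 H2 H3 sub [/(pword_end set_ok long H1) -> [->|[_ /(pword_end set_ok long H2) ->]]].
  by exists b; split; [apply: sub; rewrite /= mem_head|exists l2].
by exists c; split; [apply: sub; rewrite !inE eqxx orbT|exists k].
Qed.

Lemma assertion_ind_exists b : b \in Ind ab -> exists x p,
  [/\ x < sN M, litem passert M kx x, assertion_ind M x p & nm M p b].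
Proof.
move=> /In_mem/In_flatten_map[F /(proj2 assertions_at)[x [k [xM Hl Hk]]] Hin].
have build p p0 A : seg (sw M) x.+2 (enc_word A) p0 ->
    (p = p0 \/ (bit true M x.+1 /\ pword M p0 p)) -> assertion_ind M x p.
  move=> Hp0 Hor; exists x.+1; first by lia.
  exists x.+2; first by lia.
  exists p0; first exact: word_lt Hp0.
  by rewrite addn1 addn2; do !split=> //; apply/(parses_word set_ok long); exists A.
case: F Hk Hin => [A c|P c d] /seg_cons[Hbit /seg_cat[l1 H1]].
  move=> H2 [<-|[]]; exists x, l1; split=> //; [by lia| |by exists k].
  by apply: build H1 _; left.
case/seg_cat=> l2 H2 H3 /= [<-|[<-|[]]].
  exists x, l1; split=> //; [by lia| |by exists l2].
  by apply: build H1 _; left.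
exists x, l2; split=> //; [by lia| |by exists k].
by apply: build H1 _; right; split=> //; apply/(parses_word set_ok long); exists c.
Qed.

Definition canonical_digits : Prop := dg = [::] \/ last false dg.

Lemma validP : valid M kx kv ke kc kb ka kn kz <->
  [/\ exhaustive q, rooted q, is_ccq q, size an = size av & {subset an <= Ind ab}] /\
  canonical_digits.
Proof.
have [V1 V2] := word_items Hv; have [C1 C2] := word_items Hc; have [A1 A2] := word_items Ha.
have E1 : bit false M ke <-> ev = [::].
  split=> [H|E0]; last by move: He; rewrite E0 => /seg_cons[].
  by case: (ev) He => // x s /seg_cons[/(bit_det H)].
have E2 : (all x of M, all y of M, (litem pword M kv x -> litem pword M kc y -> ~ next_eq M x y))
    <-> disjoint_seqs av cv.
  split=> [H|/hasP H x xN y yN /V1[A [HA Hx']] /C1[B [HB Hy]] /(next_eqP Hx' Hy) E].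
    apply/hasP => -[A /C2[y [yM Hy HyA]] /V2[x [xM Hx' HxA]]].
    by apply: (H x _ y _ Hx' Hy); [lia|lia|exact/(next_eqP HxA HyA)].
  by apply: H; exists B => //; rewrite -E.
have E3 : (all p of M, (body_pos M kb p -> bit false M p ->
     some y of M, ((litem pword M kv y \/ litem pword M kc y) /\ next_eq M p y)))
    <-> forall F v, List.In F bd -> List.In (Var v) (atom_terms F) -> v \in av ++ cv.
  split=> [H F v HF HFv|H p pN /body_posP[F [t [HF HFt Hp]]] Hbit].
    have [p [Bp Hp]] := body_pos_exists HF HFv.
    have /at_var[Hbit Hp'] := Hp; have pM := at_term_lt Hp.
    have [|y yN [[/V1[A [HA Hy]]|/C1[A [HA Hy]]] /(next_eqP Hp' Hy) ->]] := H p _ Bp Hbit.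
    + by lia.
    + by rewrite mem_cat HA.
    + by rewrite mem_cat HA orbT.
  case: t HFt Hp => [v|b] HFt => [/at_var|/at_cst] [Hbit' Hp]; last by have := bit_det Hbit Hbit'.
  have := H F v HF HFt; rewrite mem_cat => /orP[/V2|/C2] [y [yM Hy HyA]];
    exists y; try lia; split; try exact/(next_eqP Hp HyA).
    by left.
  by right.
have E4 : (some x of M, some y of M, some i of M,
     (tcnt M kv x i /\ bit false M x /\ tcnt M ka y i /\ bit false M y)) <-> size an = size av.
  split=> [[x xN [y yN [i iN [H1 [H2 [H3 H4]]]]]]|E].
    have /= <- := word_at set_ok long step_ok Ha iN yN H3 H4.
    by have /= <- := word_at set_ok long step_ok Hv iN xN H1 H2.
  have [x [xN iN H1]] := word_exists set_ok long step_ok Hv (leqnn (size av)).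
  rewrite ltnn => H2.
  have [y [yN _ H3]] := word_exists set_ok long step_ok Ha (leqnn (size an)).
  rewrite ltnn => H4; exists x => //; exists y => //; exists (size av) => //.
  by rewrite -{2}E.
have E5 : (all y of M, (litem pword M ka y -> some x of M, some p of M, some y1 of M,
     (litem passert M kx x /\ assertion_ind M x p /\ y1 = y + 1 /\ name_eq M p y1)))
     <-> {subset an <= Ind ab}.
  split=> [H A /A2[y [yM Hy HyA]]|H y yN /A1[A [/H/assertion_ind_exists[x [p [xN Hl Hp HpA]]] HyA]]].
    have [|x xN [p pN [_ _ [Hl [Hp [-> ]]]]]] := H y _ Hy; first by lia.
    rewrite addn1 => /(name_eqP set_ok long)[B [HpB HyB]].
    have [b [Hb' Hpb]] := assertion_indP Hl Hp.
    by rewrite (nm_det HyA HyB) -(nm_det Hpb HpB).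
  have pM := nm_lt HpA; have yM := nm_lt HyA.
  exists x => //; exists p; first by lia.
  exists y.+1; first by lia.
  by rewrite addn1; do !split=> //; apply/(name_eqP set_ok long); exists A.
have E7 : (bit false M kn \/ some l of M, (kz = l + 2 /\ bit true M l)) <-> canonical_digits.
  rewrite /canonical_digits; case/lastP: dg Hn => [|d b] Hn'.
    by split=> _; left=> //; move: Hn' => /seg_cons[].
  have Hr : last false (rcons d b) = b by rewrite last_rcons.
  rewrite Hr; move: Hn'; rewrite -cats1 /enc_word /enc_list -/(items _ _) items_cat -catA.
  move=> /seg_cat[l Hl /seg_cons[Hb0 /seg_cons[Hb1 /seg_cons[_ /seg_nil Ez]]]].
  have lM := bit_lt Hb1; split.
    case=> [Hf|[l' _ [El Hl']]]; last first.
      have El' : l' = l.+1 by lia.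
      by right; rewrite El' in Hl'; rewrite (bit_det Hb1 Hl').
    case: d Hl {Hr} => [/seg_nil El|c d /seg_cons[Ht' _]]; last by have := bit_det Hf Ht'.
    by rewrite El in Hb0; have := bit_det Hf Hb0.
  case=> [E|Hb']; first by case: (d) E.
  right; exists l.+1; first by lia.
  by move: Hb1; rewrite Hb' => Hb1; split=> //; lia.
rewrite /valid E1 E2 E3 E4 E5 E7; split.
  case=> H1 [H2 [H3 [H4 [H5 [H6 H7]]]]]; split=> //.
  have q_ccq : is_ccq q.
    split=> //=; rewrite ?H1 //; first by rewrite /disjoint_seqs; apply/hasPn.
    by rewrite /query_vars /= H1.
  by split=> //; apply/rooted_satP.
case=> -[H1 H2 H3 H4 H5] H7; do !split=> //.
- by case: H3.
- have ev0 : ev = [::] by exact: H1.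
  by case: H3 => _ _ _; rewrite /query_vars /= ev0.
- by case: ((rooted_satP H1 H3).2 H2).
- by case: ((rooted_satP H1 H3).2 H2).
Qed.

(** * A countermodel from the relations *)

Definition word_value (d : seq bool) : nat := foldr (fun (b : bool) u => b + (u + u)) 0 d.

Lemma tvalP i v d : value_axiom M -> i < sN M -> v < sN M -> (exists j, seg (sw M) i (enc_word d) j) ->
  tval M i v -> v = word_value d.
Proof.
move=> val_ok; elim: d i v => [|b d IH] i v iN vN [j Hj] /(val_ok i iN v vN).
  move: Hj => /seg_cons[Hbit _]; by case=> [[_ ->]|[/(bit_det Hbit)]].
move: Hj => /seg_cons[Hbit /seg_cons[Hbit' Hd]].
case=> [[/(bit_det Hbit)//]|[_ [i1 _ [i2 i2N [u uN [Ei1 [Ei2 [Hu]]]]]]]].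
have {}Hu : u = word_value d by apply: IH i2N uN _ Hu; exists j; rewrite Ei2 addn2.
have {}Ei1 : i1 = i.+1 by lia.
subst i1 u => /=.
by case=> [[/(bit_det Hbit') ->]|[/(bit_det Hbit') ->]] /=; lia.
Qed.

(** Every position from which a word can be decoded contributes at most one name, whatever its role
    in the instance; so the list includes all names of the instance and is no longer than the
    input. *)
Lemma located_names : exists ns : seq (seq bool),
  [/\ uniq ns, size ns <= size (sw M) & forall A, A \in ns <-> exists p, nm M p A].
Proof.
suff H k : exists ns : seq (seq bool), size ns <= k /\
    forall A, A \in ns <-> exists2 p, p < k & nm M p A.
  have [ns [Hs Hns]] := H (size (sw M)); exists (undup ns); split.
  - exact: undup_uniq.
  - exact: leq_trans (size_undup _) Hs.
  - move=> A; rewrite mem_undup Hns; split=> [[p _ HA]|[p HA]]; first by exists p.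
    by exists p => //; exact: nm_lt HA.
elim: k => [|k [ns [Hs Hns]]]; first by exists [::]; split=> // A; split=> // -[].
have [[A HA]|HA] := pselect (exists A, nm M k A).
  exists (A :: ns); split=> // B; rewrite inE; split.
    case/orP=> [/eqP ->|/Hns[p pk HB]]; first by exists k.
    by exists p => //; lia.
  case=> p; rewrite ltnS leq_eqVlt => /orP[/eqP ->|pk] HB.
    by rewrite (nm_det HA HB) eqxx.
  by apply/orP; right; apply/Hns; exists p.
exists ns; split; first by lia.
move=> B; rewrite Hns; split=> [[p pk HB]|[p]]; first by exists p => //; lia.
rewrite ltnS leq_eqVlt => /orP[/eqP ->|pk] HB; last by exists p.
by case: HA; exists B.
Qed.

Lemma incl_located p F j A : seg (sw M) p (enc_inclusion F) j -> A \in incl_names F ->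
  exists p', nm M p' A.
Proof.
have con B i k : seg (sw M) i (enc_basic_concept B) k -> exists p', nm M p' (concept_name_of B).
  case: B => [B|[P|P]] /seg_cons[_]; first by exists i.+1, k.
    by case/seg_cons=> _; exists i.+2, k.
  by case/seg_cons=> _; exists i.+2, k.
have rol S i k : seg (sw M) i (enc_role S) k -> exists p', nm M p' (role_name_of S).
  by case: S => P /seg_cons[_]; exists i.+1, k.
by case: F => B1 B2 /seg_cons[_ /seg_cons[_ /seg_cat[k H1 H2]]];
  rewrite !inE => /orP[] /eqP ->; [apply: con H1|apply: con H2|apply: con H1|apply: con H2|
    apply: rol H1|apply: rol H2|apply: rol H1|apply: rol H2].
Qed.

Lemma assertion_located p F j A : seg (sw M) p (enc_assertion F) j -> A \in assertion_names F ->
  exists p', nm M p' A.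
Proof.
case: F => [B b|P b c] /seg_cons[_ /seg_cat[k H1]].
  by move=> H2; rewrite !inE => /orP[] /eqP ->; [exists p.+1, k|exists k, j].
case/seg_cat=> l H2 H3; rewrite !inE => /or3P[] /eqP ->; [exists p.+1, k|exists k, l|exists l, j]; done.
Qed.

Lemma atom_located p F j A : seg (sw M) p (enc_atom F) j -> A \in atom_names F ->
  exists p', nm M p' A.
Proof.
have ter t i k : seg (sw M) i (enc_term t) k -> exists p', nm M p' (term_name t).
  by case: t => v /seg_cons[_]; exists i.+1, k.
case: F => [B b|P b c] /seg_cons[_ /seg_cat[k H1]].
  by move=> H2; rewrite !inE => /orP[] /eqP ->; [exists p.+1, k|exact: ter H2].
by case/seg_cat=> l H2 H3; rewrite !inE => /or3P[] /eqP ->; [exists p.+1, k|exact: ter H2|exact: ter H3].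
Qed.

Lemma tbox_located F A : List.In F tb -> A \in incl_names F -> exists p, nm M p A.
Proof.
have [_ H] := litem_all set_ok long (parses_incl set_ok long) proper_incl Ht.
by move=> /H[x [k [_ _ Hk]]]; exact: incl_located Hk.
Qed.

Lemma abox_located F A : List.In F ab -> A \in assertion_names F -> exists p, nm M p A.
Proof. by move=> /(proj2 assertions_at)[x [k [_ _ Hk]]]; exact: assertion_located Hk. Qed.

Lemma body_located F A : List.In F bd -> A \in atom_names F -> exists p, nm M p A.
Proof. by move=> /(proj2 atoms_at)[x [k [_ _ Hk]]]; exact: atom_located Hk. Qed.

Lemma answer_located A : A \in an -> exists p, nm M p A.
Proof. by move=> /(proj2 (word_items Ha))[y [_ _ Hy]]; exists y.+1. Qed.

Section Matches.
Variables (D : Type) (g : D -> nat) (C : concept_name -> D -> Prop).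
Variables (R : role_name -> D -> D -> Prop) (f : individual -> D) (ns : seq individual).
Hypothesis f_inj : {in ns &, injective f}.
Hypothesis rep : represents_int M g C R f ns.
Hypothesis size_an : size an = size av.

Let J := struct_int C R f_inj.

Lemma model_satP : items_sat pincl incl_sat M kt /\ items_sat passert assert_sat M kx <->
  model J (KB tb ab).
Proof.
have HI p F l : seg (sw M) p (enc_inclusion F) l -> incl_sat M p <-> sat_inclusion J F.
  by move=> HF; exact: (incl_satP set_ok long f_inj rep HF).
have HA p F l : seg (sw M) p (enc_assertion F) l -> assert_sat M p <-> sat_assertion J F.
  by move=> HF; exact: (assert_satP set_ok long f_inj rep HF).
rewrite (items_satP set_ok long (parses_incl set_ok long) proper_incl Ht HI).
by rewrite (items_satP set_ok long (parses_assert set_ok long) proper_assert Hx HA).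
Qed.

Lemma match_satP t (sg : variable -> domain J) : represents_asg M g t sg ->
  match_sat M t kv kb ka <-> is_match q sg /\ map sg av = map (ind_int J) an.
Proof.
move=> rep_t; have -> : match_sat M t kv kb ka <->
    items_sat patom (fun M => atom_sat M t) M kb /\ answer_sat M t kv ka by [].
have HA p F l : seg (sw M) p (enc_atom F) l -> atom_sat M t p <-> sat_atom sg F.
  by move=> HF; exact: (atom_satP set_ok long rep rep_t HF).
rewrite (items_satP set_ok long (parses_atom set_ok long) (S := fun M => atom_sat M t) proper_atom Hb HA).
suff -> : answer_sat M t kv ka <-> map sg av = map (ind_int J) an by [].
split=> [H|H x xN y yN i iN Hxi Hxb Hyi Hyb].
  apply: (@eq_from_nth _ (inr [::])); rewrite ?size_map // => i Hi.
  rewrite !(nth_map [::]) ?size_an //.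
  have [x [xN iN Hxi]] := word_exists set_ok long step_ok Hv (ltnW Hi); rewrite Hi => Hxb.
  have Hi' : i < size an by rewrite size_an.
  have [y [yN _ Hyi]] := word_exists set_ok long step_ok Ha (ltnW Hi'); rewrite Hi' => Hyb.
  have [_ Hx'] := word_at set_ok long step_ok Hv iN xN Hxi Hxb.
  have [_ Hy'] := word_at set_ok long step_ok Ha iN yN Hyi Hyb.
  have [p _ [r _ [d dN [-> [-> []]]]]] := H x xN y yN i iN Hxi Hxb Hyi Hyb.
  rewrite !addn1 => /(rep_t _ _ _ dN Hx')[z [-> ->]] /(rep_ind rep (rep_lt rep z) Hy') /(rep_inj rep) ->.
  by rewrite (ind_ext f_inj rep Hy').
have [Hi Hx'] := word_at set_ok long step_ok Hv iN xN Hxi Hxb.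
have [_ Hy'] := word_at set_ok long step_ok Ha iN yN Hyi Hyb.
have := congr1 (fun s => nth (inr [::]) s i) H; rewrite /= !(nth_map [::]) ?size_an //.
rewrite -[struct_ind _ _ _]/(ind_int J _) (ind_ext f_inj rep Hy') => E.
have xM := nm_lt Hx'; have yM := nm_lt Hy'.
exists x.+1; first by lia.
exists y.+1; first by lia.
exists (g (f (nth [::] an i))); first exact: (rep_lt rep).
rewrite !addn1; do !split=> //; last exact: (tind_f rep Hy').
by apply/(rep_t _ _ _ (rep_lt rep _) Hx'); exists (f (nth [::] an i)).
Qed.

Lemma match_inl (sg : variable -> domain J) v : is_match q sg -> List.In (Var v) (body_terms q) ->
  exists x, sg v = inl x.
Proof.
move=> Hm /In_flatten_map[F HF Hvt]; move: (Hm F HF).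
case: F {HF} Hvt => [A t|P t u] /= Htv.
  by case: Htv => [->|[]] /=; case: (sg v) => // x _; exists x.
case: Htv => [->|[->|[]]] /=; first by case: (sg v) => // x _; exists x.
by case: (term_val sg t) => // y; case: (sg v) => // x _; exists x.
Qed.

Lemma count_var_inl (sg : variable -> domain J) v : is_ccq q -> rooted q -> is_match q sg ->
  v \in cv -> exists x, sg v = inl x.
Proof.
by move=> q_ccq q_rooted Hm Hvc; apply: match_inl Hm _; exact: (count_var_in_body (q := q)).
Qed.

End Matches.

Lemma is_match_ext (I : interpretation) (s1 s2 : variable -> domain I) : is_ccq q ->
  {in query_vars q, s1 =1 s2} -> is_match q s1 -> is_match q s2.
Proof.
case=> _ _ _ Hvars H12 Hm F HF; have Hterm t : List.In t (atom_terms F) -> term_val s1 t = term_val s2 t.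
  by case: t => [v|b] // HFt /=; apply: H12; apply: Hvars HF HFt.
have := Hm F HF; case: F HF Hterm => [A t|P t u] HF Hterm /=.
  by have -> : term_val s1 t = term_val s2 t by apply: Hterm; left.
have -> : term_val s1 t = term_val s2 t by apply: Hterm; left.
by have -> : term_val s1 u = term_val s2 u by apply: Hterm; right; left.
Qed.

(** The elements marked by [dom] form a model. If it had [m] distinct counting matches, each would
    be coded by an assignment with one of [m - 1] labels, and two of them with the same label would
    coincide. *)
Lemma countermodel_sound m : countermodel M kt kx kv kc kb ka kn ->
  word_value dg = m -> exhaustive q -> rooted q -> is_ccq q -> size an = size av ->
  ~ certain_answer (KB tb ab) q an m.
Proof.
move=> [[[d0 d0N Hd0] [S1 [S2 [S3 S4]]]] [[T1 [T2 T4]] [V [HT [HA few]]]]] dgm q_exh q_rooted q_ccq size_an.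
have [ns [_ _ ns_loc]] := located_names.
pose D := {d : nat | d < sN M /\ dom M d}.
pose g (x : D) := sval x.
have gN x : g x < sN M by case: (svalP x).
have gdom x : dom M (g x) by case: (svalP x).
have pN p A : nm M p A -> p < sN M by move=> /nm_lt; lia.
have same p r A : nm M p A -> nm M r A -> name_eq M p r.
  by move=> H1 H2; apply/(name_eqP set_ok long); exists A.
have nam p A : nm M p A -> named M p by move=> H; apply/(namedP set_ok long); exists A.
have [f Hf] : exists f : individual -> D, forall b p, nm M p b -> tind M p (g (f b)).
  suff /choice[f Hf] : forall b, exists x : D, forall p, nm M p b -> tind M p (g x) by exists f.
  move=> b; have [[p Hp]|Hnp] := pselect (exists p, nm M p b); last first.
    by exists (exist _ d0 (conj d0N Hd0)) => p Hp; case: Hnp; exists p.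
  have [d dN [Hd Hpd]] := S1 p (pN _ _ Hp) (nam _ _ Hp).
  exists (exist _ d (conj dN Hd)) => r Hr.
  have [e eN [He' Hre]] := S1 r (pN _ _ Hr) (nam _ _ Hr).
  have E := (S2 r (pN _ _ Hr) p (pN _ _ Hp) e eN d dN Hre Hpd).2 (same _ _ _ Hr Hp).
  by rewrite /g /= -E.
have g_inj : injective g.
  by case=> x Px [y Py] /= E; subst y; congr exist; exact: Prop_irrelevance.
have f_inj : {in ns &, injective f}.
  move=> b c /ns_loc[p Hp] /ns_loc[r Hr] E.
  have H1 := Hf b p Hp; have H2 := Hf c r Hr; rewrite -E in H2.
  have [+ _] := S2 p (pN _ _ Hp) r (pN _ _ Hr) _ (gN _) _ (gN _) H1 H2.
  case/(_ erefl)/(name_eqP set_ok long) => A [HpA HrA].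
  by rewrite (nm_det Hp HpA) (nm_det Hr HrA).
pose C A x := exists p, nm M p A /\ tcon M p (g x).
pose R P x y := exists p, nm M p P /\ trol M p (g x) (g y).
have rep : represents_int M g C R f ns.
  split=> //.
  - move=> d dN; split=> [Hd|[x ->] //].
    by exists (exist _ d (conj dN Hd)).
  - move=> p b d dN Hp; split=> [Hd|->]; last exact: Hf.
    by apply/(S2 p (pN _ _ Hp) p (pN _ _ Hp) d dN _ (gN _) Hd (Hf _ _ Hp))/(same _ _ _ Hp Hp).
  - move=> p A x Hp; split=> [H|[r [Hr H]]]; first by exists p.
    exact: (S3 r (pN _ _ Hr) p (pN _ _ Hp) _ (gN x) (same _ _ _ Hr Hp) H).
  - move=> p P x y Hp; split=> [H|[r [Hr H]]]; first by exists p.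
    exact: (S4 r (pN _ _ Hr) p (pN _ _ Hp) _ (gN x) _ (gN y) (same _ _ _ Hr Hp) H).
pose J := struct_int C R f_inj.
have Jmodel : model J (KB tb ab) by apply/(model_satP f_inj rep).
move=> /(_ J Jmodel)[F [F_inj HF]].
(* An assignment is reached from the one coded by 0 by finitely many updates, one for each name of
   the input. *)
have asg_exists (sg : variable -> domain J) : (forall A, A \in ns -> exists x, sg A = inl x) ->
    some t of M, represents_asg M g t sg.
  move=> Hsg; suff K (l : seq variable) : {subset l <= ns} -> some t of M,
      exists2 sg0, represents_asg M g t sg0 & {in l, sg0 =1 sg}.
    have [t tN [sg0 H0 E0]] := K ns (fun _ => id); exists t => // p A d dN Hp.
    by rewrite -E0; [exact: H0|apply/ns_loc; exists p].
  elim: l => [_|A l IH sub].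
    exists 0; first by lia.
    have /choice[sg0 H0] : forall A, exists y : domain J, forall p, nm M p A ->
        exists2 x, y = inl x & tasg M 0 p (g x).
      move=> A; have [[p Hp]|Hnp] := pselect (exists p, nm M p A); last first.
        by exists (inr [::]) => p Hp; case: Hnp; exists p.
      have N0 : 0 < sN M by lia.
      have [d dN [Hd Hpd]] := T1 0 N0 p (pN _ _ Hp) (nam _ _ Hp).
      exists (inl (exist _ d (conj dN Hd))) => r Hr.
      have [e eN [He' Hre]] := T1 0 N0 r (pN _ _ Hr) (nam _ _ Hr).
      have E := T2 0 N0 r (pN _ _ Hr) p (pN _ _ Hp) e eN d dN Hre Hpd (same _ _ _ Hr Hp).
      by exists (exist _ d (conj dN Hd)) => //; rewrite /g /= -E.
    exists sg0 => // p A d dN Hp; have [x Ex Hx'] := H0 A p Hp; rewrite Ex; split=> [Hd|[y [[<-] ->]] //].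
    exists x; split=> //.
    have N0 : 0 < sN M by lia.
    exact: (T2 0 N0 p (pN _ _ Hp) p (pN _ _ Hp) d dN _ (gN x) Hd Hx' (same _ _ _ Hp Hp)).
  have [|t tN [sg0 H0 E0]] := IH; first by move=> B HB; apply: sub; rewrite inE HB orbT.
  have HA' : A \in ns by apply: sub; rewrite mem_head.
  have [p Hp] := (ns_loc A).1 HA'; have [x Ex] := Hsg A HA'.
  have [u uN Hu] := T4 t tN p (pN _ _ Hp) (g x) (gN x) (nam _ _ Hp) (gdom x).
  exists u => //; exists (fun v => if v == A then inl x else sg0 v); last first.
    move=> B; rewrite inE; case: eqP => [-> _|_ /E0 //].
    by rewrite Ex.
  move=> r B d dN Hr; rewrite (Hu r (pN _ _ Hr) d dN (nam _ _ Hr)).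
  case: (eqVneq B A) => [E|ne].
    subst B; split=> [[[_ ->]|[H _]]|[y [[<-] ->]]]; [by exists x|by case: H; exact: same Hp Hr|].
    by left; split=> //; exact: same Hp Hr.
  have Hne : ~ name_eq M p r.
    move=> /(name_eqP set_ok long)[B' [H1 H2]]; case/eqP: ne.
    by rewrite (nm_det Hr H2) (nm_det Hp H1).
  rewrite -(H0 r B d dN Hr); split=> [[[/Hne]|[_]]|H] //.
  by right.
have an_ns b : b \in an -> b \in ns by move=> /answer_located/ns_loc.
have asg i : exists t (sg : variable -> domain J), [/\ t < sN M, represents_asg M g t sg,
    match_sat M t kv kb ka, F i = map sg cv & forall v, v \in cv -> exists x, sg v = inl x].
  have [sg [Hm Hans EF]] := HF i.
  (* Outside the query [sg] may take isolated elements as values, which the tables cannot describe;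
     these values are replaced by individuals. *)
  pose sg' v := if v \in query_vars q then sg v else ind_int J v.
  have sgE : {in query_vars q, sg =1 sg'} by move=> v Hvq; rewrite /sg' Hvq.
  have Hm' := is_match_ext q_ccq sgE Hm.
  have sg_inl A : A \in ns -> exists x, sg' A = inl x.
    move=> HA'; rewrite /sg'; case: ifP => [|_].
      have ev0 : ev = [::] by exact: q_exh.
      rewrite /query_vars /= ev0 mem_cat => /orP[HAv|HAc]; last first.
        exact: (count_var_inl q_ccq q_rooted Hm HAc).
      have : sg A \in (map sg (answer_vars q) : seq {classic (domain J)}) by apply: map_f.
      rewrite Hans => /mapP[b /an_ns Hb' ->].
      by rewrite /= /struct_ind Hb'; exists (f b).
    by rewrite /= /struct_ind HA'; exists (f A).
  have [t tN Ht'] := asg_exists sg' sg_inl.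
  exists t, sg'; split=> //.
  - apply/(match_satP rep size_an Ht'); split=> //.
    have Hans' : map sg av = map (ind_int J) an := Hans.
    rewrite -Hans'; apply/eq_in_map => v Hv'; rewrite -sgE //.
    by rewrite /query_vars mem_cat Hv'.
  - rewrite EF; apply/eq_in_map => v Hv'; rewrite -sgE //.
    by rewrite /query_vars !mem_cat Hv' !orbT.
  - by move=> v Hv'; apply: count_var_inl q_ccq q_rooted Hm' Hv'.
have [v vN [Hval [v0 [few1 few2]]]] := few.
have knN : kn < sN M by have [_] := seg_le Ha ((proper_list proper_word).2 an); lia.
have Hdg : exists j, seg (sw M) kn (enc_word dg) j by exists kz.
have Ev : v = m by rewrite -dgm; exact: (tvalP V knN vN Hdg Hval).
subst v.
have /choice[lab Hlab] : forall i : 'I_m, exists l : 'I_m.-1, exists t (sg : variable -> domain J),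
   [/\ t < sN M /\ represents_asg M g t sg, match_sat M t kv kb ka, F i = map sg cv,
    forall v, v \in cv -> exists x, sg v = inl x & tlab M t l].
  move=> i; have [t [sg [tN Hrep Hmt EF Hinl]]] := asg i.
  have [j jN [Hj [_ _ [-> jm]]]] := few1 t tN Hmt.
  have jm' : j < m.-1 by lia.
  by exists (Ordinal jm'), t, sg.
have lab_inj : injective lab.
  move=> i i' E; apply: F_inj.
  have [t [sg [[tN Hrep] Hmt EF Hinl Hl]]] := Hlab i.
  have [t' [sg' [[tN' Hrep'] Hmt' EF' Hinl' Hl']]] := Hlab i'.
  rewrite EF EF'; apply/eq_in_map => A HAc.
  have [y [yM Hly Hy]] := (word_items Hc).2 A HAc.
  have [x Ex] := Hinl A HAc.
  have labN : lab i < sN M by have := ltn_ord (lab i); lia.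
  have yN : y < sN M by lia.
  have Hyy : y.+1 = y + 1 by rewrite addn1.
  rewrite -E in Hl'.
  have Hx' : tasg M t y.+1 (g x) by apply/(Hrep _ _ _ (gN x) Hy); exists x.
  have := few2 t tN t' tN' (lab i) labN Hmt Hmt' Hl Hl' y yN y.+1 (pN _ _ Hy) (g x) (gN x) Hly Hyy Hx'.
  by case/(Hrep' _ _ _ (gN x) Hy) => x' [-> /g_inj <-].
by have := leq_card lab lab_inj; rewrite !card_ord; lia.
Qed.

(** * Relations from a countermodel *)

Section Complete.
Variables (D : finType) (C : concept_name -> D -> Prop) (R : role_name -> D -> D -> Prop).
Variables (f : individual -> D) (ns : seq individual).
Hypothesis f_inj : {in ns &, injective f}.
Let J := struct_int C R f_inj.
Hypothesis ns_loc : forall A, A \in ns <-> exists p, nm M p A.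

Definition number (x : D) : nat := enum_rank x.

Definition choice_of (s : {ffun 'I_(size ns) -> D}) (A : variable) : D + individual :=
  if insub (index A ns) is Some i then inl (s i) else inr A.

(** Numbers beyond the enumeration code a constant assignment, so that every element of the
    structure codes some assignment, as [assignment_axiom] requires. *)
Definition coded_asg (t : nat) : variable -> D + individual :=
  choice_of (nth [ffun => f [::]] (enum {ffun 'I_(size ns) -> D}) t).

Variables (m : nat) (cs : seq (seq (D + individual))).
Hypotheses (few_cs : size cs < m) (cs_all : forall c, c_match (I := J) q an c <-> List.In c cs).
Hypotheses (D_small : #|D| <= sN M) (asg_small : #|{ffun 'I_(size ns) -> D}| <= sN M).
Hypotheses (dg_m : word_value dg = m) (m_small : m < sN M).
Hypotheses (J_model_K : model J (KB tb ab)) (size_an : size an = size av).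

Record coded_tables : Prop := CodedTables {
  coded_dom : forall d, dom M d <-> exists x, d = number x;
  coded_ind : forall p d, tind M p d <-> exists b, nm M p b /\ d = number (f b);
  coded_con : forall p d, tcon M p d <-> exists A x, [/\ nm M p A, d = number x & C A x];
  coded_rol : forall p d e, trol M p d e <->
    exists P x y, [/\ nm M p P, d = number x, e = number y & R P x y];
  coded_tasg : forall t p d, tasg M t p d <->
    exists A x, [/\ nm M p A, coded_asg t A = inl x & d = number x];
  coded_val : forall i v, tval M i v <-> exists d, v = word_value d /\ exists j, seg (sw M) i (enc_word d) j;
  coded_lab : forall t j, tlab M t j <-> onth cs j = Some (map (coded_asg t) cv)
}.

Hypothesis coded : coded_tables.

Lemma number_lt x : number x < sN M.
Proof. exact: leq_trans (ltn_ord _) D_small. Qed.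

Lemma number_inj : injective number.
Proof. by move=> x y /ord_inj/enum_rank_inj. Qed.

Lemma coded_rep : represents_int M number C R f ns.
Proof.
split.
- exact: number_lt.
- exact: number_inj.
- by move=> d _; exact: coded_dom.
- exact: ns_loc.
- move=> p b d _ Hp; rewrite (coded_ind coded); split=> [[c [Hpc ->]]|->]; last by exists b.
  by rewrite (nm_det Hp Hpc).
- move=> p A x Hp; rewrite (coded_con coded); split=> [[B [y [Hb' /number_inj -> H]]]|H].
    by rewrite (nm_det Hp Hb').
  by exists A, x.
- move=> p P x y Hp; rewrite (coded_rol coded).
  split=> [[B [x' [y' [Hb' /number_inj -> /number_inj -> H]]]]|H].
    by rewrite (nm_det Hp Hb').
  by exists P, x, y.
Qed.

Lemma coded_asg_rep t : represents_asg M number t (coded_asg t : variable -> domain J).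
Proof.
move=> p A d dN Hp; rewrite (coded_tasg coded).
split=> [[B [x [HB Hx' ->]]]|[x [Hx' ->]]]; last by exists A, x.
by exists x; rewrite (nm_det Hp HB).
Qed.

Lemma choice_of_inl s A : A \in ns -> exists x, choice_of s A = inl x.
Proof.
rewrite -index_mem => H; rewrite /choice_of insubT; by eexists.
Qed.

Lemma onth_In (T : Type) (s : seq T) x : List.In x s -> exists2 j, j < size s & onth s j = Some x.
Proof.
elim: s => //= y s IH [->|/IH[j Hj Ej]]; first by exists 0.
by exists j.+1.
Qed.

(** The label of a match is the index of its counting match in [cs], a list with fewer than [m]
    entries. Updates of assignments are again coded because all functions from the names to [D] are
    enumerated. *)
Lemma countermodel_complete : countermodel M kt kx kv kc kb ka kn.
Proof.
have pN p A : nm M p A -> p < sN M by move=> /nm_lt; lia.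
have eqP' p r : name_eq M p r <-> exists A, nm M p A /\ nm M r A.
  exact: (name_eqP set_ok long).
have rep := coded_rep.
split.
  split.
    exists (number (f [::])); first exact: number_lt.
    by apply/(coded_dom coded); exists (f [::]).
  split.
    move=> p _ /(namedP set_ok long)[A HpA]; exists (number (f A)); first exact: number_lt.
    split; first by apply/(coded_dom coded); exists (f A).
    by apply/(coded_ind coded); exists A.
  split.
    move=> p _ r _ d _ e _ /(coded_ind coded)[b [Hpb ->]] /(coded_ind coded)[c [Hrc ->]].
    rewrite eqP'; split=> [/number_inj E|[A [H1 H2]]].
      have bns : b \in ns by apply/ns_loc; exists p.
      have cns : c \in ns by apply/ns_loc; exists r.
      by exists b; split=> //; rewrite (f_inj bns cns E).
    by rewrite (nm_det Hpb H1) (nm_det Hrc H2).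
  split.
    move=> p _ r _ d _ /eqP'[A [H1 H2]] /(coded_con coded)[B [x [HB -> HC]]].
    by apply/(coded_con coded); exists A, x; split=> //; rewrite (nm_det H1 HB).
  move=> p _ r _ d _ e _ /eqP'[A [H1 H2]] /(coded_rol coded)[B [x [y [HB -> -> HR]]]].
  by apply/(coded_rol coded); exists A, x, y; split=> //; rewrite (nm_det H1 HB).
split.
  split.
    move=> t _ p _ /(namedP set_ok long)[A HpA].
    have [|x Ex] := choice_of_inl (nth [ffun => f [::]] (enum {ffun 'I_(size ns) -> D}) t) (A := A).
      by apply/ns_loc; exists p.
    exists (number x); first exact: number_lt.
    split; first by apply/(coded_dom coded); exists x.
    by apply/(coded_tasg coded); exists A, x.
  split.
    move=> t _ p _ r _ d _ e _ /(coded_tasg coded)[A [x [HA Ex ->]]] /(coded_tasg coded)[B [y [HB Ey ->]]].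
    case/eqP' => N' [H1 H2]; move: Ex Ey.
    by rewrite (nm_det HA H1) (nm_det HB H2) => -> [->].
  move=> t _ p _ d _ /(namedP set_ok long)[A HpA] /(coded_dom coded)[x ->].
  set s := nth [ffun => f [::]] (enum {ffun 'I_(size ns) -> D}) t.
  pose s' := [ffun i : 'I_(size ns) => if val i == index A ns then x else s i].
  have Au : A \in ns by apply/ns_loc; exists p.
  exists (enum_rank s').
    exact: leq_trans (ltn_ord _) asg_small.
  have Es' : nth [ffun => f [::]] (enum {ffun 'I_(size ns) -> D}) (enum_rank s') = s'.
    exact: nth_enum_rank.
  have choice_s' B : B \in ns -> choice_of s' B = if B == A then inl x else choice_of s B.
    move=> Bns; have Hi : index B ns < size ns by rewrite index_mem.
    rewrite /choice_of !insubT /= ffunE /=.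
    case: (eqVneq B A) => [EBA|ne]; first by rewrite ifT // EBA.
    rewrite ifF //; apply: contraNF ne => /eqP E.
    by rewrite -(nth_index [::] Bns) E nth_index.
  move=> r _ e _ /(namedP set_ok long)[B HrB].
  have Bns : B \in ns by apply/ns_loc; exists r.
  have eqAB : name_eq M p r <-> B = A.
    rewrite eqP'; split=> [[A' [H1 H2]]|E]; last by exists A; split=> //; rewrite -E.
    by rewrite (nm_det HpA H1) (nm_det HrB H2).
  rewrite !(coded_tasg coded) eqAB.
  have -> : (exists A0 x0, [/\ nm M r A0, coded_asg (enum_rank s') A0 = inl x0 & e = number x0]) <->
            exists x0, choice_of s' B = inl x0 /\ e = number x0.
    rewrite /coded_asg Es'; split=> [[B' [y [HB' Ey ->]]]|[y [Ey ->]]]; last by exists B, y.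
    by exists y; rewrite (nm_det HrB HB').
  rewrite choice_s' //; case: eqP => [E|ne].
    split=> [[y [[<-] ->]]|[[_ ->]|[]//]]; first by left.
    by exists x.
  split=> [[y [Ey ->]]|[[//]|[_ [B' [y [HB' Ey ->]]]]]]; first by right; split=> //; exists B, y.
  by exists y; rewrite (nm_det HrB HB').
split.
  move=> i iN v vN /(coded_val coded)[[|b d] [Ev [j /seg_cons[Hbit Hj]]]]; subst v.
    by left.
  move: Hj => /seg_cons[Hbit' Hd]; right; split=> //.
  have iM := bit_lt Hbit'; exists i.+1; first by lia.
  exists i.+2; first by lia.
  have Hu : tval M i.+2 (word_value d) by apply/(coded_val coded); exists d; split=> //; exists j.
  exists (word_value d); first by move: vN => /=; lia.
  rewrite addn1 addn2; do !split=> //.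
  by case: (b) Hbit' => Hbit' /=; [left|right]; split=> //; lia.
have [HT HA] := (model_satP f_inj rep).2 J_model_K.
split=> //; split=> //.
exists m => //; split.
  by apply/(coded_val coded); exists dg; split; [rewrite dg_m|exists kz].
split; first by lia.
have csm t : match_sat M t kv kb ka -> List.In (map (coded_asg t) cv) cs.
  move=> /(match_satP rep size_an (coded_asg_rep t))[H1 H2]; apply/cs_all.
  by exists (coded_asg t).
split.
  move=> t tN /csm Hin; have [j jcs Hj] := onth_In Hin; exists j; first by lia.
  split; first exact: ((coded_lab coded _ _).2 Hj).
  by exists j.+1; [lia|rewrite addn1; split=> //; lia].
move=> t tN u uN j jN Ht' Hu' /(coded_lab coded) E1 /(coded_lab coded).
rewrite E1 => -[/eq_in_map Etu].
move=> y yN p' p'N d dN Hy -> /(coded_tasg coded)[A [x [HA' Ex ->]]].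
have [A' [HA'c HyA']] := (word_items Hc).1 y Hy.
rewrite addn1 in HA'; apply/(coded_tasg coded); exists A, x; split=> //; first by rewrite addn1.
by rewrite -Etu // (nm_det HA' HyA').
Qed.
End Complete.
End Instance.

(** * The language *)

Lemma word_value_lt d : word_value d < 2 ^ size d.
Proof. by elim: d => //= b d IH; rewrite expnS; case: b => /=; lia. Qed.

Lemma word_value_mkseq m k : word_value (mkseq (fun i => odd (m %/ 2 ^ i)) k) = m %% 2 ^ k.
Proof.
elim: k m => [|k IH] m; first by rewrite modn1.
rewrite /mkseq /= expn0 divn1.
have -> : [seq odd (m %/ 2 ^ i) | i <- iota 1 k] = mkseq (fun i => odd ((m %/ 2) %/ 2 ^ i)) k.
  rewrite /mkseq (iotaDl 1 0) -map_comp; apply: eq_map => i /=.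
  by rewrite -divnMA -expnS.
rewrite -/(word_value _) IH expnS.
have E := divn_eq m 2; have E' := divn_eq (m %/ 2) (2 ^ k).
have Hm : m = m %/ 2 %/ 2 ^ k * (2 * 2 ^ k) + (m %% 2 + (m %/ 2 %% 2 ^ k + m %/ 2 %% 2 ^ k)).
  move: E E'; generalize (m %/ 2) (m %% 2) (2 ^ k) => h r K; move=> -> E'.
  by rewrite {1}E'; generalize (h %/ K) (h %% K) => u v; lia.
rewrite [in RHS]Hm modnMDl [RHS]modn_small; first by rewrite modn2.
have : m %/ 2 %% 2 ^ k < 2 ^ k by rewrite ltn_mod expn_gt0.
have : m %% 2 < 2 by rewrite ltn_mod.
by lia.
Qed.

Lemma word_value_digits m : word_value (binary_digits m) = m.
Proof.
rewrite /binary_digits word_value_mkseq modn_small //.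
by have := up_logP m.+1 (isT : 1 < 2).
Qed.

Lemma canonical_binary_digits m : canonical_digits (binary_digits m).
Proof.
case: m => [|m]; first by left.
right; rewrite /binary_digits; set k := up_log 2 m.+2.
have k0 : 0 < k by rewrite up_log_gt0.
have /andP[H1 H2] : 2 ^ k.-1 < m.+2 <= 2 ^ k by exact: up_log_bounds.
rewrite -nth_last size_mkseq nth_mkseq; last by lia.
suff -> : m.+1 %/ 2 ^ k.-1 = 1 by [].
have P : 0 < 2 ^ k.-1 by rewrite expn_gt0.
have E : 2 ^ k = 2 ^ k.-1 * 2 by rewrite -expnSr prednK.
have U : m.+1 %/ 2 ^ k.-1 < 2 by rewrite ltn_divLR // mulnC -E.
have L : 0 < m.+1 %/ 2 ^ k.-1 by rewrite divn_gt0.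
by lia.
Qed.

(** Without leading zeros the digits are determined by the number; so a word that passes the
    validity test really is the code of an instance. *)
Lemma canonical_value dg : canonical_digits dg -> binary_digits (word_value dg) = dg.
Proof.
move=> dg_can; have Hs : up_log 2 (word_value dg).+1 = size dg.
  case: dg_can => [->//|]; case/lastP: dg => // d b; rewrite last_rcons => b_true.
  rewrite b_true size_rcons; apply: up_log_eq => //.
  have : word_value (rcons d true) = word_value d + 2 ^ size d.
    by elim: (d) => //= c e ->; rewrite expnS; lia.
  by have := word_value_lt d; rewrite expnS; lia.
apply: (@eq_from_nth _ false); rewrite /binary_digits size_mkseq Hs // => i Hi.
rewrite nth_mkseq //; elim: dg i Hi {dg_can Hs} => //= b d IH [|i] Hi /=.
  by rewrite expn0 divn1 oddD addnn odd_double addbF; case: (b).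
rewrite -IH // expnS divnMA; congr (odd (_ %/ _)).
by rewrite addnn -muln2 divnDMl // divn_small //; case: (b).
Qed.

Definition pieces w tb ab av ev cv bd an dg kt kx kv ke kc kb ka kn kz : Prop :=
  kt = 0 /\ seg w kt (enc_list enc_inclusion tb) kx /\
  seg w kx (enc_list enc_assertion ab) kv /\ seg w kv (enc_list enc_word av) ke /\
  seg w ke (enc_list enc_word ev) kc /\ seg w kc (enc_list enc_word cv) kb /\
  seg w kb (enc_list enc_atom bd) ka /\ seg w ka (enc_list enc_word an) kn /\
  seg w kn (enc_word dg) kz /\ kz = size w.

Lemma list_gt0 (T : Type) (enc : T -> seq bool) s : 0 < size (enc_list enc s).
Proof. by rewrite /enc_list size_cat addn1. Qed.

Lemma decomposed_pieces M kt kx kv ke kc kb ka kn kz :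
  set_axiom M -> size (sw M) + 2 < sN M ->
  decomposed M kt kx kv ke kc kb ka kn kz ->
  exists tb ab av ev cv bd an dg, pieces (sw M) tb ab av ev cv bd an dg kt kx kv ke kc kb ka kn kz.
Proof.
move=> set_ok long [Et [H1 [H2 [H3 [H4 [H5 [H6 [H7 [H8 Hz]]]]]]]]].
have [tb Ht] := (parses_list set_ok long (parses_incl set_ok long) proper_incl _ _).1 H1.
have [ab Ha] := (parses_list set_ok long (parses_assert set_ok long) proper_assert _ _).1 H2.
have PW := parses_list set_ok long (parses_word set_ok long) proper_word.
have [av Hv] := (PW _ _).1 H3; have [ev He] := (PW _ _).1 H4; have [cv Hc] := (PW _ _).1 H5.
have [bd Hb] := (parses_list set_ok long (parses_atom set_ok long) proper_atom _ _).1 H6.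
have [an Hn] := (PW _ _).1 H7; have [dg Hd] := (parses_word set_ok long _ _).1 H8.
exists tb, ab, av, ev, cv, bd, an, dg; do !split=> //.
have [_ Hz'] := seg_le Hd (list_gt0 _ _); apply/eqP; rewrite eqn_leq Hz' leqNgt.
by apply/negP => /inposP.
Qed.

Lemma pieces_decomposed M tb ab av ev cv bd an dg kt kx kv ke kc kb ka kn kz :
  set_axiom M -> size (sw M) + 2 < sN M ->
  pieces (sw M) tb ab av ev cv bd an dg kt kx kv ke kc kb ka kn kz ->
  decomposed M kt kx kv ke kc kb ka kn kz.
Proof.
move=> set_ok long [Et [H1 [H2 [H3 [H4 [H5 [H6 [H7 [H8 Hz]]]]]]]]].
have PW := parses_list set_ok long (parses_word set_ok long) proper_word.
split=> //; split; first by apply/(parses_list set_ok long (parses_incl set_ok long) proper_incl); exists tb.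
split; first by apply/(parses_list set_ok long (parses_assert set_ok long) proper_assert); exists ab.
split; first by apply/PW; exists av.
split; first by apply/PW; exists ev.
split; first by apply/PW; exists cv.
split; first by apply/(parses_list set_ok long (parses_atom set_ok long) proper_atom); exists bd.
split; first by apply/PW; exists an.
split; first by apply/(parses_word set_ok long); exists dg.
by move=> /inposP; rewrite Hz ltnn.
Qed.

Lemma pieces_unique w tb ab av ev cv bd an dg kt kx kv ke kc kb ka kn kz
    tb' ab' av' ev' cv' bd' an' dg' kt' kx' kv' ke' kc' kb' ka' kn' kz' :
  pieces w tb ab av ev cv bd an dg kt kx kv ke kc kb ka kn kz ->
  pieces w tb' ab' av' ev' cv' bd' an' dg' kt' kx' kv' ke' kc' kb' ka' kn' kz' ->
  [/\ kt = kt', kx = kx', kv = kv', ke = ke' & kc = kc'] /\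
  [/\ kb = kb', ka = ka', kn = kn' & kz = kz'].
Proof.
have PW := proper_list proper_word.
move=> [Et [H1 [H2 [H3 [H4 [H5 [H6 [H7 [H8 Hz]]]]]]]]] [Et' [H1' [H2' [H3' [H4' [H5' [H6' [H7' [H8' Hz']]]]]]]]].
subst kt kt' kz kz'.
have [_ E1] := seg_unique (proper_list proper_incl) H1 H1'; subst kx'.
have [_ E2] := seg_unique (proper_list proper_assert) H2 H2'; subst kv'.
have [_ E3] := seg_unique PW H3 H3'; subst ke'.
have [_ E4] := seg_unique PW H4 H4'; subst kc'.
have [_ E5] := seg_unique PW H5 H5'; subst kb'.
have [_ E6] := seg_unique (proper_list proper_atom) H6 H6'; subst ka'.
by have [_ E7] := seg_unique PW H7 H7'; subst kn'.
Qed.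

Definition coded_instance tb ab av ev cv bd an m : instance :=
  Instance (KB tb ab) (Query av ev cv bd) an m.

Lemma encode_pieces w tb ab av ev cv bd an m :
  w = encode (coded_instance tb ab av ev cv bd an m) <->
  exists kx kv ke kc kb ka kn,
    pieces w tb ab av ev cv bd an (binary_digits m) 0 kx kv ke kc kb ka kn (size w).
Proof.
have encodeE : encode (coded_instance tb ab av ev cv bd an m) =
    enc_list enc_inclusion tb ++ enc_list enc_assertion ab ++ enc_list enc_word av ++
    enc_list enc_word ev ++ enc_list enc_word cv ++ enc_list enc_atom bd ++
    enc_list enc_word an ++ enc_word (binary_digits m).
  by rewrite /encode /enc_kb /enc_query -!(catA (enc_list _ _)).
rewrite encodeE; split=> [E|].
  have : seg w 0 w (size w) by split; rewrite ?drop0 ?drop_size ?cats0.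
  rewrite {2}E => /seg_cat[kx H1 /seg_cat[kv H2 /seg_cat[ke H3 /seg_cat[kc H4 /seg_cat[kb H5]]]]].
  move=> /seg_cat[ka H6 /seg_cat[kn H7 H8]].
  by exists kx, kv, ke, kc, kb, ka, kn.
case=> kx [kv [ke [kc [kb [ka [kn [_ [H1 [H2 [H3 [H4 [H5 [H6 [H7 [H8 _]]]]]]]]]]]]]]].
set u := enc_list _ _ ++ _; have [+ _] : seg w 0 u (size w); last by rewrite drop0 drop_size cats0.
by apply/seg_cat; exists kx => //; apply/seg_cat; exists kv => //; apply/seg_cat; exists ke => //;
  apply/seg_cat; exists kc => //; apply/seg_cat; exists kb => //; apply/seg_cat; exists ka => //;
  apply/seg_cat; exists kn.
Qed.

(** * Existence of the relations *)

Definition set_rel (n X i : nat) : bool :=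
  [exists o : 'I_n, (val o == i) && (o \in nth set0 (enum {set 'I_n}) X)].

Lemma set_axiom_holds M : 2 ^ size (sw M) <= sN M ->
  (forall X i, sG M RSet X i i = set_rel (size (sw M)) X i) -> set_axiom M.
Proof.
move=> HN HG; set n := size (sw M) in HN HG.
have card_set : #|{: {set 'I_n}}| = 2 ^ n.
  by have := card_powerset [set: 'I_n]; rewrite powersetT !cardsT card_ord.
have code_lt (S : {set 'I_n}) : enum_rank S < sN M.
  by apply: leq_trans (ltn_ord _) _; rewrite -?cardE card_set.
have codeE (S : {set 'I_n}) : nth set0 (enum {set 'I_n}) (enum_rank S) = S.
  exact: nth_enum_rank.
split.
  exists (enum_rank (set0 : {set 'I_n})) => // i iN.
  by rewrite /sset HG /set_rel codeE => /existsP[o]; rewrite inE andbF.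
move=> X XN i iN /inposP iM.
set S := nth set0 (enum {set 'I_n}) X.
exists (enum_rank (Ordinal iM |: S)) => // k kN; rewrite /sset !HG /set_rel codeE -/S; split.
  case/existsP=> o /andP[/eqP Eo]; rewrite !inE => /orP[/eqP E|oS].
    by right; rewrite -Eo E.
  by left; apply/existsP; exists o; rewrite Eo eqxx.
case=> [/existsP[o /andP[Eo oS]]|->]; apply/existsP.
  by exists o; rewrite Eo !inE oS orbT.
by exists (Ordinal iM); rewrite !inE !eqxx.
Qed.

Definition word_step (w : seq bool) (a b : nat) : Prop :=
  [/\ onth w a = Some true, b < size w & exists A, seg w a.+1 (enc_word A) b].

Lemma step_axiom_holds M : set_axiom M -> size (sw M) + 2 < sN M ->
  (forall k y j, sG M RStep k y j = `[< chain (word_step (sw M)) k j y >]) -> step_axiom M.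
Proof.
move=> set_ok long HG.
have stepE c a b : lstep pword M c a b <-> word_step (sw M) a b.
  split=> [[Ha [/inposP bM [k _ [->]]]]|[Ha bM [A HA]]].
    by rewrite addn1 => /(parses_word set_ok long)[A HA]; split=> //; exists A.
  split=> //; split; first exact/inposP.
  have aM := @bit_lt M a true Ha; exists a.+1; first by lia.
  by rewrite addn1; split=> //; apply/(parses_word set_ok long); exists A.
move=> k kN y yN j jN; rewrite /tcnt HG; split=> [/asboolP H|].
  inversion H as [|i x z Hx Hxy]; subst; first by left.
  right; have [/(@bit_lt M x true) xM _ _] := Hxy.
  exists x; first by lia.
  exists i; first by lia.
  by rewrite /tcnt HG addn1; split; [exact/asboolP|split=> //; exact/stepE].
case=> [[-> ->]|[x xN [i iN [H [/stepE Hxy ->]]]]]; apply/asboolP; first exact: chain0.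
by rewrite addn1; apply: chainS Hxy; move: H; rewrite /tcnt HG => /asboolP.
Qed.

Definition tables (w : seq bool) (dm : nat -> Prop) (id cn : nat -> nat -> Prop)
    (rl sg : nat -> nat -> nat -> Prop) (vl lb : nat -> nat -> Prop)
    (c : relsym) (x y z : nat) : bool :=
  match c with
  | RSet => set_rel (size w) x y
  | RStep => `[< chain (word_step w) x z y >]
  | RDom => `[< dm x >]
  | RInd => `[< id x y >]
  | RConcept => `[< cn x y >]
  | RRole => `[< rl x y z >]
  | RAssign => `[< sg x y z >]
  | RValue => `[< vl x y >]
  | RLabel => `[< lb x y >]
  end.

Lemma size_seg w i u j : seg w i u j -> size u <= size w.
Proof. by case=> /(congr1 size); rewrite size_cat size_drop; lia. Qed.

Lemma size_enc_list (T : Type) (enc : T -> seq bool) s : size s <= size (enc_list enc s).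
Proof. by rewrite /enc_list size_cat addn1; elim: s => //= x s; rewrite size_cat; lia. Qed.

Lemma size_body_terms q : size (body_terms q) <= size (enc_list enc_atom (body q)).
Proof.
rewrite /body_terms /enc_list size_cat; elim: (body q) => //= F s; rewrite !size_cat /=.
have Hw A : 0 < size (enc_word A) by exact: list_gt0.
suff : size (atom_terms F) <= size (enc_atom F) by lia.
case: F => [A t|P t u] //; rewrite -[size (enc_atom _)]/(size (enc_word P ++ _)).+1 size_cat.
by have := Hw P; rewrite /=; lia.
Qed.

Lemma node_bound_le n s t r : s <= n -> t <= n -> r <= 2 ^ (2 * n + 1) ->
  node_bound s t r <= 2 ^ ((n + 5) ^ 2).
Proof.
(* [E] bounds the exponents of all three summands; its quadratic term comes from the paths of roles.
   The factor 4 below covers their sum. *)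
move=> sn tn rn; pose E := n * n + 8 * n + 2.
have le a b : a <= b -> 2 ^ a <= 2 ^ b by move=> ab; rewrite leq_exp2l.
have nE : n < 2 ^ n by exact: ltn_expl.
have H1 : r <= 2 ^ E by apply: leq_trans rn _; apply: le; rewrite /E; nia.
have H2 : t.+1 * r * (s * 2) ^ t.+1 <= 2 ^ E.
  have Ht : t.+1 <= 2 ^ n by lia.
  have Hs : (s * 2) ^ t.+1 <= 2 ^ (n.+1 * n.+1).
    apply: (@leq_trans ((2 ^ n.+1) ^ t.+1)).
      by rewrite leq_exp2r // expnS; lia.
    by rewrite -expnM; apply: le; rewrite leq_mul2l; lia.
  apply: (@leq_trans (2 ^ n * 2 ^ (2 * n + 1) * 2 ^ (n.+1 * n.+1))).
    by rewrite !leq_mul.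
  by rewrite -!expnD; apply: le; rewrite /E; nia.
have H3 : 3 * (2 ^ s * 2 ^ (s * 2) * 2 ^ (s * 2) * (2 ^ s * 2 ^ (s * 2))) <= 4 * 2 ^ (8 * n).
  by rewrite leq_mul // -!expnD; apply: le; lia.
have H4 : 4 * 2 ^ (8 * n) <= 2 ^ E.
  by rewrite -[4]/(2 ^ 2) -expnD; apply: le; rewrite /E; nia.
apply: (@leq_trans (4 * 2 ^ E)); first by rewrite /node_bound; lia.
by rewrite -[4]/(2 ^ 2) -expnD; apply: le; rewrite /E; nia.
Qed.

Lemma no_answer_exists w : ~ ccq_answering (fun q => exhaustive q /\ rooted q) w ->
  exists G, no_answer (Structure (2 ^ ((size w + 5) ^ 3)) w G).
Proof.
move=> not_answer; set n := size w; set N := 2 ^ _.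
have le a b : a <= b -> 2 ^ a <= 2 ^ b by move=> ab; rewrite leq_exp2l.
have n_le : n + 2 <= (n + 5) ^ 3 by rewrite !expnS expn0; nia.
have long : n + 2 < N by apply: leq_trans (ltn_expl (n + 2) (isT : 1 < 2)) _; exact: le.
have setN : 2 ^ n <= N by apply: le; lia.
have base dm id cn rl sg vl lb : let M := Structure N w (tables w dm id cn rl sg vl lb) in
    set_axiom M /\ step_axiom M.
  move=> M; have set_ok : set_axiom M by exact: set_axiom_holds.
  by split=> //; exact: step_axiom_holds.
have [[tb [ab [av [ev [cv [bd [an [dg H]]]]]]]]|none] := pselect (exists tb ab av ev cv bd an dg,
    (exists kx kv ke kc kb ka kn, pieces w tb ab av ev cv bd an dg 0 kx kv ke kc kb ka kn n) /\
    [/\ exhaustive (Query av ev cv bd), rooted (Query av ev cv bd), is_ccq (Query av ev cv bd),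
        size an = size av & {subset an <= Ind ab}] /\ canonical_digits dg); last first.
  (* With no valid instance in [w], only the tables for sets and steps matter; the others may be
     empty. *)
  pose F1 (_ : nat) := False; pose F2 (_ _ : nat) := False; pose F3 (_ _ _ : nat) := False.
  exists (tables w F1 F2 F2 F3 F3 F2 F2); set M := Structure _ _ _.
  have [set_ok step_ok] : set_axiom M /\ step_axiom M by exact: base.
  split=> //; split=> // kt _ kx _ kv _ ke _ kc _ kb _ ka _ kn _ kz _.
  move=> /(decomposed_pieces set_ok long)[tb [ab [av [ev [cv [bd [an [dg HP]]]]]]]] HV.
  case: none; exists tb, ab, av, ev, cv, bd, an, dg; split.
    exists kx, kv, ke, kc, kb, ka, kn.
    by case: (HP) => Ekt [_ [_ [_ [_ [_ [_ [_ [_ Ekz]]]]]]]]; subst kt kz.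
  case: HP => _ [H1 [H2 [H3 [H4 [H5 [H6 [H7 [H8 _]]]]]]]].
  exact: (validP set_ok long step_ok H2 H3 H4 H5 H6 H7 H8).1 HV.
case: H => [[kx [kv [ke [kc [kb [ka [kn HP]]]]]]] [[q_exh q_rooted q_ccq size_an an_ind] dg_can]].
set q := Query av ev cv bd in q_exh q_rooted q_ccq.
pose m := word_value dg; have dgE : binary_digits m = dg by exact: canonical_value.
have [I [I_model I_few]] : exists I, model I (KB tb ab) /\ ~ at_least_c_matches I q an m.
  have Hw : w = encode (coded_instance tb ab av ev cv bd an m).
    by apply/encode_pieces; rewrite dgE; exists kx, kv, ke, kc, kb, ka, kn.
  have /existsNP[I /not_implyP[HI few]] : ~ certain_answer (KB tb ab) q an m; last by exists I.
  by move=> cert; apply: not_answer; exists (coded_instance tb ab av ev cv bd an m).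
have [_ [H1 [H2 [H3 [H4 [H5 [H6 [H7 [H8 _]]]]]]]]] := HP.
pose F1 (_ : nat) := False; pose F2 (_ _ : nat) := False; pose F3 (_ _ _ : nat) := False.
(* Which names occur depends on the word alone, so a structure with empty tables serves to locate
   them before the tables of the countermodel can be defined. *)
pose M0 := Structure N w (tables w F1 F2 F2 F3 F3 F2 F2).
have [set_ok0 _] : set_axiom M0 /\ step_axiom M0 by exact: base.
have long0 : size (sw M0) + 2 < sN M0 by [].
have [ns [ns_uniq ns_n ns_loc]] := located_names long0.
have [||||D [C [R [f [f_inj [D_card J_model J_few]]]]]] := small_countermodel (ns := ns) _ _ _ _
  q_ccq q_exh q_rooted I_model I_few.
- by move=> F HF A HA; apply/ns_loc; exact: (tbox_located set_ok0 long0 H1 HF HA).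
- by move=> F HF A HA; apply/ns_loc; exact: (abox_located set_ok0 long0 H2 HF HA).
- by move=> F HF A HA; apply/ns_loc; exact: (body_located set_ok0 long0 H6 HF HA).
- by move=> A HA; apply/ns_loc; exact: (answer_located set_ok0 long0 H7 HA).
have [cs cs_m cs_all] := finitely_many J_few.
pose dm d := exists x : D, d = number x.
pose id p d := exists b, nm M0 p b /\ d = number (f b).
pose cn p d := exists A x, [/\ nm M0 p A, d = number x & C A x].
pose rl p d e := exists P x y, [/\ nm M0 p P, d = number x, e = number y & R P x y].
pose sg t p d := exists A x, [/\ nm M0 p A, coded_asg f ns t A = inl x & d = number x].
pose vl i v := exists d, v = word_value d /\ exists j, seg w i (enc_word d) j.
pose lb t j := onth cs j = Some (map (coded_asg f ns t) cv).
exists (tables w dm id cn rl sg vl lb); set M := Structure _ _ _.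
have [set_ok step_ok] : set_axiom M /\ step_axiom M by exact: base.
have coded : coded_tables M cv C R f ns cs.
  by split; intros; rewrite /dom /tind /tcon /trol /tasg /tval /tlab /= asboolE.
split=> //; split=> // kt' _ kx' _ kv' _ ke' _ kc' _ kb' _ ka' _ kn' _ kz' _.
move=> /(decomposed_pieces set_ok long)[tb' [ab' [av' [ev' [cv' [bd' [an' [dg' HP']]]]]]]] _.
have [[E1 E2 E3 E4 E5] [E6 E7 E8 E9]] := pieces_unique HP HP'.
subst kt' kx' kv' ke' kc' kb' ka' kn' kz'.
have word_n k s l : seg w k (enc_list enc_word s) l -> size s <= n.
  by move=> /size_seg; apply: leq_trans; exact: size_enc_list.
have m_n : m < 2 ^ n.
  apply: leq_trans (word_value_lt dg) _; apply: le.
  by apply: leq_trans (size_enc_list (fun b => [:: b]) dg) (size_seg H8).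
have D_small : #|D| <= 2 ^ ((n + 5) ^ 2).
  apply: leq_trans D_card (node_bound_le ns_n _ _).
    exact: leq_trans (size_body_terms q) (size_seg H6).
  have n2 : n < 2 ^ n by exact: ltn_expl.
  have -> : 2 ^ (2 * n + 1) = 2 ^ n * 2 ^ n * 2 by rewrite expnD mulnC mul2n -addnn expnD expn1 mulnC.
  apply: (@leq_trans (n + 2 ^ n * n)); last by move: (2 ^ n) n2 => K; nia.
  by apply: leq_add => //; apply: leq_mul (ltnW m_n) (word_n _ _ _ H5).
apply: (countermodel_complete set_ok long step_ok H1 H2 H3 H5 H6 H7 H8 ns_loc cs_m cs_all) => //.
- by apply: leq_trans D_small _; apply: le; rewrite leq_pexp2l //; lia.
- rewrite card_ffun card_ord; apply: leq_trans (_ : (2 ^ ((n + 5) ^ 2)) ^ size ns <= _).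
    by case: (size ns) => // k; rewrite leq_exp2r.
  by rewrite -expnM; apply: le; rewrite [leqRHS]expnSr leq_mul //= (leq_trans ns_n) // leq_addr.
- exact: leq_trans m_n setN.
Qed.

Lemma no_answer_sound w G : no_answer (Structure (2 ^ ((size w + 5) ^ 3)) w G) ->
  ~ ccq_answering (fun q => exhaustive q /\ rooted q) w.
Proof.
set N := 2 ^ _; set M := Structure _ _ _ => -[set_ok [step_ok no]].
have long : size (sw M) + 2 < sN M.
  apply: leq_trans (ltn_expl (size w + 2) (isT : 1 < 2)) _.
  by rewrite leq_exp2l // !expnS expn0; nia.
case=> -[[tb ab] [av ev cv bd] an m] [/encode_pieces[kx [kv [ke [kc [kb [ka [kn HP]]]]]]]].
move=> [/= q_ccq size_an an_ind] [q_exh q_rooted] cert.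
have [_ [H1 [H2 [H3 [H4 [H5 [H6 [H7 [H8 _]]]]]]]]] := HP.
have lt (T : Type) (enc : T -> seq bool) s i j : seg w i (enc_list enc s) j -> i < N.
  by case/seg_le => [|+ _]; [exact: list_gt0|move: long; rewrite /=; lia].
have V : valid M kx kv ke kc kb ka kn (size w).
  apply/(validP set_ok long step_ok H2 H3 H4 H5 H6 H7 H8); split=> //.
  exact: canonical_binary_digits.
have N0 : 0 < N by rewrite expn_gt0.
apply: (countermodel_sound set_ok long step_ok H1 H2 H3 H5 H6 H7 H8 _
  (word_value_digits m) q_exh q_rooted q_ccq size_an cert).
apply: (no 0 _ kx _ kv _ ke _ kc _ kb _ ka _ kn _ (size w) _
  (pieces_decomposed set_ok long HP) V) => //; try exact: lt; eauto.
by move: long; rewrite /=; lia.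
Qed.

Theorem theorem9 : coNEXP (ccq_answering (fun q => exhaustive q /\ rooted q)).
Proof.
have [f Hf] := definable_no_answer.
have [M [p [HM Hacc]]] := eso_NEXP f (isT : 1 < 5).
exists M, p; split=> // w; rewrite -Hacc.
have satE G := Hf (Structure (2 ^ ((size w + 5) ^ 3)) w G) (fun _ => 0) (fun _ => _).
split=> [/no_answer_exists[G HG]|[G HG]].
  by exists G; apply/satE => //=; rewrite expn_gt0.
by apply: (@no_answer_sound w G); apply/satE => //=; rewrite expn_gt0.
Qed.
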